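(* Let $p$ be an odd prime. For a chord diagram $D$ on a closed oriented one-dimensional manifold $X$ with connected components $X_1,\dots,X_n$, put $$\omega^{(p)}_{sl(2)}(D)\equiv\sum_{\vec\lambda}\Delta_{\vec\lambda}\,\omega^{T}_{\vec\lambda}(D)\pmod p ,\qquad \Delta_{\vec\lambda}=\prod_{i=1}^n(-1)^{\lambda_i}(\lambda_i+1),$$ where the sum is over all $\vec\lambda=(\lambda_1,\dots,\lambda_n)$ with $\lambda_i\in I_p=\{0,1,\dots,p-2\}$, and let $\omega^{(p)}_{so(3)}(D)$ be defined by the same formula with the sum restricted to $\lambda_i\in I_p\cap 2\mathbb Z$. Then $\omega^{(p)}_{sl(2)}$ and $\omega^{(p)}_{so(3)}$ are Kirby weight systems with values in the field $\mathbb Z/p\mathbb Z$.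
   Context: **Planar tangles.** A $(k,l)$ tangle is a generic immersion (only transverse double points, no over/under information) of a compact 1-manifold in $\mathbb R\times[0,1]$, with boundary $k$ points on $\mathbb R\times\{0\}$ and $l$ points on $\mathbb R\times\{1\}$, up to ambient isotopy. Let $\mathcal S(k,l)$ be the $\mathbb Q$-vector space generated by $(k,l)$ tangles modulo: (i) $T\cup O=-2T$, $O$ a disjoint circle; (ii) the local skein relation $(\text{crossing})+(\text{two vertical strands})+(\text{cup}\cdot\text{cap})=0$. Then $\mathcal S(0,0)=\mathbb Q$ (generated by the empty tangle). In $\mathcal S$ the Reidemeister moves (curl removal, II, III, for flat crossings) hold. For $n\ge0$, $f_n=\frac1{n!}\sum_{\sigma\in\Sigma(n)}(-1)^{|\sigma|}T(\sigma)\in\mathcal S(n,n)$, with $T(\sigma)$ the permutation tangle of $\sigma$ and $(-1)^{|\sigma|}$ its signature. **Spin networks.** A triple $(i,j,k)$ of nonnegative integers is admissible if $i+j+k$ is even and $i+j\ge k$, $i+k\ge j$, $j+k\ge i$. A spin network is a trivalent graph (closed loops allowed) with a cyclic orientation at each vertex and a colouring of edges by nonnegative integers such that the triple at each vertex is admissible. Its evaluation $e(\Gamma)\in\mathcal S(0,0)=\mathbb Q$: immerse $\Gamma$ in the plane so that the cyclic orientation at each vertex is counterclockwise; replace each edge coloured $i$ by $i$ parallel strands with $f_i$ inserted; at each vertex coloured $(i,j,k)$ join the strands without crossings by $\frac{-i+j+k}2$ arcs between $j$ and $k$, $\frac{i-j+k}2$ arcs between $i$ and $k$, $\frac{i+j-k}2$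 arcs between $i$ and $j$. The result is independent of the immersion. **Chord diagrams.** A chord diagram on $X$ is $D=\bar D\cup X$ with $\bar D$ a graph with univalent and trivalent vertices, a cyclic orientation at each trivalent (internal) vertex, and univalent vertices lying at distinct points of $X$. $n_i(D)$ is the number of univalent vertices on $X_i$; $d^\circ(D)$ is half the total number of vertices of $\bar D$. $\mathcal A(X)$ is the $\mathbb Z$-module generated by chord diagrams modulo the relations AS, IHX and STU. STU convention: for a piece of $X$ drawn vertically, oriented upwards, with legs to the right, (two parallel legs) $-$ (two crossed legs) $=$ (one leg ending in an internal vertex from which the two legs issue, planar counterclockwise orientation). A weight system is a linear form (with values in some abelian group) on chord diagrams compatible with AS, IHX, STU. **The weight system $\omega^T_{\vec\lambda}$.** For $\vec\lambda=(\lambda_1,\dots,\lambda_n)$ with $\lambda_i\in I_p$: $\omega^T_{\vec\lambda}(D)=2^{I(D)}\prod_i\lambda_i^{n_i(D)}\,e(\Gamma_{D,\vec\lambda})$, where $I(D)$ is the number of internal vertices and $\Gamma_{D,\vec\lambda}$ is the spin network with underlying graph $D$, arcs of $X_i$ coloured $\lambda_i$, edges of $\bar D$ coloured $2$, the given cyclic orientation at internal vertices, and at a univalent vertex of $\bar D$ on $X$ the cyclic order (leg, outgoing arc of $X$, incoming arc of $X$). (The value is $0$ if some $\lambda_i=0$ and $n_i(D)>0$.) These values are rational numbers with denominator prime to $p$, so they can be reduced mod $p$. **Kirby weight system.** A weight system $\omega$ (defined for all $X$) is independent of orientation if $\omega(D)=(-1)^{n_i(D)}\omega(\hat D)$ whenever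 $\hat D$ is obtained from $D$ by reversing the orientation of the component $X_i$. It is a Kirby weight system if it is independent of orientation and satisfies the handle-slide relation $\omega(D)=\omega(D')$ for all distinct components $X_i,X_j$, where $D'$ is obtained from $D$ by choosing a point of $X_j$ and a point of $X_i$ (both different from vertices), replacing a small arc of $X_j$ at the chosen point by an arc running parallel to all of $X_i$ cut at its chosen point, and replacing each univalent vertex on $X_i$ by the sum of the two ways of attaching that leg to $X_i$ or to the parallel arc of $X_j$; thus $D'$ is a sum of $2^{n_i(D)}$ chord diagrams. *)

(* Defs.v *)
From HB Require Import structures.
From Stdlib Require Import ClassicalEpsilon.
From mathcomp Require Import all_boot all_order all_fingroup all_algebra.
From mathcomp Require Import monalg.

Set Implicit Arguments.
Unset Strict Implicit.
Unset Printing Implicit Defensive.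

Import GRing.Theory.
Local Open Scope ring_scope.

(* A generic tangle is put in general position with respect to the height
   function of R x [0, 1] and cut into slices containing a single local minimum
   (cup), local maximum (cap) or double point, listed from bottom to top.
   A slice (g, i) has i strands to the left of the piece g. *)
Inductive piece := Cup | Cap | Cross.

Definition ord_of_piece g : 'I_3 :=
  match g with Cup => inord 0 | Cap => inord 1 | Cross => inord 2 end.
Definition piece_of_ord (k : 'I_3) :=
  match val k with 0%N => Cup | 1%N => Cap | _ => Cross end.
Lemma ord_of_pieceK : cancel ord_of_piece piece_of_ord.
Proof. by case; rewrite /piece_of_ord /= inordK. Qed.
HB.instance Definition _ := Choice.copy piece (can_type ord_of_pieceK).

Definition src g : nat := match g with Cup => 0 | _ => 2 end.
Definition tgt g : nat := match g with Cap => 0 | _ => 2 end.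

Definition slice := (piece * nat)%type.

Fixpoint is_tangle (k l : nat) (w : seq slice) : bool :=
  if w is (g, i) :: w' then
    (i + src g <= k)%N && is_tangle (k - src g + tgt g) l w'
  else k == l.

(* Local moves generating ambient isotopy of plane immersed curves: distant
   slices may be exchanged, a pair consisting of a minimum and a maximum may be
   straightened, and a double point may be moved across an extremum. *)
Inductive isotopy : seq slice -> seq slice -> Prop :=
| isotopy_far g h (i j : nat) : (i <= j)%N ->
    isotopy [:: (g, i); (h, (j + tgt g)%N)] [:: (h, (j + src g)%N); (g, i)]
| isotopy_zigzagl i : isotopy [:: (Cup, i); (Cap, i.+1)] [::]
| isotopy_zigzagr i : isotopy [:: (Cup, i.+1); (Cap, i)] [::]
| isotopy_cup i : isotopy [:: (Cup, i); (Cross, i.+1)]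
                          [:: (Cup, i.+1); (Cross, i)]
| isotopy_cap i : isotopy [:: (Cross, i.+1); (Cap, i)]
                          [:: (Cross, i); (Cap, i.+1)].

(* Formal rational combinations of tangles; the product stacks the right factor
   on top of the left one. *)
Definition tangles := {malg rat[{fmonom slice}]}.

Definition tg (w : seq slice) : tangles := << FMonom w >>.

Inductive skein_relator (k l : nat) : tangles -> Prop :=
| skein_isotopy u v r r' : isotopy r r' ->
    is_tangle k l (u ++ r ++ v) -> is_tangle k l (u ++ r' ++ v) ->
    skein_relator k l (tg (u ++ r ++ v) - tg (u ++ r' ++ v))
| skein_circle u v i : is_tangle k l (u ++ [:: (Cup, i); (Cap, i)] ++ v) ->
    skein_relator k l
      (tg (u ++ [:: (Cup, i); (Cap, i)] ++ v) - (- 2%:R) *: tg (u ++ v))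
| skein_crossing u v i : is_tangle k l (u ++ [:: (Cross, i)] ++ v) ->
    skein_relator k l
      (tg (u ++ [:: (Cross, i)] ++ v) + tg (u ++ v)
       + tg (u ++ [:: (Cap, i); (Cup, i)] ++ v)).

(* The linear span of the relators: S(k, l) is the quotient of the combinations
   of (k, l) tangles by skein_null k l. *)
Inductive skein_null (k l : nat) : tangles -> Prop :=
| skein_null0 : skein_null k l 0
| skein_null_lin (q : rat) x y : skein_relator k l x -> skein_null k l y ->
    skein_null k l (q *: x + y).

(* The identification S(0, 0) = Q given by the class of the empty tangle 1. *)
Definition skein_value (x : tangles) : rat :=
  epsilon (inhabits 0) (fun q => skein_null 0 0 (x - q *: 1)).

(* Permutation tangle, each strand being given by its upper end: the strands
   after the first one are permuted, then the first one crosses those strands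
   ending to its left. *)
Fixpoint perm_word (o : nat) (s : seq nat) : seq slice :=
  if s is x :: s' then
    perm_word o.+1 s' ++
    [seq (Cross, (o + t)%N) | t <- iota 0 (count (fun y => (y < x)%N) s')]
  else [::].

Definition perm_tangle n (s : 'S_n) : tangles :=
  tg (perm_word 0 [seq val (s i) | i <- enum 'I_n]).

Definition symmetrizer (n : nat) : tangles :=
  (n`!%:R : rat)^-1 *: \sum_(s : 'S_n) (-1) ^+ s *: perm_tangle s.

Definition admissible (i j k : nat) : bool :=
  [&& ~~ odd (i + j + k), (k <= i + j)%N, (j <= i + k)%N & (i <= j + k)%N].

(* A vertex is the triple of the edges met counterclockwise around it; a non
   closed edge has two ends and hence occurs twice among all these triples.
   A closed loop without vertices is given by its colour. *)
Record spin_network (E : eqType) := SpinNetwork {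
  sn_vert : seq (E * E * E);
  sn_colour : E -> nat;
  sn_loop : seq nat }.

Section Evaluation.
Variables (E : eqType) (G : spin_network E).
Local Notation col := (sn_colour G).

Definition triple_ends (T : Type) (v : T * T * T) : seq T :=
  [:: v.1.1; v.1.2; v.2].

Definition nested_cups (o n : nat) : seq slice :=
  [seq (Cup, (o + t)%N) | t <- iota 0 n].
Definition nested_caps (o n : nat) : seq slice :=
  [seq (Cap, (o + t)%N) | t <- rev (iota 0 n)].

(* A vertex from which three edges, coloured x, y, z from left to right, go
   upwards, to the right of o strands. *)
Definition vertex_word (o x y z : nat) : seq slice :=
  let xz := (x + z - y)./2 in
  let xy := (x + y - z)./2 in
  let yz := (y + z - x)./2 in
  nested_cups o xz ++ nested_cups (o + xz) xy
    ++ nested_cups (o + xz + xy.*2) yz.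

(* All vertices stand in a row with their edges going upwards; the
   counterclockwise order around a vertex is then from right to left. *)
Fixpoint vertex_row (o : nat) (vs : seq (E * E * E)) : seq slice :=
  if vs is (a, b, c) :: vs' then
    vertex_word o (col c) (col b) (col a)
      ++ vertex_row (o + (col a + col b + col c)) vs'
  else [::].
Definition row_ends (vs : seq (E * E * E)) : seq E :=
  flatten [seq rev (triple_ends v) | v <- vs].

(* n parallel strands going from right to left over m strands. *)
Definition cable_word (n m : nat) : seq slice :=
  flatten [seq [seq (Cross, (n + j + t)%N) | t <- iota 0 n]
          | j <- rev (iota 0 m)].

(* Joins the two ends of every edge, starting with the edge of the leftmost end:
   its other end is brought next to the first one across the edges in between.
   The first argument bounds the number of ends. *)
Fixpoint close_edges (N : nat) (s : seq E) : tangles :=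
  match N, s with
  | N'.+1, x :: s' =>
      let n := col x in
      let m := sumn [seq col y | y <- take (index x s') s'] in
      symmetrizer n * tg (cable_word n m ++ nested_caps 0 n)
        * close_edges N' (rem x s')
  | _, _ => 1
  end.

Definition loop_tangle (n : nat) : tangles :=
  tg (nested_cups 0 n) * symmetrizer n * tg (nested_caps 0 n).

Definition sn_tangle : tangles :=
  let s := row_ends (sn_vert G) in
  (\prod_(n <- sn_loop G) loop_tangle n)
    * tg (vertex_row 0 (sn_vert G)) * close_edges (size s) s.

(* The evaluation does not depend on the immersion, and sn_tangle uses a standard
   one; it is extended by 0 to colourings that are not admissible. *)
Definition sn_eval : rat :=
  if all (fun v => admissible (col v.1.1) (col v.1.2) (col v.2)) (sn_vert G)
  then skein_value sn_tangle else 0.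

End Evaluation.

(* Codes of chord diagrams on n oriented circles. The edges of the uni-trivalent
   graph are labelled by distinct integers; ivert lists the internal vertices,
   each given by the edges met in its cyclic order, and legs i lists the edges of
   the univalent vertices met along the i-th circle. *)
Record diagram (n : nat) := Diagram {
  legs : {ffun 'I_n -> seq nat};
  ivert : seq (nat * nat * nat) }.

Section Diagrams.
Variable n : nat.
Implicit Types D : diagram n.

Definition ends D : seq nat :=
  flatten [seq triple_ends v | v <- ivert D]
    ++ flatten [seq legs D i | i <- enum 'I_n].

Definition is_diagram D : bool :=
  all (fun a => count_mem a (ends D) == 2) (ends D).

Definition triple_map (f : nat -> nat) (v : nat * nat * nat) :=
  (f v.1.1, f v.1.2, f v.2).
Definition same_vertex (u v : nat * nat * nat) : bool :=
  let: (a, b, c) := v in u \in [:: (a, b, c); (b, c, a); (c, a, b)].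

(* Two codes of the same diagram, up to the labels of the edges and the
   numbering of the vertices and of the circles, and up to the cyclic order at
   internal vertices and along the circles. *)
Definition same_diagram D D' : Prop :=
  exists (f : nat -> nat) (s : 'S_n) (r : 'I_n -> nat) t,
    [/\ injective f,
        forall i, legs D' (s i) = rot (r i) (map f (legs D i)),
        perm_eq (ivert D') t
      & all2 same_vertex t (map (triple_map f) (ivert D))].

Definition set_legs D (i : 'I_n) (w : seq nat) : diagram n :=
  Diagram [ffun k => if k == i then w else legs D k] (ivert D).
Definition set_ivert D vs : diagram n := Diagram (legs D) vs.

(* a and b are the chosen points of X_i and X_j. The arc of X_j parallel to X_i
   runs in the direction of X_i; it receives the legs of X_i at the positions
   where m is true. *)
Definition handle_slide D (i j : 'I_n) (a b : nat) (m : seq bool) : diagram n :=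
  let w := rot a (legs D i) in
  set_legs (set_legs D i (mask (map negb m) w)) j
           (rot b (legs D j) ++ mask m w).

End Diagrams.

Section WeightSystems.
Variables (V : zmodType) (omega : forall n, diagram n -> V).

Definition relation_AS := forall n (D : diagram n) a b c vs,
  is_diagram D -> ivert D = (a, b, c) :: vs ->
  omega (set_ivert D ((b, a, c) :: vs)) = - omega D.

(* The Jacobi form of IHX: the ends a, b, c are permuted cyclically. *)
Definition relation_IHX := forall n (D : diagram n) a b c d e vs,
  is_diagram D -> ivert D = [:: (a, b, e), (e, c, d) & vs] ->
  omega D + omega (set_ivert D [:: (b, c, e), (e, a, d) & vs])
          + omega (set_ivert D [:: (c, a, e), (e, b, d) & vs]) = 0.

(* With X_i going upwards and its legs to the right, x is below y in the first
   diagram, so that (e, x, y) is the counterclockwise order in the last one. *)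
Definition relation_STU := forall n (D : diagram n) i x y w e,
  is_diagram D -> legs D i = [:: x, y & w] -> e \notin ends D ->
  omega D - omega (set_legs D i [:: y, x & w])
    = omega (set_ivert (set_legs D i (e :: w)) ((e, x, y) :: ivert D)).

Definition weight_system : Prop :=
  [/\ forall n (D D' : diagram n),
        is_diagram D -> same_diagram D D' -> omega D = omega D',
      relation_AS, relation_IHX & relation_STU].

Definition orientation_independent : Prop :=
  forall n (D : diagram n) i, is_diagram D ->
    omega D = omega (set_legs D i (rev (legs D i))) *~ (-1) ^+ size (legs D i).

Definition handle_slide_relation : Prop :=
  forall n (D : diagram n) (i j : 'I_n) (a b : nat), is_diagram D -> i != j ->
    omega D = \sum_(m : (size (legs D i)).-tuple bool)
                 omega (handle_slide D i j a b m).

Definition kirby_weight_system : Prop :=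
  [/\ weight_system, orientation_independent & handle_slide_relation].

End WeightSystems.

Section OmegaT.
Variables (n : nat) (lam : 'I_n -> nat) (D : diagram n).

(* inl a is the edge a of the uni-trivalent graph, and inr (i, k) the arc of X_i
   going out of its k-th vertex; vertices are (leg, outgoing, incoming). *)
Definition arc_edge := (nat + 'I_n * nat)%type.

Definition circle_vertices (i : 'I_n) : seq (arc_edge * arc_edge * arc_edge) :=
  let m := size (legs D i) in
  [seq (inl (nth 0%N (legs D i) k), inr (i, k), inr (i, (k + m.-1) %% m)%N)
  | k <- iota 0 m].

Definition diagram_network : spin_network arc_edge :=
  SpinNetwork
    ([seq (inl v.1.1, inl v.1.2, inl v.2) | v <- ivert D]
       ++ flatten [seq circle_vertices i | i <- enum 'I_n])
    (fun x => match x with inl _ => 2%N | inr y => lam y.1 end)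
    [seq lam i | i <- enum 'I_n & nilp (legs D i)].

Definition omegaT : rat :=
  2%:R ^+ size (ivert D) * (\prod_(i < n) (lam i)%:R ^+ size (legs D i))
    * sn_eval diagram_network.

End OmegaT.

Definition Delta n (lam : 'I_n -> nat) : int :=
  \prod_(i < n) ((-1) ^+ lam i * (lam i).+1%:R).

(* ratr maps a rational number with denominator prime to p to its residue. *)
Definition omega_sl2 (p n : nat) (D : diagram n) : 'F_p :=
  \sum_(lam : {ffun 'I_n -> 'I_p.-1})
    (Delta (fun i => lam i : nat))%:~R * ratr (omegaT (fun i => lam i : nat) D).

Definition omega_so3 (p n : nat) (D : diagram n) : 'F_p :=
  \sum_(lam : {ffun 'I_n -> 'I_p.-1} | [forall i, ~~ odd (lam i)])
    (Delta (fun i => lam i : nat))%:~R * ratr (omegaT (fun i => lam i : nat) D).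

(* Main.v *)
Require Import Defs.
From Stdlib Require Import ClassicalEpsilon FunctionalExtensionality.
From mathcomp Require Import all_boot all_order all_fingroup all_algebra.
From mathcomp Require Import finmap monalg.
From mathcomp Require Import zify ring.

(** The skein module acts on tensor powers of the symplectic plane: a crossing acts
by minus the flip, minima and maxima by the symplectic form. Since every closed
tangle reduces to a multiple of the empty one, the class of a closed combination
of tangles is its state sum. In this model an edge of colour l carries the
irreducible representation of sl2 of dimension l + 1, an internal vertex with
edges coloured 2 becomes a multiple of the structure tensor, and a univalent
vertex with circle colour l becomes 1 / l times the action [rho] of sl2. Hence
[omegaT] is a sign times the contraction, along the edges of the uni-trivalent
graph, of structure tensors and of traces in representations of sl2; the sign
cancels the one in [Delta]. In this form AS and STU are the antisymmetry and the
definition of the bracket, IHX is the Jacobi identity, and reversing a circle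
transposes with respect to an invariant form.

Summing over the colours of a circle attaches to it the functional
theta = sum d * chi_d, for d < p or for d < p odd, on words in sl2, where chi_d is
the trace in dimension d. The diagram defines a functional L on pairs of words
invariant under the adjoint action, and the handle slide says that
L (theta (w1) theta (u w2), summed over the splittings of w) = L (theta (w) theta (u)).
It suffices to slide the circle over chi_d, and, as the chi_d with d < p are
generated by chi_2, over chi_2. There the tensor products with the plane make
the sum telescope; what remains is the trace of a p x p matrix which commutes with
sl2 once L is applied. By Schur's lemma this matrix is scalar, so its trace is a
multiple of p. *)

Set Implicit Arguments.
Unset Strict Implicit.
Unset Printing Implicit Defensive.

Import GRing.Theory.
Local Open Scope ring_scope.

(** * State sums of tangles *)

(** The weight d in theta clears the denominator d of the decomposition of a tensor product with the
    plane. So d times the mixed trace obeys an identity valid over any ring: a difference of values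
    of one function tau at the dimensions d + 1 and d - 1, plus the term of dimension d - 1 of the
    sum one wants to reach. At the lower end tau lives in dimension 0 or 1 and vanishes. At the
    upper end there remains either tau in dimension p, or tau in dimension p - 1 together with a
    term of weight p - 1 = -1 that the shifted sum lacks; this pair is again the trace of a matrix
    of size p. Such a trace need not vanish for individual words, which is why sliding is stated
    under all invariant functionals. Tensoring with the plane changes the parity of the dimension,
    so sliding over chi_2 exchanges the odd and the even sums, and the notion of sliding carries one
    functional before and another after. Reaching chi_d from chi_2 divides by integers below p only.
    The passage from Q to Z/p is harmless because all denominators left in the contraction are
    powers of 2. *)

Fixpoint strs n : seq (seq bool) :=
  if n is n'.+1 then map (cons true) (strs n') ++ map (cons false) (strs n')
  else [:: [::]].

(* The labels of a strand are a symplectic basis of Q^2; a maximum carries the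
   inverse, that is the opposite, of the matrix of a minimum, and a circle gets - 2. *)
Definition piece_weight g (s t : seq bool) : rat :=
  match g, s, t with
  | Cup, [::], [:: a; b] => if a == b then 0 else if a then 1 else -1
  | Cap, [:: a; b], [::] => if a == b then 0 else if a then -1 else 1
  | Cross, [:: a; b], [:: c; d] => if (a == d) && (b == c) then -1 else 0
  | _, _, _ => 0
  end.

(** A tangle pulls a function of the labels at its top back to a function of the labels at its
    bottom, so that stacking becomes composition. Lengths are not recorded; the laws for tangles ask
    that the string be as long as the number of strands. *)
Definition ev_slice (x : slice) (f : seq bool -> rat) (s : seq bool) : rat :=
  \sum_(t <- strs (tgt x.1)) piece_weight x.1 (take (src x.1) (drop x.2 s)) t
     * f (take x.2 s ++ t ++ drop (x.2 + src x.1) s).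

Definition ev_word (w : seq slice) (f : seq bool -> rat) : seq bool -> rat :=
  foldr ev_slice f w.

Definition ev (x : tangles) (f : seq bool -> rat) (s : seq bool) : rat :=
  mmap idfun (fun m : {fmonom slice} => ev_word m f s) x.

Lemma size_strs n t : t \in strs n -> size t = n.
Proof.
elim: n t => [|n IHn] t /=; first by rewrite inE => /eqP ->.
by rewrite mem_cat => /orP[] /mapP[u /IHn <- ->].
Qed.

Lemma big_strs0 (V : nmodType) (F : seq bool -> V) :
  \sum_(t <- strs 0) F t = F [::].
Proof. by rewrite big_seq1. Qed.

Lemma big_strsS (V : nmodType) n (F : seq bool -> V) :
  \sum_(t <- strs n.+1) F t
  = \sum_(t <- strs n) F (true :: t) + \sum_(t <- strs n) F (false :: t).
Proof. by rewrite big_cat !big_map. Qed.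

Lemma ev_slice_cat g i f s1 s s2 : size s1 = i -> size s = src g ->
  ev_slice (g, i) f (s1 ++ s ++ s2)
  = \sum_(t <- strs (tgt g)) piece_weight g s t * f (s1 ++ t ++ s2).
Proof.
move=> <- szs; apply: eq_bigr => t _ /=.
rewrite -szs take_size_cat // drop_size_cat // take_size_cat //.
by rewrite addnC -drop_drop drop_size_cat // drop_size_cat.
Qed.

Lemma ev_word_cat w1 w2 f : ev_word (w1 ++ w2) f = ev_word w1 (ev_word w2 f).
Proof. exact: foldr_cat. Qed.

Fixpoint strands (k : nat) (w : seq slice) : nat :=
  if w is x :: w' then strands (k - src x.1 + tgt x.1) w' else k.

Lemma is_tangle_cat k l u v :
  is_tangle k l (u ++ v)
  = is_tangle k (strands k u) u && is_tangle (strands k u) l v.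
Proof.
by elim: u k => [|[g i] u IHu] k /=; rewrite ?eqxx // IHu andbA.
Qed.

Lemma is_tangle_strands k l w : is_tangle k l w -> strands k w = l.
Proof. by elim: w k => [|[g i] w IHw] k /= => [/eqP|/andP[_ /IHw]]. Qed.

Lemma ev_word_eq k l w f f' s : is_tangle k l w -> size s = k ->
  (forall t, size t = l -> f t = f' t) -> ev_word w f s = ev_word w f' s.
Proof.
elim: w k s => [|[g i] w IHw] k s /=; first by move=> /eqP -> sz; apply.
case/andP=> le_ik tw sz eqf; apply: eq_big_seq => t /size_strs szt.
congr (_ * _); apply: IHw tw _ eqf.
rewrite /= in szt; rewrite !size_cat size_take size_drop szt sz /=.
by case: ifP; lia.
Qed.

Lemma ev_word_sum w (I : Type) (r : seq I) (P : pred I) (a : I -> rat) F s :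
  ev_word w (fun t => \sum_(i <- r | P i) a i * F i t) s
  = \sum_(i <- r | P i) a i * ev_word w (F i) s.
Proof.
elim: w s => [|[g i] w IHw] s //=; rewrite /ev_slice.
under [RHS]eq_bigr do rewrite mulr_sumr.
rewrite [RHS]exchange_big /=; apply: eq_bigr => t _.
by rewrite IHw mulr_sumr; apply: eq_bigr => j _; rewrite mulrCA.
Qed.

Lemma ev_wordZ w a f s : ev_word w (fun t => a * f t) s = a * ev_word w f s.
Proof.
elim: w s => [|[g i] w IHw] s //=; rewrite /ev_slice mulr_sumr.
by apply: eq_bigr => t _; rewrite IHw mulrCA.
Qed.

Lemma ev_tg w f s : ev (tg w) f s = ev_word w f s.
Proof. by rewrite /ev mmapU mul1r. Qed.

Lemma tg_nil : tg [::] = 1.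
Proof. by rewrite /tg -fmoneE. Qed.

Lemma ev1 f s : ev 1 f s = f s.
Proof. by rewrite -tg_nil ev_tg. Qed.

Lemma ev0 f s : ev 0 f s = 0.
Proof. by rewrite /ev mmap0. Qed.

Lemma evD x y f s : ev (x + y) f s = ev x f s + ev y f s.
Proof. by rewrite /ev mmapD. Qed.

Lemma evB x y f s : ev (x - y) f s = ev x f s - ev y f s.
Proof. by rewrite /ev mmapB. Qed.

Lemma evZ a x f s : ev (a *: x) f s = a * ev x f s.
Proof.
rewrite /ev (mmapEw (msuppZ_le _ _)) mmapE big_distrr /=.
by apply/eq_bigr => m _; rewrite mcoeffZ mulrA.
Qed.

Lemma ev_sum (I : Type) (r : seq I) (P : pred I) F f s :
  ev (\sum_(i <- r | P i) F i) f s = \sum_(i <- r | P i) ev (F i) f s.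
Proof. by rewrite /ev raddf_sum. Qed.

Lemma tangleE (x : tangles) : x = \sum_(m <- msupp x) x@_m *: tg m.
Proof.
rewrite {1}(monalgE x); apply: eq_bigr => m _; apply/malgP => k.
by rewrite mcoeffZ /tg !mcoeffU fmK mulr_natr.
Qed.

Lemma tgZ c w : c *: tg w = << c *g FMonom w >>.
Proof. apply/malgP => k; rewrite mcoeffZ !mcoeffU; exact: mulr_natr. Qed.

Lemma tgMZ w1 c w2 : tg w1 * (c *: tg w2) = c *: tg (w1 ++ w2).
Proof.
rewrite !tgZ /tg malgM_def fgmulUU mul1r; congr << _ *g _ >>; exact: fmmulE.
Qed.

Lemma evM x y f s : ev (x * y) f s = ev x (fun t => ev y f t) s.
Proof.
rewrite [in LHS](tangleE x) mulr_suml ev_sum [RHS]/ev mmapE.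
apply: eq_bigr => m _; rewrite -scalerAl evZ; congr (_ * _).
rewrite [in LHS](tangleE y) mulr_sumr ev_sum.
rewrite {2}/ev /mmap ev_word_sum; apply: eq_bigr => m' _.
by rewrite tgMZ evZ ev_tg ev_word_cat.
Qed.

Definition sgb (b : bool) : rat := if b then 1 else -1.

Lemma ev_slice_Cup i f s1 s2 : size s1 = i ->
  ev_slice (Cup, i) f (s1 ++ s2)
  = f (s1 ++ true :: false :: s2) - f (s1 ++ false :: true :: s2).
Proof.
move=> sz1; rewrite (ev_slice_cat _ (s := [::])) //= !big_cons big_nil /=.
by rewrite !mul0r mul1r mulN1r add0r ?addr0.
Qed.

Lemma ev_slice_Cap i f s1 a b s2 : size s1 = i ->
  ev_slice (Cap, i) f (s1 ++ a :: b :: s2)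
  = if a == b then 0 else - sgb a * f (s1 ++ s2).
Proof.
move=> sz1; rewrite (ev_slice_cat f (s := [:: a; b])) //= !big_cons big_nil /=.
by case: a; case: b; rewrite /sgb /= addr0 ?mul0r ?opprK.
Qed.

Lemma ev_slice_Cross i f s1 a b s2 : size s1 = i ->
  ev_slice (Cross, i) f (s1 ++ a :: b :: s2) = - f (s1 ++ b :: a :: s2).
Proof.
move=> sz1; rewrite (ev_slice_cat f (s := [:: a; b])) //= !big_cons big_nil /=.
by case: a; case: b => /=; rewrite ?mul0r ?mulN1r ?add0r ?addr0.
Qed.

Lemma catE2 (T : Type) (s1 : seq T) a s2 : s1 ++ a :: s2 = (s1 ++ [:: a]) ++ s2.
Proof. by rewrite -catA. Qed.

Lemma seq_split (T : Type) i (s : seq T) : (i <= size s)%N ->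
  exists s1 s2, s = s1 ++ s2 /\ size s1 = i.
Proof.
by move=> le_is; exists (take i s), (drop i s); rewrite cat_take_drop size_takel.
Qed.

(** For distant slices the string is cut as [s1 ++ a ++ s2 ++ b ++ s4], with [a] under [g] and [b]
    under [h], and two finite sums are exchanged. The straightening moves say that the matrices of a
    maximum and a minimum are inverse to each other; the moves of a double point hold because it
    acts by a flip up to sign. *)
Lemma ev_isotopy k l l' r r' f s : isotopy r r' -> is_tangle k l r ->
  is_tangle k l' r' -> size s = k -> ev_word r f s = ev_word r' f s.
Proof.
case=> [g h i j le_ij|i|i|i|i] /= /andP[le1 H] H' sz.
- have {H H'} /andP[le2 _] := H'; subst k.
  have [s1 [s' [Es sz1]]] : exists s1 s2, s = s1 ++ s2 /\ size s1 = i.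
    by apply: seq_split; lia.
  move: le1 le2; rewrite Es size_cat sz1 => le1 le2.
  have [a [s'' [Es' sza]]] : exists s1 s2, s' = s1 ++ s2 /\ size s1 = src g.
    by apply: seq_split; lia.
  move: le1 le2; rewrite Es' size_cat sza => le1 le2.
  have [s2 [s3 [Es2 sz2]]] : exists s1 s2, s'' = s1 ++ s2 /\ size s1 = (j - i)%N.
    by apply: seq_split; lia.
  move: le1 le2; rewrite Es2 size_cat sz2 => le1 le2.
  have [b [s4 [Es3 szb]]] : exists s1 s2, s3 = s1 ++ s2 /\ size s1 = src h.
    by apply: seq_split; lia.
  rewrite Es3 ev_slice_cat //.
  have -> : s1 ++ a ++ s2 ++ b ++ s4 = (s1 ++ a ++ s2) ++ b ++ s4.
    by rewrite -!catA.
  rewrite (ev_slice_cat _ (s := b)) // ?size_cat ?sz1 ?sza ?sz2; last by lia.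
  under [RHS]eq_bigr => t _.
    rewrite -!catA ev_slice_cat // mulr_sumr; over.
  rewrite exchange_big /=; apply: eq_big_seq => t /size_strs szt.
  have -> : s1 ++ t ++ s2 ++ b ++ s4 = (s1 ++ t ++ s2) ++ b ++ s4.
    by rewrite -!catA.
  rewrite (ev_slice_cat _ (s := b)) // ?size_cat ?sz1 ?szt ?sz2; last by lia.
  by rewrite mulr_sumr; apply: eq_bigr => u _; rewrite -!catA mulrCA.
- have [s1 [[|c s2] [Es sz1]]] : exists s1 s2, s = s1 ++ s2 /\ size s1 = i.
  + by apply: seq_split; lia.
  + by move: H sz; rewrite Es cats0 /=; lia.
  rewrite Es ev_slice_Cup // !(catE2 s1 _ (_ :: _)) !ev_slice_Cap; try by rewrite size_cat sz1 addn1.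
  by rewrite -!catA; case: c {Es}; rewrite /sgb /=; ring.
- have [s1 [[|c s2] [Es sz1]]] : exists s1 s2, s = s1 ++ s2 /\ size s1 = i.
  + by apply: seq_split; lia.
  + by move: H sz; rewrite Es cats0 /=; lia.
  rewrite Es (catE2 s1 c s2) ev_slice_Cup ?size_cat ?sz1 /= ?addn1 // -!catA /=.
  rewrite !ev_slice_Cap //.
  by case: c {Es}; rewrite /sgb /=; ring.
- have [s1 [[|c s2] [Es sz1]]] : exists s1 s2, s = s1 ++ s2 /\ size s1 = i.
  + by apply: seq_split; lia.
  + by move: H sz; rewrite Es cats0 /=; lia.
  rewrite Es ev_slice_Cup // !(catE2 s1 _ (_ :: _)) !ev_slice_Cross; try by rewrite size_cat sz1 addn1.
  rewrite -!catA (catE2 s1 c s2) ev_slice_Cup; last by rewrite size_cat sz1 addn1.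
  by rewrite -!catA /= !ev_slice_Cross // opprB addrC.
- have [s1 [[|a [|b [|c s2]]] [Es sz1]]] : exists s1 s2, s = s1 ++ s2 /\ size s1 = i.
  + by apply: seq_split; lia.
  + by move: sz; rewrite Es cats0 /=; lia.
  + by move: sz; rewrite Es size_cat /=; lia.
  + by move: sz; rewrite Es size_cat /=; lia.
  rewrite Es [RHS]ev_slice_Cross // !(catE2 s1 _ (_ :: _)).
  rewrite ev_slice_Cross 1?[in RHS]ev_slice_Cap; try by rewrite size_cat sz1 addn1.
  by rewrite -!catA /= ev_slice_Cap.
Qed.

(** In dimension two the antisymmetric tensors form a line, so identity minus flip factors through a
    maximum followed by a minimum: this is the crossing relation. *)
Lemma ev_relator x f : skein_relator 0 0 x -> ev x f [::] = 0.
Proof.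
case=> [u v r r' iso|u v i|u v i].
- rewrite !is_tangle_cat => /and3P[tu tr tv] /and3P[_ tr' tv'].
  rewrite evB !ev_tg !ev_word_cat; apply/eqP; rewrite subr_eq0; apply/eqP.
  apply: (ev_word_eq tu) => // t szt; exact: (ev_isotopy _ iso tr tr' szt).
- rewrite !is_tangle_cat => /and3P[tu tr tv].
  rewrite evB evZ !ev_tg !ev_word_cat -ev_wordZ; apply/eqP; rewrite subr_eq0.
  apply/eqP/(ev_word_eq tu) => // t szt; move: tr => /= /andP[le_i _].
  have [s1 [s2 [-> sz1]]] : exists s1 s2, t = s1 ++ s2 /\ size s1 = i.
    by apply: seq_split; lia.
  by rewrite ev_slice_Cup // !ev_slice_Cap // /sgb /=; ring.
- rewrite !is_tangle_cat => /and3P[tu tr tv].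
  rewrite !evD !ev_tg !ev_word_cat.
  rewrite -[ev_word u (ev_word v f) _]mul1r -[X in _ + X]mul1r.
  rewrite -[X in X + _ + _]mul1r -!ev_wordZ.
  (* The three terms form one family, so that [ev_word_sum] moves their sum inside [u] and the
     relation is checked locally. *)
  pose F (j : 'I_3) (t : seq bool) := match val j with
    | 0%N => ev_word [:: (Cross, i)] (ev_word v f) t
    | 1%N => ev_word v f t
    | _ => ev_word [:: (Cap, i); (Cup, i)] (ev_word v f) t end.
  have := ev_word_sum u (index_enum 'I_3) xpredT (fun=> 1) F [::].
  rewrite !big_ord_recl big_ord0 /= addr0 addrA -!ev_wordZ => <-.
  rewrite -[RHS](mul0r (ev_word u (fun=> 0) [::])) -ev_wordZ.
  apply: (ev_word_eq tu) => // t szt; move: tr => /= /andP[le_i _].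
  rewrite !big_ord_recl big_ord0 /F /= !mul1r addr0 mulr0.
  have [s1 [[|a [|b s2]] [Es sz1]]] : exists s1 s2, t = s1 ++ s2 /\ size s1 = i.
  + by apply: seq_split; lia.
  + by move: szt; rewrite Es cats0 /=; lia.
  + by move: szt; rewrite Es size_cat /=; lia.
  rewrite Es ev_slice_Cross // ev_slice_Cap // ev_slice_Cup //.
  by case: a {Es}; case: b; rewrite /sgb /=; ring.
Qed.

Lemma ev_null x f : skein_null 0 0 x -> ev x f [::] = 0.
Proof.
by elim=> [|q y z /ev_relator Ey _ Ez]; rewrite ?ev0 // evD evZ Ey Ez mulr0 addr0.
Qed.

(** * Reduction of closed tangles *)

Lemma skein_nullD k l x y :
  skein_null k l x -> skein_null k l y -> skein_null k l (x + y).
Proof.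
elim=> [|q x1 x2 rel1 _ IH] ny; first by rewrite add0r.
by rewrite -addrA; apply: skein_null_lin (IH ny).
Qed.

Lemma skein_nullZ k l q x : skein_null k l x -> skein_null k l (q *: x).
Proof.
elim=> [|q' x1 x2 rel1 _ IH]; first by rewrite scaler0; apply: skein_null0.
by rewrite scalerDr scalerA; apply: skein_null_lin.
Qed.

Lemma skein_null_relator k l x : skein_relator k l x -> skein_null k l x.
Proof.
by move=> rel; rewrite -[x]scale1r -[_ *: x]addr0; apply: skein_null_lin => //; apply: skein_null0.
Qed.

Definition scalar_tangle x := exists q, skein_null 0 0 (x - q *: 1).

Lemma scalar_tangleD x y :
  scalar_tangle x -> scalar_tangle y -> scalar_tangle (x + y).
Proof.
move=> [q nx] [q' ny]; exists (q + q').
rewrite scalerDl opprD addrACA; exact: skein_nullD nx ny.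
Qed.

Lemma scalar_tangleZ a x : scalar_tangle x -> scalar_tangle (a *: x).
Proof.
move=> [q nx]; exists (a * q).
rewrite -scalerA -scalerBr; exact: skein_nullZ nx.
Qed.

Lemma scalar_tangle_null x y :
  skein_null 0 0 (x - y) -> scalar_tangle y -> scalar_tangle x.
Proof.
move=> nxy [q ny]; exists q.
rewrite -[x](subrK y) -addrA; exact: skein_nullD nxy ny.
Qed.

Lemma skein_null_sym k l x y : skein_null k l (x - y) -> skein_null k l (y - x).
Proof. by move=> /(skein_nullZ (-1)); rewrite scaleN1r opprB. Qed.

Definition is_cup (x : slice) := if x.1 is Cup then true else false.
Definition is_cross (x : slice) := if x.1 is Cross then true else false.

Lemma strands_cups k u : all is_cup u -> strands k u = (k + (size u).*2)%N.
Proof.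
by elim: u k => [|[[] i] u IHu] k //= cu; rewrite ?addn0 // IHu //; lia.
Qed.

Lemma first_cap w : ~~ has is_cross w -> ~~ all is_cup w ->
  exists u j v, w = u ++ (Cap, j) :: v /\ all is_cup u.
Proof.
elim: w => [|[[] i] w IHw] //=; last by exists [::], i, w.
by move=> nc nu; have [u [j [v [-> cu]]]] := IHw nc nu; exists ((Cup, i) :: u), j, v.
Qed.

(** Below the lowest maximum there are only minima. With the topmost of these it closes a circle, or
    it is straightened, or the two are exchanged and the maximum goes down one level. The outer
    induction is on the number of slices, the inner one on the number of minima below the
    maximum. *)
Lemma scalar_planar n w : (size w <= n)%N -> ~~ has is_cross w ->
  is_tangle 0 0 w -> scalar_tangle (tg w).
Proof.
elim: n w => [|n IHn] w.
  case: w => // _ _ _; exists 1; rewrite tg_nil scale1r subrr; exact: skein_null0.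
move=> le_wn nc tw; have [cw|ncw] := boolP (all is_cup w).
  move: tw => /is_tangle_strands; rewrite strands_cups // add0n.
  by case: w {le_wn nc cw} => // _; exists 1; rewrite tg_nil scale1r subrr; apply: skein_null0.
have [u [j [v [Ew cu]]]] := first_cap nc ncw; rewrite {}Ew {ncw w} in le_wn nc tw *.
elim: {u}(size u) {-2}u (erefl (size u)) j v cu le_wn nc tw => [|m IHm] u szu j v cu le_wn nc tw.
  by case: u szu cu le_wn nc tw => // _ _ _ _ /=; rewrite addn2.
case/lastP: u szu cu le_wn nc tw => // u [g i]; rewrite size_rcons => -[szu].
rewrite all_rcons => /andP[]; case: g => // _ cu.
rewrite cat_rcons => le_wn nc tw.
have nc' : ~~ has is_cross (u ++ v) by move: nc; rewrite !has_cat.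
have le' : (size (u ++ v) <= n)%N by move: le_wn; rewrite !size_cat /= !addnS => /ltnW.
move: (tw); rewrite is_tangle_cat /= => /andP[tu /and3P[le_i le_j tv]].
have [Eij|] := eqVneq i j.
  rewrite -{}Eij in tw tv le_j *.
  have rel := skein_circle tw.
  apply: scalar_tangle_null (skein_null_relator rel) _; apply: scalar_tangleZ.
  apply: IHn => //; rewrite is_tangle_cat tu; move: tv.
  by rewrite !subn0 addn0 addn2 subn2.
have straighten : isotopy [:: (Cup, i); (Cap, j)] [::] -> scalar_tangle (tg (u ++ [:: (Cup, i), (Cap, j) & v])).
  move=> iso.
  have tuv : is_tangle 0 0 (u ++ v).
    rewrite is_tangle_cat tu; move: tv.
    by rewrite !subn0 addn0 addn2 subn2.
  have rel := skein_isotopy iso tw tuv.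
  by apply: scalar_tangle_null (skein_null_relator rel) _; apply: IHn.
move=> ne_ij.
have [Ej|ne1] := eqVneq j i.+1; first by apply: straighten; rewrite Ej; apply: isotopy_zigzagl.
have [Ei|ne2] := eqVneq i j.+1; first by apply: straighten; rewrite Ei; apply: isotopy_zigzagr.
have [lt_ij|le_ji] := ltnP i j.
  have iso : isotopy [:: (Cup, i); (Cap, (j - 2 + tgt Cup)%N)] [:: (Cap, (j - 2 + src Cup)%N); (Cup, i)].
    by apply: isotopy_far; lia.
  rewrite /= addn0 subnK in iso; last by lia.
  have tw' : is_tangle 0 0 (u ++ [:: (Cap, (j - 2)%N); (Cup, i)] ++ v).
    rewrite is_tangle_cat tu /=; move: tv.
    rewrite !subn0 !addn0 !addn2 !subn2 /= => tv.
    move: le_j; rewrite addn2 subn0 => le_j.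
    apply/and3P; split; [lia | lia |].
    by move: tv; case: (strands 0 u) le_j => [|[|k]] //=; rewrite ?addn2; lia.
  have rel := skein_isotopy iso tw tw'.
  apply: scalar_tangle_null (skein_null_relator rel) _.
  apply: IHm => //; move: nc le_wn; rewrite ?has_cat ?size_cat //=.
have iso : isotopy [:: (Cap, j); (Cup, (i - 2 + tgt Cap)%N)] [:: (Cup, (i - 2 + src Cap)%N); (Cap, j)].
  by apply: isotopy_far; lia.
rewrite /= addn0 subnK in iso; last by lia.
have tw' : is_tangle 0 0 (u ++ [:: (Cap, j); (Cup, (i - 2)%N)] ++ v).
  rewrite is_tangle_cat tu /=; move: tv.
  rewrite !subn0 !addn0 !addn2 !subn2 /= => tv.
  move: le_i; rewrite addn0 => le_i.
  apply/and3P; split; [lia | lia |].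
  by move: tv; case: (strands 0 u) le_i => [|[|k]] //=; rewrite ?addn2; lia.
have rel := skein_isotopy iso tw' tw.
apply: scalar_tangle_null (skein_null_sym (skein_null_relator rel)) _.
apply: IHm => //; move: nc le_wn; rewrite ?has_cat ?size_cat //=.
Qed.

Lemma has_cross_split w : has is_cross w ->
  exists u i v, w = u ++ [:: (Cross, i)] ++ v.
Proof.
elim: w => [|[g i] w IHw] //= /orP[|/IHw [u [j [v ->]]]].
  by case: g => // _; exists [::], i, w.
by exists ((g, i) :: u), j, v.
Qed.

(** The crossing relation trades a double point for two tangles with fewer double points, until the
    planar case is reached. *)
Lemma scalar_closed w : is_tangle 0 0 w -> scalar_tangle (tg w).
Proof.
elim: {w}(count _ w) {-2}w (leqnn (count is_cross w)) => [|n IHn] w le_wn tw.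
  apply: (scalar_planar (leqnn _)) => //; rewrite has_count -leqNgt //.
have [cw|/(scalar_planar (leqnn _))] := boolP (has is_cross w); last exact.
have [u [i [v Ew]]] := has_cross_split cw; rewrite {}Ew {w cw} in le_wn tw *.
have rel := skein_crossing tw.
move: (tw); rewrite is_tangle_cat => /andP[tu].
rewrite /= addn2 => /andP[le_i]; rewrite subn2 addn2 => tv.
have Ek : (strands 0 u).-2.+2 = strands 0 u by case: (strands 0 u) le_i => [|[|k]].
apply: (@scalar_tangle_null _ ((-1) *: (tg (u ++ v) + tg (u ++ [:: (Cap, i); (Cup, i)] ++ v)))).
  by rewrite scaleN1r opprK addrA; apply: skein_null_relator.
apply/scalar_tangleZ/scalar_tangleD; apply: IHn.
- by move: le_wn; rewrite !count_cat /=; lia.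
- by rewrite is_tangle_cat tu -Ek.
- by move: le_wn; rewrite !count_cat /=; lia.
- rewrite is_tangle_cat tu /= !addn2 addn0 le_i subn0 addn0 subn2.
  by rewrite -{1}Ek tv andbT; lia.
Qed.

Definition tangle_comb k l (x : tangles) :=
  {in msupp x, forall m : {fmonom slice}, is_tangle k l m}.

Lemma tangle_comb_tg k l w : is_tangle k l w -> tangle_comb k l (tg w).
Proof. by move=> tw m; rewrite /tg msuppU1 in_fset1 => /eqP ->. Qed.

Lemma tangle_comb1 k : tangle_comb k k 1.
Proof. by rewrite -tg_nil; apply: tangle_comb_tg => /=. Qed.

Lemma tangle_combD k l x y :
  tangle_comb k l x -> tangle_comb k l y -> tangle_comb k l (x + y).
Proof.
by move=> tx ty m /(fsubsetP (msuppD_le _ _)); rewrite in_fsetU => /orP[/tx|/ty].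
Qed.

Lemma tangle_combZ k l a x : tangle_comb k l x -> tangle_comb k l (a *: x).
Proof. by move=> tx m /(fsubsetP (msuppZ_le _ _)) /tx. Qed.

Lemma tangle_comb_sum k l (I : Type) (r : seq I) (P : pred I) F :
  (forall i, P i -> tangle_comb k l (F i)) ->
  tangle_comb k l (\sum_(i <- r | P i) F i).
Proof.
move=> tF; apply: big_ind => //; last exact: tangle_combD.
by move=> m; rewrite msupp0 in_fset0.
Qed.

Lemma tangle_combM k l r x y :
  tangle_comb k l x -> tangle_comb l r y -> tangle_comb k r (x * y).
Proof.
move=> tx ty m /msuppM_le [m1 [m2 [/tx t1 /ty t2 ->]]].
by rewrite fmM is_tangle_cat (is_tangle_strands t1) t1.
Qed.

(** Reduction of closed tangles provides a scalar, and the state sum shows that it is unique, since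
    it kills the relators and is 1 on the empty tangle. Hence the choice made by [epsilon] is
    determined. *)
Lemma skein_valueE x : tangle_comb 0 0 x -> skein_value x = ev x (fun=> 1) [::].
Proof.
move=> tx; have [q nx] : scalar_tangle x.
  rewrite (tangleE x) big_seq; apply: big_ind.
  - by exists 0; rewrite scale0r subr0; apply: skein_null0.
  - exact: scalar_tangleD.
  - move=> m /tx tm; exact/scalar_tangleZ/scalar_closed.
have unique (q' : rat) : skein_null 0 0 (x - q' *: 1) -> ev x (fun=> 1) [::] = q'.
  by move=> /(ev_null (fun=> 1)); rewrite evB evZ ev1 mulr1 => /eqP; rewrite subr_eq0 => /eqP.
symmetry; apply: unique.
exact: (epsilon_spec (inhabits 0) (fun q => skein_null 0 0 (x - q *: 1))
  (ex_intro _ q nx)).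
Qed.

(** * Cables, cups and caps *)

(** When the left feet of nested minima carry the labels [t], the right feet carry [dual t] and the
    product of the weights is [cupw t]. *)
Definition cupw (t : seq bool) : rat := \prod_(b <- t) sgb b.
Definition dual (t : seq bool) : seq bool := rev (map negb t).

Lemma size_dual t : size (dual t) = size t.
Proof. by rewrite /dual size_rev size_map. Qed.

Lemma nested_cupsS o n : nested_cups o n.+1 = (Cup, o) :: nested_cups o.+1 n.
Proof.
rewrite /nested_cups /= addn0; congr (_ :: _).
rewrite -[1%N]addn0 iotaDl -map_comp; apply: eq_map => t /=.
by rewrite addSn addnS.
Qed.

Lemma nested_capsS o n : nested_caps o n.+1 = (Cap, (o + n)%N) :: nested_caps o n.
Proof. by rewrite /nested_caps -addn1 iotaD rev_cat. Qed.

Lemma cable_wordS n m : cable_word n m.+1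
  = [seq (Cross, (n + m + t)%N) | t <- iota 0 n] ++ cable_word n m.
Proof. by rewrite /cable_word -addn1 iotaD rev_cat. Qed.

Lemma ev_nested_cups o n f s1 s2 : size s1 = o ->
  ev_word (nested_cups o n) f (s1 ++ s2)
  = \sum_(t <- strs n) cupw t * f (s1 ++ t ++ dual t ++ s2).
Proof.
elim: n o s1 s2 => [|n IHn] o s1 s2 sz1.
  by rewrite big_strs0 /cupw big_nil mul1r.
rewrite nested_cupsS [LHS]/= ev_slice_Cup //.
rewrite (catE2 s1 true (false :: s2)) (catE2 s1 false (true :: s2)).
rewrite !IHn ?size_cat ?sz1 ?addn1 // big_strsS -sumrN.
congr (_ + _); apply: eq_bigr => t _; rewrite /cupw big_cons /= -!catA /=.
  by rewrite mul1r /dual /= rev_cons cat_rcons.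
by rewrite mulN1r mulNr /dual /= rev_cons cat_rcons.
Qed.

Lemma ev_nested_caps o n f s1 t t' s2 : size s1 = o -> size t = n ->
  size t' = n ->
  ev_word (nested_caps o n) f (s1 ++ t ++ t' ++ s2)
  = if t == dual t' then cupw (map negb t) * f (s1 ++ s2) else 0.
Proof.
elim: n t t' s2 => [|n IHn] t t' s2 sz1.
  by move=> /size0nil -> /size0nil ->; rewrite /cupw big_nil mul1r.
case/lastP: t => // t b; rewrite size_rcons => -[szt].
case: t' => // b' t' [szt'].
rewrite nested_capsS [LHS]/= cat_rcons catA /= ev_slice_Cap; last first.
  by rewrite size_cat sz1 szt.
rewrite -catA IHn // /dual map_cons rev_cons eqseq_rcons map_rcons.
have -> : (b == b') = ~~ (b == ~~ b') by case: (b); case: (b').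
rewrite if_neg andbC; case: (b == _) => //=; case: ifP => _; rewrite ?mulr0 //.
by rewrite /cupw -cats1 big_cat big_seq1 /=; case: (b) => /=; ring.
Qed.

Lemma ev_strand o n f s1 b t s2 : size s1 = o -> size t = n ->
  ev_word [seq (Cross, (o + k)%N) | k <- iota 0 n] f (s1 ++ b :: t ++ s2)
  = (-1) ^+ n * f (s1 ++ t ++ b :: s2).
Proof.
elim: n o s1 t => [|n IHn] o s1 t sz1; first by move=> /size0nil ->; rewrite mul1r.
case: t => // a t [szt] /=; rewrite addn0 ev_slice_Cross // (catE2 s1).
rewrite -[1%N]addn0 iotaDl -map_comp.
rewrite (@eq_map _ _ _ (fun k => (Cross, (o.+1 + k)%N))); last first.
  by move=> k /=; rewrite addSn addnS.
by rewrite IHn ?size_cat ?sz1 ?addn1 // exprS mulN1r mulNr -catA.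
Qed.

Lemma ev_cable n m f s t u s2 : size s = n -> size t = m -> size u = n ->
  ev_word (cable_word n m) f (s ++ t ++ u ++ s2)
  = (-1) ^+ (n * m) * f (s ++ u ++ t ++ s2).
Proof.
move=> szs szt szu; elim: m t s2 szt => [|m IHm] t s2.
  by move=> /size0nil ->; rewrite muln0 mul1r.
case/lastP: t => // t b; rewrite size_rcons => -[szt].
rewrite cable_wordS ev_word_cat cat_rcons catA ev_strand ?size_cat ?szs ?szt //.
by rewrite -catA IHm // mulrA -exprD mulnS cat_rcons.
Qed.

(** * The symmetrizer *)

(** The numbers of crossings that [perm_word] makes for the successive strands. With [insert_all],
    which moves each label past that many others, the action of a permutation tangle follows the
    recursion of [perm_word]. *)
Fixpoint lehmer (s : seq nat) : seq nat :=
  if s is x :: s' then count (fun y => (y < x)%N) s' :: lehmer s' else [::].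

Fixpoint insert_all (l : seq nat) (s : seq bool) : seq bool :=
  match l, s with
  | k :: l', b :: s' => let u := insert_all l' s' in take k u ++ b :: drop k u
  | _, _ => s
  end.

Lemma size_insert_all l s : size (insert_all l s) = size s.
Proof.
elim: l s => [|k l IHl] [|b s] //=.
by rewrite size_cat /= addnS -size_cat cat_take_drop IHl.
Qed.

Lemma ev_perm_word o s f s1 t s2 : size s1 = o -> size t = size s ->
  ev_word (perm_word o s) f (s1 ++ t ++ s2)
  = (-1) ^+ sumn (lehmer s) * f (s1 ++ insert_all (lehmer s) t ++ s2).
Proof.
elim: s o s1 t f => [|x s IHs] o s1 t f sz1.
  by move=> /size0nil ->; rewrite mul1r.
case: t => // b t [szt] /=; rewrite ev_word_cat (catE2 s1).
rewrite IHs ?size_cat ?sz1 ?addn1 // -catA /= addnC exprD -mulrA; congr (_ * _).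
set u := insert_all _ _; set k := count _ _.
have le_ku : (k <= size u)%N by rewrite size_insert_all szt count_size.
rewrite -{1}(cat_take_drop k u) -catA ev_strand ?size_takel //.
by rewrite -catA.
Qed.

Definition perm_seq n (s : 'S_n) := [seq val (s i) | i <- enum 'I_n].

Lemma perm_seq_lift n (x : 'I_n.+1) (s : 'S_n) :
  perm_seq (lift_perm ord0 x s) = val x :: map (bump x) (perm_seq s).
Proof.
rewrite /perm_seq enum_ordSl /= lift_perm_id -!map_comp; congr (_ :: _).
by apply: eq_map => i /=; rewrite lift_perm_lift.
Qed.

Lemma lehmer_bump x s : lehmer (map (bump x) s) = lehmer s.
Proof.
elim: s => //= y s ->; congr (_ :: _); rewrite count_map.
by apply: eq_count => z /=; rewrite /bump; lia.
Qed.

Lemma count_perm_seq n (s : 'S_n) (a : pred nat) :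
  count a (perm_seq s) = count a (iota 0 n).
Proof.
have /seq.permP -> // : perm_eq (perm_seq s) (iota 0 n).
rewrite -val_enum_ord /perm_seq (map_comp val s); apply: perm_map.
apply: uniq_perm; [|exact: enum_uniq|].
  by rewrite (map_inj_uniq (@perm_inj _ s)) enum_uniq.
move=> i; rewrite mem_enum; apply/mapP; exists (s^-1%g i); rewrite ?mem_enum //.
by rewrite permKV.
Qed.

Lemma count_ltn_iota m n : (m <= n)%N -> count (fun y => y < m)%N (iota 0 n) = m.
Proof.
move=> le_mn; rewrite -(subnKC le_mn) iotaD count_cat.
have /eqP -> : count (fun y => y < m)%N (iota 0 m) == m.
  rewrite -[X in _ == X](size_iota 0 m) -all_count; apply/allP => y.
  by rewrite mem_iota.
have /eqP -> : count (fun y => y < m)%N (iota (0 + m) (n - m)) == 0%N.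
  rewrite -leqn0 leqNgt -has_count; apply/hasPn => y.
  by rewrite mem_iota -leqNgt => /andP[].
by rewrite addn0.
Qed.

Lemma lehmer_lift n (x : 'I_n.+1) (s : 'S_n) :
  lehmer (perm_seq (lift_perm ord0 x s)) = val x :: lehmer (perm_seq s).
Proof.
rewrite perm_seq_lift /= lehmer_bump; congr (_ :: _).
rewrite count_map (@eq_count _ _ (fun y => y < x)%N); last first.
  by move=> y /=; rewrite /bump; lia.
by rewrite count_perm_seq count_ltn_iota // -ltnS.
Qed.

Lemma lift_perm0_bij n :
  bijective (fun xs : 'I_n.+1 * 'S_n => lift_perm ord0 xs.1 xs.2).
Proof.
apply: inj_card_bij.
  move=> [x s] [y t] /= E.
  have Exy : x = y by rewrite -[x](lift_perm_id ord0 _ s) E lift_perm_id.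
  subst y; congr (_, _); apply/permP => i.
  by apply: (@lift_inj _ x); rewrite -!(lift_perm_lift ord0) E.
by rewrite card_prod card_ord !card_Sn factS.
Qed.

Lemma big_permS (V : nmodType) n (F : 'S_n.+1 -> V) :
  \sum_s F s = \sum_(x < n.+1) \sum_(s : 'S_n) F (lift_perm ord0 x s).
Proof.
rewrite (reindex (fun xs : 'I_n.+1 * 'S_n => lift_perm ord0 xs.1 xs.2)).
  by rewrite pair_bigA.
by have [g h1 h2] := lift_perm0_bij n; exists g => y _.
Qed.

(** The code adds up to the number of inversions, so the sign of the crossings is the signature and
    will cancel the sign in the symmetrizer. *)
Lemma odd_sumn_lehmer n (s : 'S_n) : odd (sumn (lehmer (perm_seq s))) = odd_perm s.
Proof.
elim: n s => [|n IHn] s.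
  have -> : s = 1%g by apply/permP => -[].
  rewrite odd_perm1 /perm_seq.
  by rewrite (size0nil (_ : size (enum 'I_0) = 0%N)) // size_enum_ord.
have [g _ gK] := lift_perm0_bij n; rewrite -(gK s); case: (g s) => x t /=.
by rewrite lehmer_lift /= oddD IHn odd_lift_perm.
Qed.

Lemma insert_eq k b (s u : seq bool) : (k <= size s)%N -> size u = (size s).+1 ->
  (take k s ++ b :: drop k s == u)
  = (nth false u k == b) && (s == take k u ++ drop k.+1 u).
Proof.
move=> le_ks szu; have lt_ku : (k < size u)%N by rewrite szu ltnS.
rewrite -{1}(cat_take_drop k u) (drop_nth false lt_ku).
rewrite eqseq_cat ?size_takel // ?eqseq_cons; last exact: ltnW.
rewrite -{3}(cat_take_drop k s) eqseq_cat ?size_takel //; last exact: ltnW.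
by rewrite (eq_sym b) andbCA.
Qed.

Lemma sum_nth_eq (u : seq bool) b :
  (\sum_(k < size u) (nth false u k == b) = count_mem b u)%N.
Proof. rewrite -sum1_count [RHS]big_mkcond (big_nth false) big_mkord; by apply: eq_bigr => i _ /=; case: (_ == _). Qed.

Lemma count_del k (u : seq bool) : (k < size u)%N ->
  count_mem true u = (nth false u k + count_mem true (take k u ++ drop k.+1 u))%N.
Proof.
move=> lt_ku; rewrite -{1}(cat_take_drop k u) (drop_nth false lt_ku) !count_cat /=.
by case: nth; lia.
Qed.

Lemma count_negb (u : seq bool) : (count_mem true u + count_mem false u = size u)%N.
Proof. by rewrite -(count_predC (pred1 true)); congr (_ + _)%N; apply: eq_count; case. Qed.

(** The permutations carrying [t] to [u], if any, form a coset of a product of two symmetric groups.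
    The induction splits off the first letter of [t]: it must land at a place [x] where [u] has the
    same letter, and the rest is matched with [u] deprived of that place. *)
Lemma count_insert_all n (t u : seq bool) : size t = n -> size u = n ->
  (\sum_(s : 'S_n) (insert_all (lehmer (perm_seq s)) t == u)
   = if count_mem true t == count_mem true u
     then (count_mem true u)`! * (count_mem false u)`! else 0)%N.
Proof.
elim: n t u => [|n IHn] t u.
  move=> /size0nil -> /size0nil -> /=; rewrite (big_pred1 1%g) => [|s].
    by case: (lehmer _).
  by apply/esym/eqP/permP => -[].
case: t => // b t [szt] szu; rewrite big_permS.
under eq_bigr => x _.
  have lt_xu : (x < size u)%N by rewrite szu.
  under eq_bigr => s _.
    rewrite lehmer_lift [insert_all _ _]/=.
    rewrite insert_eq ?size_insert_all ?szt; [|by rewrite -ltnS|by []].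
    rewrite -mulnb; over.
  rewrite -big_distrr /= IHn //; last first.
    by rewrite size_cat size_drop size_takel ?szu; [have := ltn_ord x; lia | exact: ltnW].
  over.
rewrite /=.
have sz2 := count_negb u.
transitivity (\sum_(x < n.+1) (nth false u x == b) *
  (if b + count_mem true t == count_mem true u
   then ((count_mem true u) - b)`! * ((count_mem false u) - ~~ b)`! else 0))%N.
  apply: eq_bigr => x _; case: (nth false u x =P b) => [Eb|]; last by rewrite !mul0n.
  rewrite !mul1n; have lt_xu : (x < size u)%N by rewrite szu.
  have Ec := count_del lt_xu; rewrite Eb in Ec.
  have Ef : (count_mem false (take x u ++ drop x.+1 u) = count_mem false u - ~~ b)%N.
    have := count_negb (take x u ++ drop x.+1 u).
    rewrite size_cat size_drop size_takel; last exact: ltnW.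
    by have := ltn_ord x; case: (b) Ec; lia.
  rewrite Ef Ec eqn_add2l addKn; exact: mul1n.
transitivity ((\sum_(x < n.+1) (nth false u x == b)) *
  (if b + count_mem true t == count_mem true u
   then ((count_mem true u) - b)`! * ((count_mem false u) - ~~ b)`! else 0))%N.
  by rewrite big_distrl.
rewrite -szu sum_nth_eq eqb_id; case: ifP => [/eqP Ec|]; last by rewrite muln0.
rewrite -szt in szu; have szt2 := count_negb t.
case: b Ec => /= Ec.
  by rewrite -Ec add1n subn1 subn0 mulnA factS.
rewrite subn1 subn0 mulnCA; congr (_ * _)%N.
have : (0 < count_mem false u)%N.
  by rewrite -(ltn_add2l (count_mem true u)) addn0 sz2 szu -Ec add0n ltnS -szt2 leq_addr.
by case: (count_mem false u) => // m _; rewrite factS.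
Qed.

Lemma cupwE t : cupw t = (-1) ^+ count_mem false t.
Proof.
rewrite /cupw; elim: t => [|b t IHt] /=; first by rewrite big_nil.
by rewrite big_cons IHt; case: b; rewrite /= ?mul1r // exprS.
Qed.

Lemma count_dual b t : count_mem b (dual t) = count_mem (~~ b) t.
Proof. by rewrite /dual count_rev count_map; apply: eq_count; case: b; case. Qed.

Lemma cupw_map_dual t : cupw (map negb (dual t)) = cupw t.
Proof.
rewrite !cupwE count_map -[count_mem false t](count_dual true).
by congr (_ ^+ _); apply: eq_count; case.
Qed.

(** The invariant bilinear form on the n-th symmetric power of the plane, evaluated on basis
    tensors. *)
Definition pairing n (s u : seq bool) : rat :=
  if (count_mem true s + count_mem true u == n)%N
  then (-1) ^+ count_mem true s / 'C(n, count_mem true s)%:R else 0.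

Lemma sumr_nat_bool (I : finType) (P : pred I) (b : I -> bool) :
  \sum_(i | P i) (b i)%:R = (\sum_(i | P i) b i)%N%:R :> rat.
Proof. by rewrite natr_sum. Qed.

(** As a crossing acts by minus the flip, the signs of the symmetrizer cancel and there remains the
    average over all rearrangements of [s]. With k the number of labels [true] in [s], exactly k! (n
    - k)! permutations match [dual u], if any; division by n! leaves the inverse binomial
    coefficient. *)
Lemma ev_join n m f s t u s2 : size s = n -> size t = m -> size u = n ->
  ev (symmetrizer n * tg (cable_word n m ++ nested_caps 0 n)) f
    (s ++ t ++ u ++ s2)
  = (-1) ^+ (n * m) * pairing n s u * f (t ++ s2).
Proof.
move=> szs szt szu; rewrite evM /symmetrizer evZ ev_sum.
have szr (p : 'S_n) : size (perm_seq p) = n.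
  by rewrite /perm_seq size_map size_enum_ord.
have Ep (p : 'S_n) :
    ev ((-1) ^+ p *: perm_tangle p)
      (fun v => ev (tg (cable_word n m ++ nested_caps 0 n)) f v)
      (s ++ t ++ u ++ s2)
    = (insert_all (lehmer (perm_seq p)) s == dual u)%:R
      * ((-1) ^+ (n * m) * (cupw u * f (t ++ s2))).
  rewrite evZ ev_tg -[s ++ _]cat0s ev_perm_word ?szr // cat0s.
  rewrite -[(-1) ^+ sumn _]signr_odd odd_sumn_lehmer -/(perm_seq p) [LHS]signrMK.
  rewrite ev_tg ev_word_cat ev_cable ?size_insert_all //.
  rewrite -[insert_all _ _ ++ _]cat0s ev_nested_caps ?size_insert_all //.
  by case: eqP => [->|_]; rewrite ?cupw_map_dual ?mul1r ?mul0r ?mulr0.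
under eq_bigr do rewrite Ep.
rewrite -big_distrl /= sumr_nat_bool.
rewrite (@count_insert_all n s (dual u)) ?size_dual // !count_dual /=.
have cs := count_negb s; have cu := count_negb u; rewrite /pairing.
have -> : (count_mem true s == count_mem false u) = (count_mem true s + count_mem true u == n)%N.
  by rewrite -szu -cu addnC eqn_add2l.
case: eqP => [Ec|_]; last by rewrite !(mulr0, mul0r).
have Es : count_mem true s = count_mem false u by lia.
have Eu : count_mem true u = (n - count_mem true s)%N by lia.
have le_sn : (count_mem true s <= n)%N by lia.
rewrite -Es Eu cupwE -Es.
have Ebin := bin_fact le_sn.
have nz k : (k`!%:R : rat) != 0 by rewrite Num.Theory.pnatr_eq0 -lt0n fact_gt0.
have nzb : ('C(n, count_mem true s)%:R : rat) != 0.
  by rewrite Num.Theory.pnatr_eq0 -lt0n bin_gt0.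
rewrite -Ebin !natrM.
have nz2 : (((count_mem true s)`! * (n - count_mem true s)`!)%:R : rat) != 0.
  by rewrite natrM mulf_neq0.
rewrite natrM in nz2 *.
by field; rewrite nzb !nz.
Qed.

(** * Well-formedness of the words *)

Lemma is_tangle_nested_cups k o n : (o <= k)%N ->
  is_tangle k (k + n.*2) (nested_cups o n).
Proof.
elim: n k o => [|n IHn] k o le_ok; first by rewrite /= addn0.
rewrite nested_cupsS /= addn0 le_ok subn0 (_ : k + n.+1.*2 = k + 2 + n.*2)%N.
  by apply: IHn; lia.
by lia.
Qed.

Lemma is_tangle_nested_caps k o n : (o <= k)%N ->
  is_tangle (k + n.*2) k (nested_caps o n).
Proof.
elim: n => [|n IHn] le_ok; first by rewrite /= addn0.
rewrite nested_capsS /= (_ : k + n.+1.*2 - 2 + 0 = k + n.*2)%N; last by lia.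
by rewrite IHn // andbT; lia.
Qed.

Lemma is_tangle_crosses k s : all (fun i => i.+2 <= k)%N s ->
  is_tangle k k [seq (Cross, i) | i <- s].
Proof.
elim: s => [|i s IHs] /=; first by rewrite eqxx.
case/andP=> le_ik /IHs; rewrite addn2 le_ik /= subn2 addn2.
by case: k le_ik {IHs} => [|[|k]].
Qed.

Lemma is_tangle_cable k n m : (n.*2 + m <= k)%N ->
  is_tangle k k (cable_word n m).
Proof.
elim: m => [|m IHm] le_nk; first by rewrite /= eqxx.
have tc : is_tangle k k [seq (Cross, (n + m + t)%N) | t <- iota 0 n].
  rewrite (map_comp (fun i => (Cross, i)) (addn (n + m))).
  apply: is_tangle_crosses; apply/allP => i /mapP[t]; rewrite mem_iota => lt_t ->; lia.
rewrite cable_wordS is_tangle_cat (is_tangle_strands tc) tc /=; apply: IHm; lia.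
Qed.

Lemma is_tangle_perm_word k o s : (o + size s <= k)%N ->
  is_tangle k k (perm_word o s).
Proof.
elim: s o => [|x s IHs] o /= le_ok; first by rewrite eqxx.
have tp : is_tangle k k (perm_word o.+1 s) by apply: IHs; lia.
rewrite is_tangle_cat (is_tangle_strands tp) tp /=.
rewrite (map_comp (fun i => (Cross, i)) (addn o)).
apply: is_tangle_crosses; apply/allP => i /mapP[t]; rewrite mem_iota => lt_t ->.
by have := count_size (fun y => y < x)%N s; lia.
Qed.

Lemma tangle_comb_symmetrizer k n : (n <= k)%N -> tangle_comb k k (symmetrizer n).
Proof.
move=> le_nk; apply/tangle_combZ/tangle_comb_sum => s _; apply/tangle_combZ.
apply/tangle_comb_tg/is_tangle_perm_word.
by rewrite size_map size_enum_ord.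
Qed.

Lemma tangle_comb_join k n m : tangle_comb (n.*2 + m + k) (m + k)
  (symmetrizer n * tg (cable_word n m ++ nested_caps 0 n)).
Proof.
apply: tangle_combM; first by apply: tangle_comb_symmetrizer; lia.
have tc : is_tangle (n.*2 + m + k) (n.*2 + m + k) (cable_word n m).
  by apply: is_tangle_cable; lia.
apply: tangle_comb_tg; rewrite is_tangle_cat (is_tangle_strands tc) tc.
by rewrite (_ : n.*2 + m + k = m + k + n.*2)%N ?is_tangle_nested_caps //; lia.
Qed.

Lemma tangle_comb_loop n : tangle_comb 0 0 (loop_tangle n).
Proof.
have tcup := is_tangle_nested_cups n (leqnn 0).
have tcap := is_tangle_nested_caps n (leqnn 0).
rewrite add0n in tcup tcap.
apply: (@tangle_combM _ n.*2); last exact: tangle_comb_tg.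
apply: (@tangle_combM _ n.*2); first exact: tangle_comb_tg.
by apply: tangle_comb_symmetrizer; rewrite -addnn leq_addr.
Qed.

Lemma is_tangle_vertex k o x y z : (o <= k)%N -> admissible z y x ->
  is_tangle k (k + (x + y + z)) (vertex_word o x y z).
Proof.
move=> le_ok /and4P[ev1 le1 le2 le3]; rewrite /vertex_word.
set xz := (_ + _ - y)./2; set xy := (_ + _ - z)./2; set yz := (_ + _ - x)./2.
have t1 := is_tangle_nested_cups xz le_ok.
have t2 : is_tangle (k + xz.*2) (k + xz.*2 + xy.*2) (nested_cups (o + xz) xy).
  by apply: is_tangle_nested_cups; lia.
rewrite !is_tangle_cat (is_tangle_strands t1) t1 (is_tangle_strands t2) t2 /=.
rewrite (_ : k + (x + y + z) = k + xz.*2 + xy.*2 + yz.*2)%N.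
  by apply: is_tangle_nested_cups; lia.
by rewrite /xz /xy /yz; lia.
Qed.

(** * Sums over edge labellings *)

Section SumLab.
Variables (E : eqType) (K : comNzRingType) (nl : E -> nat) (wt : E -> nat -> K).

Definition upd (c : E -> nat) e a : E -> nat := fun x => if x == e then a else c x.

(** Edges live in a type that may be infinite, so nested sums over updates of a total labelling
    replace a sum over finite functions; edges outside [es] keep their label under [c]. *)
Fixpoint sumlab (es : seq E) (c : E -> nat) (F : (E -> nat) -> K) : K :=
  if es is e :: es' then \sum_(a < nl e) wt e a * sumlab es' (upd c e a) F
  else F c.

Lemma updC c e e' a a' : e != e' -> upd (upd c e a) e' a' = upd (upd c e' a') e a.
Proof.
move=> ne; apply: functional_extensionality => x; rewrite /upd.
by case: (x =P e') => // ->; rewrite eq_sym (negPf ne).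
Qed.

Lemma eq_sumlab es c F G :
  (forall c', (forall x, x \notin es -> c' x = c x) -> F c' = G c') ->
  sumlab es c F = sumlab es c G.
Proof.
elim: es c => [|e es IHes] c eqFG; first exact: eqFG.
apply: eq_bigr => a _; congr (_ * _); apply: IHes => c' Ec'; apply: eqFG => x.
rewrite inE negb_or => /andP[/negPf ne nx].
by rewrite Ec' // /upd ne.
Qed.

Lemma sumlab_cat es1 es2 c F :
  sumlab (es1 ++ es2) c F = sumlab es1 c (fun c' => sumlab es2 c' F).
Proof. by elim: es1 c => [|e es IHes] c //=; apply: eq_bigr => a _; rewrite IHes. Qed.

Lemma sumlab_sum es c (I : Type) (r : seq I) (P : pred I) F :
  sumlab es c (fun c' => \sum_(i <- r | P i) F i c')
  = \sum_(i <- r | P i) sumlab es c (F i).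
Proof.
elim: es c => [|e es IHes] c //=.
by rewrite exchange_big /=; apply: eq_bigr => a _; rewrite IHes mulr_sumr.
Qed.

Lemma sumlabZ es c a F : sumlab es c (fun c' => a * F c') = a * sumlab es c F.
Proof.
elim: es c => [|e es IHes] c //=.
by rewrite mulr_sumr; apply: eq_bigr => b _; rewrite IHes mulrCA.
Qed.

Lemma sumlabD es c F G :
  sumlab es c (fun c' => F c' + G c') = sumlab es c F + sumlab es c G.
Proof.
elim: es c => [|e es IHes] c //=.
by rewrite -big_split; apply: eq_bigr => b _; rewrite IHes mulrDr.
Qed.

Lemma sumlabN es c F : sumlab es c (fun c' => - F c') = - sumlab es c F.
Proof.
rewrite -[RHS]mulN1r -sumlabZ; apply: eq_sumlab => c' _; by rewrite mulN1r.
Qed.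

Lemma sumlab_rem x es c F : x \in es -> sumlab es c F = sumlab (x :: rem x es) c F.
Proof.
elim: es c => // e es IHes c; rewrite inE /=; case: (eqVneq x e) => [->|ne] //= xes.
under eq_bigr do rewrite (IHes _ xes) /= mulr_sumr.
rewrite exchange_big /=; apply: eq_bigr => a _; rewrite mulr_sumr.
by apply: eq_bigr => b _; rewrite mulrCA (updC _ _ _ ne).
Qed.

Lemma sumlab_perm es es' c F : perm_eq es es' -> sumlab es c F = sumlab es' c F.
Proof.
elim: es es' c => [|e es IHes] es' c eq_es.
  by move: eq_es; rewrite perm_sym => /perm_nilP ->.
have e_es' : e \in es' by rewrite -(perm_mem eq_es) mem_head.
rewrite (sumlab_rem _ _ e_es') /=; apply: eq_bigr => a _; congr (_ * _).
by apply: IHes; rewrite -(perm_cons e) (perm_trans eq_es) // perm_to_rem.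
Qed.

End SumLab.

Lemma sumlab_map (E E' : eqType) (K : comNzRingType) nl nl' wt wt'
    (f : E -> E') es c (F : (E -> nat) -> K) :
  injective f -> nl' \o f =1 nl -> (forall e, wt' (f e) =1 wt e) ->
  sumlab nl' wt' (map f es) c (fun c' => F (c' \o f)) = sumlab nl wt es (c \o f) F.
Proof.
move=> injf Enl Ewt; elim: es c => [|e es IHes] c //=.
rewrite -(Enl e); apply: eq_bigr => a _; rewrite Ewt IHes; congr (_ * sumlab _ _ _ _ _).
by apply: functional_extensionality => x; rewrite /upd /= (inj_eq injf).
Qed.

(** * Closing the edges of a network *)

Section Closing.
Variables (E : eqType) (G : spin_network E) (arc : pred E).
Variables (nl : E -> nat) (wt : E -> nat -> rat) (eps : E -> bool -> rat).
Variable U : E -> bool -> nat -> seq bool -> rat.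
Local Notation col := (sn_colour G).
(** Both ends of an edge are expanded along the same labels. On circle arcs the two ends will use
    dual bases, told apart by the marks, which must therefore differ; on the other edges one
    orthogonal basis serves both ends. *)
Hypothesis pairingE : forall x b b' s u, arc x ==> (b != b') ->
  size s = col x -> size u = col x ->
  pairing (col x) s u
  = eps x b * \sum_(a < nl x) wt x a * (U x b a s * U x b' a u).

(** The sign produced when [close_edges] brings the far end of each edge across the strands in
    between, times the sign [eps] read at the end met first; the recursion is that of
    [close_edges]. *)
Fixpoint closing_sign N (z : seq (E * bool)) : rat :=
  match N, z with
  | N'.+1, (x, b) :: z' =>
      let k := index x (unzip1 z') in
      (-1) ^+ (col x * sumn (take k [seq col y.1 | y <- z'])) * eps x b
        * closing_sign N' (take k z' ++ drop k.+1 z')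
  | _, _ => 1
  end.

Definition end_product (c : E -> nat) (z : seq (E * bool)) (ss : seq (seq bool)) :=
  \prod_(y <- zip z ss) U y.1.1 y.1.2 (c y.1.1) y.2.

Lemma unzip1_split (z : seq (E * bool)) x : x \in unzip1 z ->
  exists z1 b z2, z = z1 ++ (x, b) :: z2 /\ x \notin unzip1 z1.
Proof.
elim: z => [|[y b] z IHz] //=; rewrite inE; case: (eqVneq x y) => [->|ne] /=.
  by move=> _; exists [::], b, z.
case/IHz=> z1 [b' [z2 [-> nx]]]; exists ((y, b) :: z1), b', z2.
by rewrite /= inE negb_or ne.
Qed.

Definition well_sized (z : seq (E * bool)) (ss : seq (seq bool)) :=
  all2 (fun y s => size s == col y.1) z ss.

Lemma well_sized_cat z1 z2 ss : well_sized (z1 ++ z2) ss ->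
  exists ss1 ss2, [/\ ss = ss1 ++ ss2, size ss1 = size z1,
    well_sized z1 ss1 & well_sized z2 ss2].
Proof.
elim: z1 ss => [|y z1 IHz] ss /=; first by exists [::], ss.
case: ss => // s ss /= /andP[sy /IHz [ss1 [ss2 [-> sz1 w1 w2]]]].
by exists (s :: ss1), ss2; rewrite /= sz1 sy.
Qed.

Lemma size_flatten_well_sized z ss : well_sized z ss ->
  size (flatten ss) = sumn [seq col y.1 | y <- z].
Proof.
elim: z ss => [|y z IHz] [|s ss] //= /andP[/eqP sy /IHz IH].
by rewrite size_cat sy IH.
Qed.

(** Cutting every edge by [pairingE] turns the closing tangle into a sum over edge labels of a
    product over the ends. *)
Lemma ev_close_edges N z ss c0 : (size z <= N)%N ->
  (forall y, y \in unzip1 z -> count_mem y (unzip1 z) = 2%N) ->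
  uniq [seq y <- z | arc y.1] -> well_sized z ss ->
  ev (close_edges G N (unzip1 z)) (fun=> 1) (flatten ss)
  = closing_sign N z
      * sumlab nl wt (undup (unzip1 z)) c0 (fun c => end_product c z ss).
Proof.
elim: N z ss c0 => [|N IHN] z ss c0.
  case: z => // _ _ _; case: ss => //= _.
  by rewrite ev1 mul1r /end_product big_nil.
case: z => [_ _ _|[x b] z].
  by case: ss => //= _; rewrite ev1 mul1r /end_product big_nil.
case: ss => [|s ss]; first by [].
rewrite /= ltnS => le_zN cnt uz /andP[/eqP szs wz].
have x_z : x \in unzip1 z.
  have := cnt x; rewrite mem_head eqxx => /(_ isT) [cx].
  by rewrite -has_pred1 has_count; move: cx; rewrite /= add0n => ->.
have [z1 [b' [z2 [Ez nx]]]] := unzip1_split x_z; subst z.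
have [ss1 [ss' [Ess sz1 w1 w2']]] := well_sized_cat wz.
case: ss' w2' Ess => // u ss2 /= /andP[/eqP szu w2] Ess; subst ss.
have Eu : unzip1 (z1 ++ (x, b') :: z2) = unzip1 z1 ++ x :: unzip1 z2.
  by rewrite /unzip1 map_cat.
have Ek : index x (unzip1 (z1 ++ (x, b') :: z2)) = size z1.
  by rewrite Eu index_cat (negPf nx) /= eqxx addn0 size_map.
have Erem : rem x (unzip1 (z1 ++ (x, b') :: z2)) = unzip1 (z1 ++ z2).
  rewrite remE Ek Eu -(size_map fst z1) -/(unzip1 z1) take_size_cat //.
  by rewrite -cat_rcons drop_size_cat ?size_rcons // /unzip1 map_cat.
have nx2 : x \notin unzip1 z2.
  have := cnt x; rewrite mem_head Eu count_cat /= eqxx => /(_ isT).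
  by rewrite (count_memPn nx) add0n !add1n => -[] /count_memPn.
have szk : size z1 = size [seq col y.1 | y <- z1] by rewrite size_map.
have neb : arc x ==> (b != b').
  apply/implyP => ax; apply: contraTneq uz => ->.
  by rewrite /= ax filter_cat /= ax mem_cat mem_head orbT.
have zE : take (size z1) (z1 ++ (x, b') :: z2)
    ++ drop (size z1).+1 (z1 ++ (x, b') :: z2) = z1 ++ z2.
  by rewrite take_size_cat // -cat_rcons drop_size_cat ?size_rcons.
have Em : take (size z1) [seq col y.1 | y <- z1 ++ (x, b') :: z2]
    = [seq col y.1 | y <- z1] by rewrite map_cat szk take_size_cat.
have Em' : [seq col y | y <- take (size z1) (unzip1 (z1 ++ (x, b') :: z2))]
    = [seq col y.1 | y <- z1].
  by rewrite Eu -(size_map fst z1) take_size_cat // /unzip1 -map_comp.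
rewrite Erem Ek Em' zE Em flatten_cat /= evM.
rewrite ev_join // ?(size_flatten_well_sized w1) // -flatten_cat.
have cnt' y : y \in unzip1 (z1 ++ z2) -> y != x /\ count_mem y (unzip1 (z1 ++ z2)) = 2%N.
  rewrite {1}/unzip1 map_cat => yz.
  have ne : y != x by apply: contraTneq yz => ->; rewrite mem_cat negb_or nx.
  split=> //; have := cnt y.
  rewrite !inE (negPf ne) Eu mem_cat in_cons (negPf ne) /= -mem_cat yz => /(_ isT).
  by rewrite eq_sym (negPf ne) !count_cat /= eq_sym (negPf ne) !add0n /unzip1 map_cat count_cat.
have le' : (size (z1 ++ z2) <= N)%N.
  by move: le_zN; rewrite !size_cat /= addnS => /ltnW.
have uz' : uniq [seq y <- z1 ++ z2 | arc y.1].
  apply: subseq_uniq uz; rewrite /=; apply: subseq_trans (_ : subseq [seq y <- z1 ++ (x, b') :: z2 | arc y.1] _).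
    rewrite !filter_cat cat_subseq //=; case: ifP => // _; exact: subseq_cons.
  by case: ifP => // _; exact: subseq_cons.
have wz' : well_sized (z1 ++ z2) (ss1 ++ ss2).
  rewrite /well_sized; elim: (z1) (ss1) sz1 w1 => [|y z' IHz] [|v ss'] //= [sz'] /andP[-> wz'].
  exact: IHz.
have perm_un : perm_eq (undup (x :: unzip1 (z1 ++ (x, b') :: z2))) (x :: undup (unzip1 (z1 ++ z2))).
  apply: uniq_perm; first exact: undup_uniq.
    rewrite /= mem_undup undup_uniq andbT.
    by apply/negP => /cnt' []; rewrite eqxx.
  move=> y; rewrite mem_undup !in_cons mem_undup Eu /unzip1 map_cat !mem_cat in_cons.
  by case: eqP => //=.
rewrite [undup _]/= in perm_un.
rewrite -/(undup (x :: unzip1 (z1 ++ (x, b') :: z2))) (sumlab_perm _ _ _ _ perm_un) /=.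
rewrite (pairingE neb szs szu).
have pull (A e V : rat) (F : 'I_(nl x) -> rat) :
  A * (e * \sum_a F a) * V = \sum_a A * (e * F a) * V.
  by rewrite !mulr_sumr mulr_suml.
rewrite pull [RHS]mulr_sumr; apply: eq_bigr => a _.
(* The edge [x] does not occur among the remaining ends, so the label [a] given to it here survives
   in the inner sum. *)
rewrite (IHN _ _ (upd c0 x a) le' (fun y yz => proj2 (cnt' y yz)) uz' wz').
rewrite (_ : sumlab _ _ _ _ (fun c => end_product c (_ :: _) _)
  = U x b a s * U x b' a u * sumlab nl wt (undup (unzip1 (z1 ++ z2)))
      (upd c0 x a) (fun c => end_product c (z1 ++ z2) (ss1 ++ ss2))).
  by ring.
rewrite -sumlabZ; apply: eq_sumlab => c' Ec'.
have Ecx : c' x = a.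
  by rewrite Ec' /upd ?eqxx // mem_undup; apply/negP => /cnt' []; rewrite eqxx.
rewrite /end_product /= big_cons !zip_cat ?sz1 // !big_cat big_cons /= Ecx.
by ring.
Qed.

Lemma tangle_comb_close_edges N s : (size s <= N)%N ->
  (forall y, y \in s -> count_mem y s = 2%N) ->
  tangle_comb (sumn [seq col y | y <- s]) 0 (close_edges G N s).
Proof.
elim: N s => [|N IHN] [|x s] //; try by move=> _ _; exact: tangle_comb1.
rewrite /= ltnS => le_sN cnt.
have cx : count_mem x s = 1%N.
  by have := cnt x; rewrite mem_head eqxx => /(_ isT) [].
have x_s : x \in s by rewrite -has_pred1 has_count cx.
case/splitPr: s / x_s le_sN cnt cx => s1 s2 le_sN cnt.
rewrite count_cat /= eqxx add1n addnS => -[/eqP].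
rewrite addn_eq0 => /andP[/eqP/count_memPn nx /eqP/count_memPn nx2].
have Ei : index x (s1 ++ x :: s2) = size s1.
  by rewrite index_cat (negPf nx) /= eqxx addn0.
rewrite remE Ei take_size_cat // -[in drop _ _]cat_rcons drop_size_cat ?size_rcons //.
have -> : (col x + sumn [seq col y | y <- s1 ++ x :: s2]
    = (col x).*2 + sumn [seq col y | y <- s1] + sumn [seq col y | y <- s2])%N.
  by rewrite map_cat sumn_cat /=; lia.
apply: (tangle_combM (@tangle_comb_join (sumn [seq col y | y <- s2]) (col x) (sumn [seq col y | y <- s1]))).
rewrite -sumn_cat -map_cat; apply: IHN.
  by move: le_sN; rewrite !size_cat /= addnS => /ltnW.
move=> y ys; have ne : y != x by apply: contraTneq ys => ->; rewrite mem_cat negb_or nx.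
have := cnt y; rewrite !inE (negPf ne) mem_cat in_cons (negPf ne) -mem_cat ys => /(_ isT).
by rewrite !count_cat /= eq_sym (negPf ne) !add0n.
Qed.

End Closing.

Lemma strs_count (V : nmodType) n b (F : nat -> V) :
  \sum_(t <- strs n) F (count_mem b t) = \sum_(k < n.+1) F k *+ 'C(n, k).
Proof.
elim: n F => [|n IHn] F; first by rewrite big_strs0 big_ord1.
have -> : \sum_(t <- strs n.+1) F (count_mem b t)
    = \sum_(t <- strs n) F (count_mem b t).+1 + \sum_(t <- strs n) F (count_mem b t).
  by rewrite big_strsS; case: (b) => //=; rewrite addrC.
rewrite (IHn (fun k => F k.+1)) IHn.
rewrite [RHS]big_ord_recl bin0 [X in _ + X]big_ord_recl bin0 addrCA; congr (_ + _).
under [RHS]eq_bigr do rewrite /= binS mulrnDr.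
rewrite big_split /= addrC; congr (_ + _).
by rewrite [RHS]big_ord_recr /= bin_small // mulr0n addr0.
Qed.

(** The strings with k labels [true] are as many as a binomial coefficient, and each contributes the
    sign divided by it, so the n + 1 values of k contribute equally. *)
Lemma ev_loop n f s :
  ev (loop_tangle n) f s = (-1) ^+ n * n.+1%:R * f s.
Proof.
rewrite /loop_tangle evM evM ev_tg -[s]cat0s (ev_nested_cups _ _ _ (erefl (size [::]))).
have E t : t \in strs n -> cupw t * ev (symmetrizer n) (fun u => ev (tg (nested_caps 0 n)) f u) ([::] ++ t ++ dual t ++ s)
   = (-1) ^+ n / 'C(n, count_mem true t)%:R * f s.
  move=> /size_strs szt; rewrite -evM -[nested_caps 0 n]cat0s.
  have := @ev_join n 0 f t [::] (dual t) s szt (erefl _).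
  rewrite size_dual => /(_ szt); rewrite !cat0s muln0 mul1r => ->.
  have cdt := count_negb t; rewrite szt in cdt.
  rewrite /pairing count_dual cdt eqxx cupwE -{2}cdt exprD; ring.
rewrite (eq_big_seq _ E) -mulr_suml; congr (_ * _).
rewrite (strs_count n true (fun k => (-1) ^+ n / 'C(n, k)%:R)).
rewrite (eq_bigr (fun=> (-1) ^+ n)) ?sumr_const ?card_ord ?mulr_natr // => k _.
rewrite -[LHS]mulr_natr mulfVK // Num.Theory.pnatr_eq0 -lt0n bin_gt0 -ltnS //.
Qed.

(** * Evaluation of the network of a diagram *)

(* Matrices of e - f, - e - f and h in the irreducible representation of sl2 of
   dimension d: an orthogonal basis for the invariant form. *)
Definition rho (K : comNzRingType) d (c : nat) : 'M[K]_d :=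
  \matrix_(i, j)
    let e := (d - i)%:R *+ (i == j.+1 :> nat) in
    let f := i.+1%:R *+ (j == i.+1 :> nat) in
    match c with
    | 0%N => e - f
    | 1%N => - e - f
    | _ => (i.*2.+1%:R - d%:R) *+ (i == j)
    end.

Lemma rho1 (K : comNzRingType) c : rho K 1 c = 0.
Proof.
apply/matrixP => i j; rewrite !ord1 !mxE /=.
by case: c => [|[|c]]; rewrite /= ?mulr0n ?subrr ?oppr0 ?addr0 ?mul0rn.
Qed.

(** The coefficients that make the pairing of colour 2 diagonal in the forms [leg_form]. Labels
    above 2 are treated as 2, here as in [rho] and [eps3], so that labels can be plain natural
    numbers. *)
Definition edge_weight (K : fieldType) (c : nat) : K :=
  if c is 0%N then 2%:R^-1 else - 2%:R^-1.

Definition leg_form (c : nat) (s : seq bool) : rat :=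
  match c, count_mem true s with
  | 0%N, 0%N => 1
  | 0%N, 2 => 1
  | 1%N, 0%N => 1
  | 1%N, 2 => -1
  | c, 1%N => (1 < c)%:R
  | _, _ => 0
  end.

Lemma leg_pairing s u : size s = 2%N -> size u = 2%N ->
  pairing 2 s u
  = \sum_(a < 3) edge_weight rat a * (leg_form a s * leg_form a u).
Proof.
case: s => [|s1 [|s2 []]] // _; case: u => [|u1 [|u2 []]] // _.
rewrite !big_ord_recl big_ord0 /= /edge_weight /bump /=.
by case: s1; case: s2; case: u1; case: u2.
Qed.

(** Reading the first end through n - a instead of a exchanges the arguments of the form, which is
    symmetric up to (-1)^n; hence the sign when the end met first is marked [true]. *)
Lemma arc_pairing n (b : bool) s u : size s = n -> size u = n ->
  pairing n s u
  = (if b then (-1) ^+ n else 1) * \sum_(a < n.+1) (-1) ^+ a / 'C(n, a)%:R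
      * ((count_mem true s == if b then n - a else a)%N%:R
         * (count_mem true u == if b then a : nat else n - a)%N%:R).
Proof.
move=> szs szu; have le_s := count_size (pred1 true) s.
have le_u := count_size (pred1 true) u; rewrite szs in le_s; rewrite szu in le_u.
rewrite /pairing.
move: (count_mem true s) (count_mem true u) le_s le_u => x y le_s le_u.
have Exy (k : nat) : (k <= n)%N -> (x + k == n)%N = (x == n - k)%N by lia.
have Eyx : (x + y == n)%N = (y == n - x)%N by lia.
case: b.
  rewrite (bigD1 (Ordinal (le_u : y < n.+1)%N)) //= eqxx mulr1.
  rewrite big1 ?addr0 => [|a /eqP ne]; last first.
    case: (y =P a) => [Ea|]; last by rewrite !mulr0.
    by case: ne; apply: val_inj.
  rewrite -Exy //; case: eqP => [En|_]; last by rewrite !mulr0.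
  have -> : y = (n - x)%N by lia.
  rewrite mulr1 bin_sub // mulrA -exprD; congr (_ / _).
  rewrite -signr_odd -[RHS]signr_odd; congr (_ ^+ _); lia.
rewrite (bigD1 (Ordinal (le_s : x < n.+1)%N)) //= eqxx !mul1r.
rewrite big1 ?addr0 => [|a /eqP ne]; last first.
  case: (x =P a) => [Ea|]; last by rewrite mul0r mulr0.
  by case: ne; apply: val_inj.
by rewrite Eyx; case: eqP => _; rewrite ?mulr1 ?mulr0.
Qed.

Lemma ev_vertex_word o x y z f s1 s2 : size s1 = o ->
  ev_word (vertex_word o x y z) f (s1 ++ s2)
  = \sum_(A <- strs ((x + z - y)./2)) \sum_(B <- strs ((x + y - z)./2))
    \sum_(C <- strs ((y + z - x)./2)) cupw A * cupw B * cupw C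
      * f (s1 ++ (A ++ B) ++ (dual B ++ C) ++ (dual C ++ dual A) ++ s2).
Proof.
move=> sz1; rewrite /vertex_word !ev_word_cat ev_nested_cups //.
apply: eq_big_seq => A /size_strs szA.
have -> : s1 ++ A ++ dual A ++ s2 = (s1 ++ A) ++ (dual A ++ s2) by rewrite !catA.
rewrite ev_nested_cups ?size_cat ?sz1 ?szA // mulr_sumr.
apply: eq_big_seq => B /size_strs szB.
have -> : (s1 ++ A) ++ B ++ dual B ++ dual A ++ s2
    = (s1 ++ A ++ B ++ dual B) ++ (dual A ++ s2) by rewrite -!catA.
rewrite ev_nested_cups; last first.
  by rewrite !size_cat size_dual sz1 szA szB addnn addnA.
rewrite !mulr_sumr; apply: eq_bigr => C _; rewrite !mulrA; congr (_ * f _).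
by rewrite -!catA.
Qed.

Lemma mul_sum3 (T : Type) (r1 r2 r3 : seq T) (F : T -> T -> T -> rat) a b :
  a * (\sum_(A <- r1) \sum_(B <- r2) \sum_(C <- r3) F A B C) * b
  = \sum_(A <- r1) \sum_(B <- r2) \sum_(C <- r3) a * F A B C * b.
Proof.
rewrite mulr_sumr mulr_suml; apply: eq_bigr => A _.
rewrite mulr_sumr mulr_suml; apply: eq_bigr => B _.
by rewrite mulr_sumr mulr_suml.
Qed.

Section Network.
Variables (n : nat) (lam : 'I_n -> nat) (D : diagram n).
Local Notation E := (arc_edge n).
Local Notation G := (diagram_network lam D).
Local Notation col := (sn_colour G).

Definition is_arc (x : E) := if x is inr _ then true else false.
Definition labels (x : E) : nat := if x is inr y then (lam y.1).+1 else 3.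
Definition weight (x : E) (a : nat) : rat :=
  if x is inr y then (-1) ^+ a / 'C(lam y.1, a)%:R else edge_weight rat a.
Definition end_sign (x : E) (b : bool) : rat :=
  if x is inr y then if b then (-1) ^+ lam y.1 else 1 else 1.
Definition end_form (x : E) (b : bool) (a : nat) (s : seq bool) : rat :=
  if x is inr y then
    (count_mem true s == if b then lam y.1 - a else a)%N%:R
  else leg_form a s.

Lemma network_pairing x b b' s u : is_arc x ==> (b != b') ->
  size s = col x -> size u = col x ->
  pairing (col x) s u
  = end_sign x b * \sum_(a < labels x) weight x a * (end_form x b a s * end_form x b' a u).
Proof.
case: x => [e _|[i k] /= neb] szs szu; first by rewrite mul1r -leg_pairing.
rewrite /= (arc_pairing b szs szu).
by case: b neb; case: b'.
Qed.

(* The leftmost end of a vertex is marked with true: at a univalent vertex, this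
   is the incoming arc. *)
Definition marked_ends (vs : seq (E * E * E)) : seq (E * bool) :=
  flatten [seq [:: (v.2, true); (v.1.2, false); (v.1.1, false)] | v <- vs].

Lemma unzip1_marked_ends vs : unzip1 (marked_ends vs) = row_ends vs.
Proof. by elim: vs => //= v vs; rewrite /unzip1 /= => ->. Qed.

Definition amplitude (v : E * E * E) (c : E -> nat) : rat :=
  \sum_(A <- strs ((col v.2 + col v.1.1 - col v.1.2)./2))
  \sum_(B <- strs ((col v.2 + col v.1.2 - col v.1.1)./2))
  \sum_(C <- strs ((col v.1.2 + col v.1.1 - col v.2)./2)) cupw A * cupw B * cupw C
    * (end_form v.2 true (c v.2) (A ++ B)
       * (end_form v.1.2 false (c v.1.2) (dual B ++ C)
          * end_form v.1.1 false (c v.1.1) (dual C ++ dual A))).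

Definition admissible_vertex (v : E * E * E) :=
  admissible (col v.1.1) (col v.1.2) (col v.2).

Local Notation Sum := (sumlab labels weight).

Lemma ev_vertex_row es c0 vs o f s1 (F : (E -> nat) -> rat) :
  all admissible_vertex vs -> size s1 = o ->
  (forall ss, well_sized G (marked_ends vs) ss -> f (s1 ++ flatten ss)
    = Sum es c0 (fun c => F c * end_product end_form c (marked_ends vs) ss)) ->
  ev_word (vertex_row G o vs) f s1
  = Sum es c0 (fun c => F c * \prod_(v <- vs) amplitude v c).
Proof.
elim: vs o s1 F => [|v vs IHvs] o s1 F.
  move=> _ _ /(_ [::] isT); rewrite cats0 /= => ->.
  by apply: eq_sumlab => c _; rewrite /end_product !big_nil.
case: v => [[x y] z] /andP[adm advs] sz1 Ef.
rewrite /= ev_word_cat -[s1]cats0 ev_vertex_word //.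
under [RHS]eq_sumlab => c _ do rewrite big_cons {1}/amplitude mulrA mul_sum3.
rewrite sumlab_sum; apply: eq_big_seq => A /size_strs szA.
rewrite sumlab_sum; apply: eq_big_seq => B /size_strs szB.
rewrite sumlab_sum; apply: eq_big_seq => C /size_strs szC.
rewrite cats0; set X := A ++ B; set Y := dual B ++ C; set Z := dual C ++ dual A.
have {adm} [szX szY szZ] : [/\ size X = col z, size Y = col y & size Z = col x].
  case/and4P: adm => /= ev1 le1 le2 le3.
  by rewrite /X /Y /Z !size_cat !size_dual szA szB szC /=; split; lia.
clearbody X Y Z; rewrite (IHvs _ _ (fun c => F c * (end_form z true (c z) X
     * (end_form y false (c y) Y * end_form x false (c x) Z)))) //.
- by rewrite -sumlabZ; apply: eq_sumlab => c _; rewrite /=; ring.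
- rewrite !size_cat szX szY szZ sz1; congr (_ + _)%N.
  by rewrite addnC [(col y + _)%N]addnC.
- move=> ss wss; rewrite -!catA.
  have := Ef (X :: Y :: Z :: ss); rewrite /= szX szY szZ !eqxx => /(_ wss) ->.
  by apply: eq_sumlab => c _; rewrite /end_product /= !big_cons /=; ring.
Qed.

Lemma is_tangle_vertex_row vs o : all admissible_vertex vs ->
  is_tangle o (o + sumn [seq col x | x <- row_ends vs]) (vertex_row G o vs).
Proof.
elim: vs o => [|[[x y] z] vs IHvs] o /=; first by rewrite addn0.
case/andP=> adm /IHvs IH; have tv := is_tangle_vertex (leqnn o) adm.
rewrite is_tangle_cat (is_tangle_strands tv) tv /=.
have -> : (o + (col x + col y + col z) = o + (col z + col y + col x))%N by lia.
by have := IH (o + (col z + col y + col x))%N; rewrite -!addnA.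
Qed.

(** * The sign of the crossings *)

Local Notation sign := (closing_sign G end_sign).

Definition matched (T : eqType) (s : seq T) :=
  forall y, y \in s -> count_mem y s = 2%N.

Lemma matched_split (T : eqType) (x : T) (b : bool) (z : seq (T * bool)) :
  matched (unzip1 ((x, b) :: z)) ->
  exists z1 b' z2, [/\ z = z1 ++ (x, b') :: z2, x \notin unzip1 z1,
    x \notin unzip1 z2 & matched (unzip1 (z1 ++ z2))].
Proof.
move=> mz; have x_z : x \in unzip1 z.
  have := mz x; rewrite mem_head /= eqxx => /(_ isT) [cx].
  by rewrite -has_pred1 has_count; move: cx; rewrite /= add0n => ->.
have [z1 [b' [z2 [Ez nx]]]] := unzip1_split x_z.
exists z1, b', z2; split=> //.
  have := mz x; rewrite mem_head Ez /unzip1 /= map_cat count_cat /= eqxx => /(_ isT).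
  by rewrite (count_memPn nx) add0n !add1n => -[] /count_memPn.
rewrite {}Ez in mz => y; rewrite /unzip1 map_cat => yz.
have ne : y != x.
  apply: contraTneq yz => ->; rewrite mem_cat negb_or nx.
  have := mz x; rewrite mem_head /unzip1 /= map_cat count_cat /= eqxx => /(_ isT).
  by rewrite (count_memPn nx) add0n !add1n => -[] /count_memPn.
have := mz y; rewrite /unzip1 /= map_cat inE mem_cat in_cons (negPf ne) /= -mem_cat yz.
by move=> /(_ isT); rewrite !count_cat /= eq_sym (negPf ne) !add0n.
Qed.

Lemma closing_sign_cons N (x : E) b z1 b' z2 : x \notin unzip1 z1 ->
  sign N.+1 ((x, b) :: z1 ++ (x, b') :: z2)
  = (-1) ^+ (col x * sumn [seq col y.1 | y <- z1]) * end_sign x b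
    * sign N (z1 ++ z2).
Proof.
move=> nx; rewrite /=.
have -> : index x (unzip1 (z1 ++ (x, b') :: z2)) = size z1.
  by rewrite /unzip1 map_cat index_cat (negPf nx) /= eqxx addn0 size_map.
rewrite map_cat take_size_cat ?size_map // take_size_cat //.
by rewrite -cat_rcons drop_size_cat ?size_rcons.
Qed.

Lemma closing_sign0 N : sign N [::] = 1.
Proof. by case: N. Qed.

(** Edges of the uni-trivalent graph have the even colour 2, so crossings with them give no sign and
    they can be deleted. *)
Lemma closing_sign_arcs N N' (z : seq (E * bool)) : (size z <= N)%N ->
  (size [seq y <- z | is_arc y.1] <= N')%N -> matched (unzip1 z) ->
  sign N z = sign N' [seq y <- z | is_arc y.1].
Proof.
elim: N N' z => [|N IHN] N' z.
  by case: z => // _ _ _; rewrite !closing_sign0.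
case: z => [_ _ _|[x b] z le_zN le_fN mz]; first by rewrite !closing_sign0.
have [z1 [b' [z2 [Ez nx1 nx2 mz']]]] := matched_split mz; subst z.
have le' : (size (z1 ++ z2) <= N)%N.
  by move: le_zN; rewrite /= !size_cat /= addnS => /ltnW.
rewrite closing_sign_cons //; case: x nx1 nx2 mz le_zN le_fN => [e|[i k]] nx1 nx2 mz le_zN le_fN.
  rewrite /= -[(-1) ^+ _]signr_odd oddM !mul1r filter_cat /= -filter_cat.
  by apply: IHN => //; move: le_fN; rewrite /= !filter_cat.
rewrite /= filter_cat /=; case: N' le_fN => // N' le_fN.
rewrite closing_sign_cons; last first.
  by apply: contra nx1 => /mapP[y]; rewrite mem_filter => /andP[_ yz] ->; apply: map_f.
rewrite -filter_cat (IHN N') //; last first.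
  by move: le_fN; rewrite /= !filter_cat /= !size_cat /= addnS => /ltnW.
congr (_ * _ * _); rewrite -signr_odd -[RHS]signr_odd !oddM.
suff -> : odd (sumn [seq col y.1 | y <- z1]) = odd (sumn [seq col y.1 | y <- z1 & is_arc y.1]) by [].
by elim: (z1) => [|[[e|[j l]] c] s IHs] //=; rewrite ?oddD IHs ?negbK.
Qed.

Definition arc_block (i : 'I_n) m : seq (E * bool) :=
  flatten [seq [:: (inr (i, (k + m.-1) %% m)%N, true); (inr (i, k), false)]
          | k <- iota 0 m].

Definition arc_pairs (i : 'I_n) m : seq (E * bool) :=
  flatten [seq [:: (inr (i, k), false); (inr (i, k), true)] | k <- iota 0 m].

Lemma iota0S m : iota 0 m.+1 = rcons (iota 0 m) m.
Proof. by rewrite -addn1 iotaD cats1. Qed.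

(** Along a circle the last arc comes in first and goes out last. It encloses the other arcs, whose
    two ends are adjacent, and it alone is met first at an end marked [true]. *)
Lemma arc_blockE i m :
  arc_block i m.+1 = (inr (i, m), true) :: arc_pairs i m ++ [:: (inr (i, m), false)].
Proof.
rewrite /arc_block /arc_pairs.
have step l : (l <= m)%N ->
    flatten [seq [:: (inr (i, (k + m) %% m.+1)%N : E, true); (inr (i, k), false)]
            | k <- iota 0 l.+1]
    = (inr (i, m), true) :: flatten [seq [:: (inr (i, k) : E, false); (inr (i, k), true)]
                       | k <- iota 0 l] ++ [:: (inr (i, l), false)].
  elim: l => [|l IHl] le_lm; first by rewrite /= add0n modn_small.
  rewrite (iota0S l.+1) map_rcons -cats1 flatten_cat IHl; last exact: ltnW.
  rewrite (iota0S l) map_rcons -cats1 flatten_cat /= -!catA /= (_ : (l.+1 + m) %% m.+1 = l)%N //.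
  by rewrite addSnnS modnDr modn_small // ltnS ltnW.
exact: step.
Qed.

Lemma sign_arc_pairs N i m z : (size (arc_pairs i m ++ z) <= N)%N ->
  exists2 N', (size z <= N')%N & sign N (arc_pairs i m ++ z) = sign N' z.
Proof.
rewrite /arc_pairs; elim: (iota 0 m) N => [|k s IHs] N le_N; first by exists N.
case: N le_N => // N /= le_N.
rewrite eqxx /= muln0 !mul1r drop0; apply: IHs.
by apply: leq_trans (leqnSn _) _.
Qed.

(** The enclosed arcs give no sign, and the enclosing arc crosses both ends of each of them, so that
    only its [end_sign] is left. A circle without legs is a loop and receives the same sign from
    [ev_loop]. *)
Lemma sign_arc_block N i m z : (size (arc_block i m ++ z) <= N)%N ->
  exists2 N', (size z <= N')%N & sign N (arc_block i m ++ z)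
    = (if m is 0%N then 1 else (-1) ^+ lam i) * sign N' z.
Proof.
case: m => [|m] le_N; first by exists N; rewrite // mul1r.
rewrite arc_blockE in le_N *; case: N le_N => // N le_N.
rewrite cat_cons -catA cat1s closing_sign_cons; last first.
  by apply/negP => /mapP[[x b] /flattenP[s /mapP[k]]]; rewrite mem_iota => lt_k ->;
    rewrite !inE => /orP[] /eqP -> // [] Ek; move: lt_k; rewrite -Ek; lia.
have le' : (size (arc_pairs i m ++ z) <= N)%N.
  by move: le_N; rewrite /= !size_cat /= addn1 addSn => /ltnW.
have [N' leN' ->] := sign_arc_pairs le'; exists N' => //.
congr (_ * _); rewrite /= -signr_odd oddM.
suff -> : odd (sumn [seq col y.1 | y <- arc_pairs i m]) = false by rewrite andbF mul1r.
by rewrite /arc_pairs; elim: (iota 0 m) => //= k s IHs; rewrite !oddD IHs addbF addbb.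
Qed.

Lemma marked_ends_cat vs vs' : marked_ends (vs ++ vs') = marked_ends vs ++ marked_ends vs'.
Proof. by rewrite /marked_ends map_cat flatten_cat. Qed.

Lemma filter_marked_ends : [seq y <- marked_ends (sn_vert G) | is_arc y.1]
  = flatten [seq arc_block i (size (legs D i)) | i <- enum 'I_n].
Proof.
rewrite marked_ends_cat filter_cat.
have -> : [seq y <- marked_ends [seq (inl v.1.1, inl v.1.2, inl v.2) | v <- ivert D] | is_arc y.1] = [::].
  by elim: (ivert D).
rewrite cat0s.
elim: (enum 'I_n) => //= i s IHs; rewrite marked_ends_cat filter_cat IHs; congr (_ ++ _).
rewrite /circle_vertices /arc_block; elim: (iota 0 _) => //= k ks IHk.
by rewrite -IHk.
Qed.

Lemma closing_signE N : (size (marked_ends (sn_vert G)) <= N)%N ->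
  matched (row_ends (sn_vert G)) ->
  sign N (marked_ends (sn_vert G))
  = \prod_i (if nilp (legs D i) then 1 else (-1) ^+ lam i).
Proof.
move=> le_N; rewrite -unzip1_marked_ends => mz.
rewrite (closing_sign_arcs le_N (leqnn _) mz) filter_marked_ends.
rewrite -[RHS]big_enum /=.
have := leqnn (size (flatten [seq arc_block i (size (legs D i)) | i <- enum 'I_n])).
move: {2 3}(size _) => M.
elim: (enum 'I_n) M => [|i s IHs] M le_M /=.
  by rewrite big_nil closing_sign0.
have [M' le_M' ->] := sign_arc_block le_M.
by rewrite big_cons (IHs M' le_M') /nilp; case: (size _).
Qed.

(** * The representation on a circle *)

Definition leg_amplitude (l c a b : nat) : rat :=
  \sum_(A <- strs 1) \sum_(B <- strs l.-1) \sum_(C <- strs 1)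
    cupw A * cupw B * cupw C
    * ((count_mem true (A ++ B) == l - a)%N%:R
       * ((count_mem true (dual B ++ C) == b)%:R
          * leg_form c (dual C ++ dual A))).

Lemma leg_amplitude_sum l c a b : leg_amplitude l c a b
  = \sum_(A <- [:: true; false]) \sum_(C <- [:: true; false])
      sgb A * sgb C * leg_form c [:: ~~ C; ~~ A]
      * \sum_(B <- strs l.-1) (-1) ^+ count_mem false B
          * (A + count_mem true B == l - a)%N%:R
          * (count_mem false B + C == b)%N%:R.
Proof.
rewrite /leg_amplitude.
have -> : strs 1 = map (fun b => [:: b]) [:: true; false] by [].
rewrite big_map; under eq_bigr do under eq_bigr do rewrite big_map.
apply: eq_bigr => A _; rewrite exchange_big; apply: eq_bigr => C _.
rewrite mulr_sumr; apply: eq_bigr => B _.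
rewrite /cupw !big_cons !big_nil !mulr1 -/(cupw B) cupwE.
rewrite !count_cat count_dual /= /dual /rev /= !addn0.
by rewrite !eqb_id; ring.
Qed.

(** Only the strings with b - C labels [false] contribute. Their number is a binomial coefficient of
    l - 1; its quotient by that of l, times l, is b or l - b. *)
Lemma dual_sum l a b (A C : bool) : (0 < l)%N -> (a <= l)%N -> (b <= l)%N ->
  l%:R * ((-1) ^+ b / 'C(l, b)%:R)
    * (\sum_(B <- strs l.-1) (-1) ^+ count_mem false B
          * (A + count_mem true B == l - a)%N%:R
          * (count_mem false B + C == b)%N%:R)
  = (if C then - b%:R else (l - b)%N%:R) *+ (b.+1 == a + A + C)%N :> rat.
Proof.
move=> l_gt0 le_al le_bl.
have nz : ('C(l, b)%:R : rat) != 0 by rewrite Num.Theory.pnatr_eq0 -lt0n bin_gt0.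
rewrite (eq_big_seq (fun B => (-1) ^+ count_mem false B *
    ((count_mem false B).+1 == a + A)%N%:R * (count_mem false B + C == b)%N%:R)); last first.
  move=> B /size_strs szB; congr (_ * _ * _); have := count_negb B; rewrite szB.
  move: (count_mem true B) (count_mem false B) => x y Exy; congr (_%:R); congr nat_of_bool.
  by case: (A); lia.
rewrite (strs_count l.-1 false (fun j => (-1) ^+ j * (j.+1 == a + A)%N%:R * (j + C == b)%N%:R)).
rewrite prednK //.
have [le_Cb|lt_bC] := leqP C b; last first.
  have -> : b = 0%N by case: (C) lt_bC; lia.
  have -> : C = true by case: (C) lt_bC.
  rewrite oppr0 mul0rn big1 ?mulr0 // => j _.
  by rewrite addn1 mulr0 mul0rn.
have [lt_l|ge_l] := ltnP (b - C) l; last first.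
  have -> : C = false by case: (C) ge_l le_Cb; lia.
  have -> : b = l by case: (C) ge_l le_Cb; lia.
  rewrite subnn mul0rn big1 ?mulr0 // => j _.
  by rewrite addn0 (ltn_eqF (ltn_ord j)) mulr0 mul0rn.
rewrite (bigD1 (Ordinal lt_l)) //= big1 ?addr0; last first.
  move=> j /eqP ne; rewrite (_ : (j + C == b)%N = false) ?mulr0 ?mul0rn //.
  by apply/eqP => Eb; apply: ne; apply: val_inj => /=; lia.
rewrite subnK // eqxx mulr1.
have -> : ((b - C).+1 == a + A)%N = (b.+1 == a + A + C)%N by case: (C) le_Cb; lia.
case: eqP => _; last by rewrite !(mulr0, mul0rn, mulr0n).
rewrite mulr1 mulr1n -[X in _ * X]mulr_natr.
have Es : (-1) ^+ b * (-1) ^+ (b - C) = (if C then -1 else 1) :> rat.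
  rewrite -exprD -signr_odd; case: (C) le_Cb => /= le_Cb.
    by rewrite (_ : odd _ = true) //; lia.
  by rewrite (_ : odd _ = false) //; lia.
have Eb : l%:R * 'C(l.-1, b - C)%:R = (if C then b else l - b)%N%:R * 'C(l, b)%:R :> rat.
  rewrite -!natrM; case: (C) le_Cb => /= le_Cb.
    case: (b) le_Cb => // b' _; rewrite subn1 mul_bin_diag //.
  by rewrite subn0 mul_bin_down.
transitivity (((-1) ^+ b * (-1) ^+ (b - C)) * (l%:R * 'C(l.-1, b - C)%:R) / 'C(l, b)%:R : rat).
  move: ((-1) ^+ b) ((-1) ^+ (b - C)) ('C(l, b)%:R^-1) => x y z; ring.
rewrite Es Eb mulrA mulfK //; case: (C); ring.
Qed.

(** The factor [l] is the power of the colour that [omegaT] grants to each leg, and (-1)^b / C(l, b)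
    is the weight of the outgoing arc, absorbed by the vertex which that arc leaves. With this
    normalisation a univalent vertex is exactly the action of sl2. *)
Lemma leg_amplitude_rho l c (a b : 'I_l.+1) : (0 < l)%N ->
  l%:R * ((-1) ^+ b / 'C(l, b)%:R) * leg_amplitude l c a b = rho rat l.+1 c a b.
Proof.
move=> l_gt0; rewrite leg_amplitude_sum mulr_sumr.
under eq_bigr => A _.
  rewrite mulr_sumr; under eq_bigr => C _ do
    rewrite mulrCA (dual_sum A C l_gt0 (ltnSE (ltn_ord a)) (ltnSE (ltn_ord b))).
  over.
rewrite !big_cons !big_nil /sgb /rho mxE /=.
have lea := ltnSE (ltn_ord a); have leb := ltnSE (ltn_ord b).
rewrite -val_eqE /= !addn0 !addn1 !eqSS !addr0.
rewrite (natrB _ leb) (natrB _ (leqW lea)) -muln2.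
move: (nat_of_ord a) (nat_of_ord b) => x y; rewrite /leg_form.
have [Eyx|n1] := eqVneq y x.+1.
  have h1 : (x.+1 == x) = false by lia.
  have h2 : (x.+2 == x) = false by lia.
  have h3 : (x == x.+1) = false by lia.
  have h4 : (x == x.+2) = false by lia.
  by rewrite Eyx ?h1 ?h2 ?h3 ?h4; case: c => [|[|c]] /=; ring.
have [Exy|n2] := eqVneq x y.+1.
  have h1 : (y.+1 == y) = false by lia.
  have h2 : (y == y.+1) = false by lia.
  by rewrite Exy ?eqxx ?h1 ?h2; case: c => [|[|c]] /=; ring.
have [->|_] := eqVneq x y; by case: c => [|[|c]] /=; ring.
Qed.

(** * The sum over the labels of the arcs *)

Definition mprod (K : comNzRingType) d (w : seq nat) : 'M[K]_d :=
  foldr (fun c M => rho K d c *m M) 1%:M w.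

Lemma mprod_cat (K : comNzRingType) d w1 w2 :
  mprod K d (w1 ++ w2) = mprod K d w1 *m mprod K d w2.
Proof. by elim: w1 => [|c w1 IHw] /=; rewrite ?mul1mx // IHw mulmxA. Qed.

Definition path_amplitude l (c : E -> nat) (x : E) (s : seq (E * nat)) : rat :=
  (fix pa x s := if s is (y, a) :: s' then
    l%:R * leg_amplitude l a (c x) (c y) * pa y s' else 1) x s.

Lemma path_sum l (c : E -> nat) x (s : seq (E * nat)) (H : nat -> rat) (a : 'I_l.+1) :
  (0 < l)%N -> uniq (x :: unzip1 s) -> c x = a ->
  (forall y, y \in unzip1 s -> exists i k, y = inr (i, k) /\ lam i = l) ->
  Sum (unzip1 s) c (fun c' => path_amplitude l c' x s * H (c' (last x (unzip1 s))))
  = \sum_(b < l.+1) mprod rat l.+1 (unzip2 s) a b * H b.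
Proof.
move=> l_gt0; elim: s c x a => [|[y k] s IHs] c x a.
  move=> _ Ex _ /=; rewrite (bigD1 a) //= big1 => [|b ne].
    by rewrite !mxE eqxx !mul1r addr0 Ex.
  by rewrite mxE eq_sym (negPf ne) mul0r.
move=> uxys Ex alls; have [i [j [Ey El]]] := alls y (mem_head _ _).
have uys : uniq (y :: unzip1 s) by move: uxys => /= /andP[].
move: uxys; rewrite /= !inE negb_or => /and3P[/andP[nxy nxs] nys us].
have Ely : labels y = l.+1 by rewrite Ey /= El.
rewrite Ely; under eq_bigr => b _.
  rewrite (_ : sumlab _ _ _ _ _ = l%:R * leg_amplitude l k a b *
     \sum_(d < l.+1) mprod rat l.+1 (unzip2 s) b d * H d); last first.
    rewrite -(IHs (upd c y b) y b) //; last 2 first.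
    - by rewrite /upd eqxx.
    - by move=> z zs; apply: alls; rewrite inE zs orbT.
    rewrite -sumlabZ; apply: eq_sumlab => c' Ec'.
    have c'x : c' x = a by rewrite Ec' // /upd (negPf nxy).
    have c'y : c' y = b by rewrite Ec' // /upd eqxx.
    by rewrite /= c'x c'y -mulrA.
  rewrite mulrA (_ : weight _ _ * _ = rho rat l.+1 k a b); last first.
    by rewrite -leg_amplitude_rho // Ey /= El mulrCA mulrA.
  rewrite mulr_sumr; over.
rewrite exchange_big; apply: eq_bigr => d _; rewrite mxE mulr_suml.
by apply: eq_bigr => b _; rewrite mulrA.
Qed.

Definition arcs i m : seq E := [seq inr (i, k) | k <- iota 0 m].

(** The circle is cut at its last arc: for a fixed label there, the other arcs form a path, whose
    sum is an entry of a product of matrices, and summing over that label closes the path into a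
    trace. *)
Lemma circle_sum i (c : E -> nat) : (0 < lam i)%N -> (0 < size (legs D i))%N ->
  (lam i)%:R ^+ size (legs D i) * Sum (arcs i (size (legs D i))) c
     (fun c' => \prod_(v <- circle_vertices D i) amplitude v c')
  = \tr (mprod rat (lam i).+1 (map (c \o inl) (legs D i))).
Proof.
move=> l_gt0; set w := legs D i; case Esz : (size w) => [|m] // _.
pose lab k := c (inl (nth 0%N w k)).
pose prev k : E := inr (i, (k + m) %% m.+1)%N.
have prevS k : (k <= m)%N -> prev k.+1 = inr (i, k).
  by move=> le_km; rewrite /prev addSnnS modnDr modn_small.
have prev0 : prev 0%N = inr (i, m) by rewrite /prev modn_small.
have lastE j r : (j + r <= m.+1)%N ->
    last (prev j) [seq inr (i, k) | k <- iota j r] = prev (j + r)%N.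
  elim: r j => [|r IHr] j le_jr /=; first by rewrite addn0.
  by rewrite -prevS; [rewrite IHr addSnnS | lia].
pose s j r := [seq (inr (i, k) : E, lab k) | k <- iota j r].
have u1 j r : unzip1 (s j r) = [seq inr (i, k) | k <- iota j r].
  by rewrite /unzip1 -map_comp.
have u2 : unzip2 (s 0%N m.+1) = map (c \o inl) w.
  rewrite /unzip2 -map_comp -Esz -[in RHS](mkseq_nth 0%N w) /mkseq -map_comp.
  exact: eq_map.
have pathE c' j r : (j + r <= m.+1)%N -> path_amplitude (lam i) c' (prev j) (s j r)
    = \prod_(k <- iota j r) ((lam i)%:R * leg_amplitude (lam i) (lab k) (c' (prev k)) (c' (inr (i, k)))).
  elim: r j => [|r IHr] j le_jr /=; first by rewrite big_nil.
  by rewrite big_cons -prevS ?IHr //; lia.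
rewrite -sumlabZ.
rewrite (_ : sumlab _ _ _ _ _ = Sum (arcs i m.+1) c (fun c' =>
    path_amplitude (lam i) c' (prev 0%N) (s 0%N m.+1))); last first.
  apply: eq_sumlab => c' Ec'; rewrite pathE // big_split /=; congr (_ * _).
    by rewrite big_const_seq count_predT /= size_iota iter_mulr_1 -exprS.
  rewrite /circle_vertices Esz big_map; apply: eq_big_seq => k.
  rewrite mem_iota add0n /= => lt_k; rewrite /amplitude /leg_amplitude /=.
  have -> : ((lam i + 2 - lam i)./2 = 1)%N by lia.
  have -> : ((lam i + lam i - 2)./2 = (lam i).-1)%N by lia.
  have Ecl e : c' (inl e) = c (inl e) by apply: Ec'; apply/negP => /mapP[].
  by rewrite /lab Ecl.
have perm_arcs : perm_eq (arcs i m.+1) (inr (i, m) :: arcs i m).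
  by rewrite /arcs iota0S map_rcons perm_rcons.
rewrite (sumlab_perm _ _ _ _ perm_arcs) /=.
rewrite /mxtrace; apply: eq_bigr => a _.
pose H b := (lam i)%:R * leg_amplitude (lam i) (lab m) b a.
rewrite (_ : sumlab _ _ _ _ _ = Sum (unzip1 (s 0%N m)) (upd c (inr (i, m)) a)
  (fun c' => path_amplitude (lam i) c' (prev 0%N) (s 0%N m)
     * H (c' (last (prev 0%N) (unzip1 (s 0%N m)))))); last first.
  rewrite u1; apply: eq_sumlab => c' Ec'.
  rewrite -[LHS]/(path_amplitude (lam i) c' (prev 0%N) (s 0%N m.+1)) !pathE //.
  rewrite iota0S -cats1 big_cat big_seq1 lastE //= add0n /H; congr (_ * (_ * leg_amplitude _ _ _ _)).
  rewrite Ec' /upd ?eqxx //; apply/negP => /mapP[k]; rewrite mem_iota => lt_k [Ek].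
  by move: lt_k; rewrite Ek ltnn.
have us : uniq (prev 0%N :: unzip1 (s 0%N m)).
  rewrite u1 prev0 -/(arcs i m) -(perm_uniq perm_arcs) map_inj_uniq ?iota_uniq //.
  by move=> k k' [].
rewrite (@path_sum (lam i) _ _ _ _ a) //; last 2 first.
- by rewrite prev0 /upd eqxx.
- by rewrite u1 => y /mapP[k _ ->]; exists i, k.
rewrite -u2 /s iota0S map_rcons /unzip2 map_rcons -cats1 mprod_cat mxE mulr_sumr.
apply: eq_bigr => b _; rewrite /= mulmx1 -leg_amplitude_rho // /H /=.
by rewrite mulrCA; congr (_ * _); rewrite mulrCA mulrA.
Qed.

Lemma sumlab_agree (E' : eqType) (K : comNzRingType) nl wt es (c c2 : E' -> nat)
    (F : (E' -> nat) -> K) (good : pred E') :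
  (forall c' c'', {in good, c' =1 c''} -> F c' = F c'') -> {in good, c =1 c2} ->
  sumlab nl wt es c F = sumlab nl wt es c2 F.
Proof.
move=> depF; elim: es c c2 => [|e es IHes] c c2 Ecc; first exact: depF.
apply: eq_bigr => a _; congr (_ * _); apply: IHes => x gx.
by rewrite /upd; case: ifP => // _; apply: Ecc.
Qed.

Definition near_circle i (x : E) := if x is inr y then y.1 == i else true.

(** The circles share no arc and each factor reads only its own arcs and the legs, so the sums
    separate. *)
Lemma sumlab_circles (m : 'I_n -> nat) (F : 'I_n -> (E -> nat) -> rat) r c :
  uniq r ->
  (forall i c' c'', {in near_circle i, c' =1 c''} -> F i c' = F i c'') ->
  Sum (flatten [seq arcs i (m i) | i <- r]) c (fun c' => \prod_(i <- r) F i c')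
  = \prod_(i <- r) Sum (arcs i (m i)) c (F i).
Proof.
move=> ur depF; elim: r c ur => [|i r IHr] c /=; first by rewrite !big_nil.
case/andP=> nir ur; rewrite sumlab_cat big_cons.
transitivity (Sum (arcs i (m i)) c (fun c' => (\prod_(j <- r) Sum (arcs j (m j)) c (F j)) * F i c')).
  apply: eq_sumlab => c1 Ec1.
  rewrite (_ : sumlab _ _ _ _ _ = Sum (flatten [seq arcs j (m j) | j <- r]) c1
      (fun c' => F i c1 * \prod_(j <- r) F j c')); last first.
    apply: eq_sumlab => c2 Ec2; rewrite big_cons; congr (_ * _); apply: depF => x nx.
    rewrite Ec2 //; apply/negP => /flattenP[s /mapP[j jr ->] /mapP[k _ Ex]].
    by move: nx; rewrite Ex unfold_in /= => /eqP Eji; rewrite -Eji jr in nir.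
  rewrite sumlabZ IHr // mulrC; congr (_ * _); apply: eq_big_seq => j jr.
  apply: (@sumlab_agree _ _ _ _ _ _ _ _ (near_circle j)); first exact: depF.
  move=> x nx; rewrite Ec1 //; apply/negP => /mapP[k _ Ex].
  by move: nx; rewrite Ex unfold_in /= => /eqP Eij; rewrite Eij jr in nir.
by rewrite sumlabZ mulrC.
Qed.

Definition all_arcs : seq E :=
  flatten [seq arcs i (size (legs D i)) | i <- enum 'I_n].

Lemma row_ends_cat (vs vs' : seq (E * E * E)) :
  row_ends (vs ++ vs') = row_ends vs ++ row_ends vs'.
Proof. by rewrite /row_ends map_cat flatten_cat. Qed.

Lemma perm_row_ends :
  perm_eq (row_ends (sn_vert G)) (map inl (ends D) ++ (all_arcs ++ all_arcs)).
Proof.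
apply/seq.permP => a; rewrite row_ends_cat !count_cat /ends map_cat count_cat.
have -> : count a (row_ends [seq (inl v.1.1, inl v.1.2, inl v.2) | v <- ivert D])
    = count a (map inl (flatten [seq triple_ends v | v <- ivert D])).
  by elim: (ivert D) => //= v vs IHv; rewrite -/(row_ends _) IHv; lia.
rewrite -addnA; congr (_ + _)%N; rewrite /all_arcs.
elim: (enum 'I_n) => //= i r IHr.
rewrite row_ends_cat map_cat !count_cat {}IHr.
have regroup (x y x' y' : nat) : (x + (y + y) + (x' + (y' + y')) = x + x' + ((y + y') + (y + y')))%N.
  by lia.
suff -> : count a (row_ends (circle_vertices D i))
    = (count a [seq inl i0 | i0 <- legs D i] + (count a (arcs i (size (legs D i))) + count a (arcs i (size (legs D i)))))%N.
  exact: regroup.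
rewrite /circle_vertices; set m := size (legs D i).
have count3 (f g h : nat -> E) s :
    count a (row_ends [seq (h k, g k, f k) | k <- s])
    = (count a (map h s) + (count a (map g s) + count a (map f s)))%N.
  by elim: s => //= k s IHs; rewrite -/(row_ends _) IHs; lia.
rewrite count3; congr (_ + _)%N.
  by rewrite -[in RHS](mkseq_nth 0%N (legs D i)) /mkseq -map_comp.
congr (_ + _)%N; case: m => [|m] //.
have -> : [seq (inr (i, (k + m.+1.-1) %% m.+1)%N : E) | k <- iota 0 m.+1]
    = inr (i, m) :: arcs i m.
  rewrite /arcs [iota 0 m.+1]/= map_cons add0n modn_small //; congr (_ :: _).
  rewrite -[1%N]addn0 iotaDl -map_comp; apply/eq_in_map => k.
  by rewrite mem_iota => lt_k /=; rewrite add1n addSnnS modnDr modn_small // ltnW.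
by rewrite /arcs iota0S map_rcons -cats1 count_cat /= addn0 addnC.
Qed.

Lemma uniq_all_arcs : uniq all_arcs.
Proof.
rewrite /all_arcs; elim: (enum 'I_n) (enum_uniq 'I_n) => //= i r IHr /andP[nir ur].
rewrite cat_uniq IHr // andbT map_inj_uniq ?iota_uniq => [|k k' [] //].
apply/hasPn => x /flattenP[s /mapP[j jr ->] /mapP[k _ ->]].
by apply: contra nir => /mapP[k' _ [<- _]].
Qed.

(** Every arc goes out of one vertex and into one, so its two ends carry both marks, as the dual
    bases of [network_pairing] require. *)
Lemma uniq_arc_blocks :
  uniq (flatten [seq arc_block i (size (legs D i)) | i <- enum 'I_n]).
Proof.
pose both (s : seq E) := [seq (x, true) | x <- s] ++ [seq (x, false) | x <- s].
have count_block a i m : count a (arc_block i m) = count a (both (arcs i m)).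
  case: m => // m; rewrite arc_blockE -cat1s /both /arcs iota0S !map_rcons -!cats1 !count_cat.
  have -> : count a (arc_pairs i m) = count a (both (arcs i m)).
    rewrite /arc_pairs /both /arcs; elim: (iota 0 m) => //= k s IHs.
    by rewrite IHs !count_cat /= addnCA; congr (_ + _)%N; rewrite addnCA.
  rewrite /both !count_cat /= !addn0.
  by rewrite addnCA [RHS]addnACA.
have /perm_uniq -> : perm_eq (flatten [seq arc_block i (size (legs D i)) | i <- enum 'I_n]) (both all_arcs).
  apply/seq.permP => a; rewrite /all_arcs; elim: (enum 'I_n) => //= i s IHs.
  by rewrite count_cat IHs count_block /both !map_cat !count_cat addnACA.
rewrite cat_uniq !map_inj_uniq ?uniq_all_arcs; try by move=> x y [].
by rewrite andbT; apply/hasPn => y /mapP[x _ ->]; apply/negP => /mapP[].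
Qed.

Lemma inl_all_arcs e : inl e \notin all_arcs.
Proof. by apply/negP => /flattenP[s /mapP[j _ ->] /mapP[]]. Qed.

Lemma matched_row_ends : is_diagram D -> matched (row_ends (sn_vert G)).
Proof.
move=> /allP dD y; rewrite (perm_mem perm_row_ends).
have /seq.permP -> := perm_row_ends; rewrite mem_cat !count_cat.
case: y => [e|z].
  rewrite mem_cat (negPf (inl_all_arcs e)) !orbF (mem_map (@inl_inj _ _)).
  rewrite (count_memPn (inl_all_arcs e)) !addn0 => /dD /eqP E2.
  transitivity (count_mem e (ends D)); last exact: E2.
  by rewrite count_map; apply: eq_count => e' /=; rewrite (inj_eq (@inl_inj _ _)).
have nz s : inr z \notin map (inl : nat -> E) s by apply/negP => /mapP[].
by rewrite (negPf (nz _)) (count_memPn (nz _)) mem_cat orbb !count_uniq_mem ?uniq_all_arcs //= => H; rewrite H.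
Qed.

Lemma perm_undup_row_ends :
  perm_eq (undup (row_ends (sn_vert G))) (map inl (undup (ends D)) ++ all_arcs).
Proof.
apply: uniq_perm; first exact: undup_uniq.
  rewrite cat_uniq uniq_all_arcs (map_inj_uniq (@inl_inj _ _)) undup_uniq andbT /=.
  by apply/hasPn => x; apply: contraL => /mapP[e _ ->]; exact: inl_all_arcs.
move=> y; rewrite mem_undup (perm_mem perm_row_ends) !mem_cat orbb; congr (_ || _).
by apply/mapP/mapP => -[e ee ->]; exists e; rewrite ?mem_undup // in ee *.
Qed.

(** * The weight of a diagram *)

Definition eps3 (a b c : nat) : int :=
  match a, b, c with
  | 0%N, 1%N, _.+2 | 1%N, _.+2, 0%N | _.+2, 0%N, 1%N => 1
  | 1%N, 0%N, _.+2 | 0%N, _.+2, 1%N | _.+2, 1%N, 0%N => -1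
  | _, _, _ => 0
  end.

(** This 2 and the one that [omegaT] grants to each internal vertex make the constant 4 of
    [network_sum]. *)
Lemma amplitude_eps3 (v : nat * nat * nat) c :
  amplitude (inl v.1.1, inl v.1.2, inl v.2) c
  = 2%:R * (eps3 (c (inl v.1.1)) (c (inl v.1.2)) (c (inl v.2)))%:~R.
Proof.
rewrite /amplitude /= !big_cons !big_nil /cupw !big_cons !big_nil /dual /rev /= /sgb.
move: (c _) (c _) (c _) => x y z; rewrite /leg_form /=.
by case: x => [|[|x]]; case: y => [|[|y]]; case: z => [|[|z]] /=; ring.
Qed.

Definition network_sum : rat :=
  sumlab (fun=> 3%N) (fun=> edge_weight rat) (undup (ends D)) (fun=> 0%N)
    (fun c => \prod_(v <- ivert D) (4%:R * (eps3 (c v.1.1) (c v.1.2) (c v.2))%:~R)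
       * \prod_i \tr (mprod rat (lam i).+1 (map c (legs D i)))).

Lemma ev_loops r f s :
  ev (\prod_(l <- r) loop_tangle l) f s = (\prod_(l <- r) ((-1) ^+ l * l.+1%:R)) * f s.
Proof.
elim: r s => [|l r IHr] s; first by rewrite !big_nil ev1 mul1r.
by rewrite !big_cons evM ev_loop IHr mulrA.
Qed.

Lemma tangle_comb_network : is_diagram D -> all admissible_vertex (sn_vert G) ->
  tangle_comb 0 0 (sn_tangle G).
Proof.
move=> dD adm; have mt := matched_row_ends dD.
have tr := is_tangle_vertex_row 0 adm; rewrite add0n in tr.
have tl : tangle_comb 0 0 (\prod_(l <- sn_loop G) loop_tangle l).
  elim: (sn_loop G) => [|l r IHr]; first by rewrite big_nil; exact: tangle_comb1.
  by rewrite big_cons; exact: tangle_combM (@tangle_comb_loop l) IHr.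
have tc := tangle_comb_close_edges (G := G) (leqnn _) mt.
exact: tangle_combM (tangle_combM tl (tangle_comb_tg tr)) tc.
Qed.

Lemma sn_evalE : is_diagram D -> all admissible_vertex (sn_vert G) ->
  sn_eval G = (\prod_(l <- sn_loop G) ((-1) ^+ l * l.+1%:R))
    * \prod_i (if nilp (legs D i) then 1 else (-1) ^+ lam i)
    * Sum (undup (row_ends (sn_vert G))) (fun=> 0%N)
        (fun c => \prod_(v <- sn_vert G) amplitude v c).
Proof.
move=> dD adm; have mt := matched_row_ends dD.
rewrite /sn_eval -/admissible_vertex adm (skein_valueE (tangle_comb_network dD adm)).
rewrite /sn_tangle evM evM ev_loops -mulrA; congr (_ * _); rewrite ev_tg.
rewrite -(closing_signE (leqnn _) mt) -sumlabZ.
apply: (ev_vertex_row (es := undup (row_ends (sn_vert G))) adm (erefl (size [::]))) => ss wss.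
have um := unzip1_marked_ends (sn_vert G).
have arc_uniq : uniq [seq y <- marked_ends (sn_vert G) | is_arc y.1] by rewrite filter_marked_ends uniq_arc_blocks.
rewrite sumlabZ -um size_map -[_ ++ _]/(flatten ss).
rewrite (ev_close_edges network_pairing (fun=> 0%N)) ?um //.
Qed.

(** With the labels of the uni-trivalent graph fixed, the arcs are summed first: each circle becomes
    a trace, and the remaining sum is [network_sum]. *)
Lemma omegaT_sum_admissible : is_diagram D ->
  (forall i, nilp (legs D i) || (0 < lam i)%N) ->
  omegaT lam D = (\prod_i (-1) ^+ lam i) * network_sum.
Proof.
move=> dD pos.
have adm : all admissible_vertex (sn_vert G).
  rewrite all_cat; apply/andP; split; first by apply/allP => v /mapP[u _ ->].
  apply/allP => v /flattenP[s /mapP[i _ ->] /mapP[k]].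
  rewrite mem_iota /= => lt_k ->.
  have l_gt0 : (0 < lam i)%N.
    by have := pos i; rewrite /nilp; case: eqP => // E; rewrite E in lt_k.
  by rewrite /admissible_vertex /admissible /=; apply/and4P; split; lia.
pose F i c := \prod_(v <- circle_vertices D i) amplitude v c.
pose circle i c := if nilp (legs D i) then 1 else \tr (mprod rat (lam i).+1 (map c (legs D i))).
have depF i c' c'' : {in near_circle i, c' =1 c''} -> F i c' = F i c''.
  move=> Ec; apply: eq_big_seq => v /mapP[k _ ->]; rewrite /amplitude /=.
  by rewrite !Ec // unfold_in /= eqxx.
have circleE i c : (lam i)%:R ^+ size (legs D i)
    * Sum (arcs i (size (legs D i))) c (F i) = circle i (c \o inl).
  have := pos i; rewrite /circle /nilp; case: eqP => [E0 _|ne /= l_gt0].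
    rewrite /F /circle_vertices E0 mul1r /=.
    by rewrite big_nil.
  by rewrite -circle_sum // lt0n; apply/eqP.
have inner c1 : 2%:R ^+ size (ivert D) * (\prod_i (lam i)%:R ^+ size (legs D i))
      * Sum all_arcs c1 (fun c => \prod_(v <- sn_vert G) amplitude v c)
    = \prod_(v <- ivert D) (4%:R * (eps3 (c1 (inl v.1.1)) (c1 (inl v.1.2)) (c1 (inl v.2)))%:~R)
      * \prod_i circle i (c1 \o inl).
  rewrite (_ : sumlab _ _ _ _ _ = Sum all_arcs c1 (fun c =>
      (\prod_(v <- ivert D) (2%:R * (eps3 (c1 (inl v.1.1)) (c1 (inl v.1.2)) (c1 (inl v.2)))%:~R))
      * \prod_(i <- enum 'I_n) F i c)); last first.
    apply: eq_sumlab => c Ec; rewrite big_cat big_map /=; congr (_ * _).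
      by apply: eq_bigr => v _; rewrite amplitude_eps3 !Ec ?inl_all_arcs.
    by rewrite big_flatten big_map.
  rewrite sumlabZ sumlab_circles ?enum_uniq //.
  rewrite mulrACA; congr (_ * _).
    elim: (ivert D) => [|v vs IHv]; first by rewrite !big_nil mulr1.
    by rewrite /= !big_cons exprS -IHv; ring.
  rewrite -[X in X * _]big_enum -big_split -[RHS]big_enum /=.
  by apply: eq_bigr => i _; rewrite circleE.
rewrite /omegaT sn_evalE // mulrCA (sumlab_perm _ _ _ _ perm_undup_row_ends) sumlab_cat.
rewrite -sumlabZ; under eq_sumlab => c1 _ do rewrite inner.
rewrite (sumlab_map (nl := fun=> 3%N) (wt := fun=> edge_weight rat) _ _
  (fun c => \prod_(v <- ivert D) (4%:R * (eps3 (c v.1.1) (c v.1.2) (c v.2))%:~R)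
       * \prod_i circle i c) (@inl_inj _ _)) //.
(* A circle without legs enters as a loop; its value supplies the trace l + 1 of the empty word and
   the sign that the other circles get from closing. *)
pose K := \prod_i (if nilp (legs D i) then (lam i).+1%:R else 1 : rat).
have EK c : \prod_i \tr (mprod rat (lam i).+1 (map c (legs D i))) = K * \prod_i circle i c.
  rewrite -big_split; apply: eq_bigr => i _; rewrite /circle /nilp /=.
  by case: eqP => [/size0nil -> /=|_]; rewrite ?mxtrace1 ?mulr1 ?mul1r.
rewrite /network_sum; under [in RHS]eq_sumlab => c _ do rewrite EK mulrCA.
rewrite sumlabZ mulrA; congr (_ * _); rewrite big_map big_filter big_enum_cond /=.
rewrite /K big_mkcond -!big_split; apply: eq_bigr => i _ /=.
by case: ifP => _; rewrite ?mulr1 ?mul1r.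
Qed.

(** A circle of colour 0 with a leg makes both sides vanish: the left one through a power of 0, the
    right one because sl2 acts by 0 in dimension 1. *)
Lemma omegaT_sum : is_diagram D ->
  omegaT lam D = (\prod_i (-1) ^+ lam i) * network_sum.
Proof.
move=> dD; have [/forallP pos|] := boolP [forall i, nilp (legs D i) || (0 < lam i)%N].
  exact: omegaT_sum_admissible.
rewrite negb_forall => /existsP[i]; rewrite negb_or -eqn0Ngt => /andP[ne /eqP Ei].
have ne0 : (0 < size (legs D i))%N by rewrite lt0n.
rewrite /omegaT (bigD1 i) //= Ei expr0n gtn_eqF // !(mul0r, mulr0).
rewrite /network_sum -[LHS](mulr0 (\prod_i0 (-1) ^+ lam i0)); congr (_ * _).
rewrite -[LHS](mul0r (sumlab (fun=> 3%N) (fun=> edge_weight rat) (undup (ends D)) (fun=> 0%N) (fun=> 0))).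
rewrite -sumlabZ; apply: eq_sumlab => c _; rewrite mul0r (bigD1 i) //= Ei.
have -> : mprod rat 1 (map c (legs D i)) = 0.
  case: (legs D i) ne0 => //= a w _.
  by rewrite rho1 mul0mx.
by rewrite linear0 mul0r mulr0.
Qed.

End Network.

(** * Polynomials in two variables *)

Section Weyl.
Variable K : comNzRingType.

(* Multiplication by and derivation with respect to the two variables, between
   the spaces of homogeneous polynomials of dimensions d and d.+1, in divided
   powers; these matrices act on row vectors. *)
Definition mulX (b : bool) d : 'M[K]_(d, d.+1) :=
  \matrix_(i, j) ((if b then i.+1 else d - i)%N%:R *+ (j == i + b :> nat)%N).
Definition derX (b : bool) d : 'M[K]_(d.+1, d) :=
  \matrix_(i, j) ((i == j + b :> nat)%N%:R).

Lemma mulX_derX b b' d (i j : 'I_d) : (mulX b d *m derX b' d) i j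
  = (if b then i.+1 else d - i)%N%:R *+ (i + b == j + b')%N.
Proof.
rewrite mxE; have lt_i : (i + b < d.+1)%N by have := ltn_ord i; case: (b); lia.
rewrite (bigD1 (Ordinal lt_i)) //= big1 ?addr0 => [|k ne].
  by rewrite !mxE /= eqxx mulr1n mulr_natr.
rewrite !mxE (_ : (k == i + b :> nat)%N = false) ?mul0r //.
by apply: contraNF ne => /eqP Ek; apply/eqP/val_inj.
Qed.

Lemma derX_mulX b b' d (i j : 'I_d.+1) : (derX b' d *m mulX b d) i j
  = (if b then i.+1 - b' else d + b' - i)%N%:R *+ (j + b' == i + b)%N.
Proof.
rewrite mxE; have [/andP[le_bi lt_d]|out] := boolP ((b' <= i) && (i - b' < d))%N.
  rewrite (bigD1 (Ordinal lt_d)) //= big1 ?addr0 => [|k ne].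
    rewrite !mxE /= subnK // eqxx mul1r; congr (_ *+ _).
      by congr (_%:R); case: (b); lia.
    by congr nat_of_bool; lia.
  rewrite !mxE (_ : (i == k + b' :> nat)%N = false) ?mul0r //.
  by apply: contraNF ne => /eqP Ek; apply/eqP/val_inj; rewrite /= Ek addnK.
rewrite big1 => [|k _]; last first.
  rewrite !mxE (_ : (i == k + b' :> nat)%N = false) ?mul0r //.
  apply: contraNF out => /eqP ->; rewrite leq_addl addnK; exact: ltn_ord.
case: eqP => [Ej|_]; last by rewrite mulr0n.
have := ltn_ord i; have := ltn_ord j; rewrite mulr1n => lt_j lt_i.
rewrite (_ : (if b then _ else _) = 0%N) //.
by move: out Ej; case: (b); case: (b') => /=; lia.
Qed.

(** The canonical commutation relation; on row vectors the left factor is applied first. *)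
Lemma weyl b b' d :
  mulX b d.+1 *m derX b' d.+1 = derX b' d *m mulX b d + (b == b')%:R%:M.
Proof.
apply/matrixP => i j; rewrite [RHS]mxE mulX_derX derX_mulX mxE -val_eqE /=.
have lt_i := ltn_ord i; have lt_j := ltn_ord j.
move: (nat_of_ord i) (nat_of_ord j) lt_i lt_j => x y lt_x lt_y.
case: b; case: b'; rewrite /= ?addn0 ?addn1 ?eqSS ?subn0 ?subn1 /=.
- by rewrite eq_sym; case: eqP => _; rewrite ?mulr1n ?mulr0n ?addr0 // -natr1.
- by rewrite mul0rn addr0 eq_sym.
- by rewrite mul0rn addr0 eq_sym.
- rewrite eq_sym; case: eqP => _; rewrite ?mulr1n ?mulr0n ?addr0 //.
  by rewrite natr1; congr (_%:R); lia.
Qed.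

Lemma mulXC b b' d : mulX b d *m mulX b' d.+1 = mulX b' d *m mulX b d.+1.
Proof.
have E c c' i j : (mulX c d *m mulX c' d.+1) i j
    = ((if c then i.+1 else d - i) * (if c' then (i + c).+1 else d.+1 - (i + c)))%N%:R
      *+ (j == i + c + c' :> nat)%N.
  rewrite mxE; have lt_i : (i + c < d.+1)%N by have := ltn_ord i; case: (c); lia.
  rewrite (bigD1 (Ordinal lt_i)) //= big1 ?addr0 => [|k ne].
    by rewrite !mxE /= eqxx mulr1n natrM mulrnAr.
  rewrite !mxE (_ : (k == i + c :> nat)%N = false) ?mul0r //.
  by apply: contraNF ne => /eqP Ek; apply/eqP/val_inj.
apply/matrixP => i j; rewrite !E addnAC; congr (_%:R *+ _).
by have := ltn_ord i; case: (b); case: (b'); lia.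
Qed.

Lemma derXC b b' d : derX b d.+1 *m derX b' d = derX b' d.+1 *m derX b d.
Proof.
have E c c' i j : (derX c d.+1 *m derX c' d) i j = (i == j + c' + c :> nat)%N%:R.
  rewrite mxE; have lt_j : (j + c' < d.+1)%N by have := ltn_ord j; case: (c'); lia.
  rewrite (bigD1 (Ordinal lt_j)) //= big1 ?addr0 => [|k ne].
    by rewrite !mxE /= eqxx mulr1.
  rewrite !mxE (_ : (k == j + c' :> nat)%N = false) ?mulr0 //.
  by apply: contraNF ne => /eqP Ek; apply/eqP/val_inj.
by apply/matrixP => i j; rewrite !E addnAC.
Qed.

Lemma euler d : derX false d *m mulX false d + derX true d *m mulX true d = d%:R%:M.
Proof.
apply/matrixP => i j; rewrite mxE !derX_mulX mxE -val_eqE /=.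
rewrite !addn0 !addn1 eqSS eq_sym subn1 /=; case: eqP => _; rewrite ?mulr1n ?mulr0n ?addr0 //.
by rewrite -natrD; congr (_%:R); have := ltn_ord i; lia.
Qed.

(* Entries of rho K 2 c. *)
Definition gl_coef (c : nat) (b b' : bool) : int :=
  match c with
  | 0%N => b%:Z - b'%:Z
  | 1%N => - (b (+) b')%:Z
  | _ => if b == b' then (-1) ^+ (~~ b) else 0
  end.

Lemma rhoS d c : rho K d.+1 c
  = \sum_b \sum_b' (gl_coef c b b')%:~R *: (derX b d *m mulX b' d).
Proof.
apply/matrixP => i j; have E b b' := derX_mulX b' b i j.
rewrite !big_bool /=; move: (derX true d *m mulX true d) (E true true)
  (derX true d *m mulX false d) (E true false)
  (derX false d *m mulX true d) (E false true)
  (derX false d *m mulX false d) (E false false) => A EA B EB C EC F EF.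
rewrite !mxE {}EA {}EB {}EC {}EF /= !addn0 !addn1 !eqSS !subn0 subn1 /=.
have lt_i := ltn_ord i; have lt_j := ltn_ord j; rewrite -val_eqE /=.
move: (nat_of_ord i) (nat_of_ord j) lt_i lt_j => x y lt_x lt_y.
rewrite (eq_sym x y) (eq_sym y.+1 x).
have -> : (x.*2.+1%:R - d.+1%:R : K) = x%:R - (d - x)%:R.
  by rewrite natrB // -addnn -!natr1 natrD; ring.
case: c => [|[|c]] /=; rewrite ?expr0 ?expr1 ?(mulr0z, mulrN1z, mulr1z, scale0r, subrr, subr0, sub0r) ?rmorphN ?rmorph1 /=; ring.
Qed.

Lemma rho0 c : rho K 0 c = 0.
Proof. by apply/matrixP => -[]. Qed.

(** Commuting a linear vector field with a variable leaves the image of that variable, so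
    multiplication is an equivariant map on the tensor product with the plane. *)
Lemma mulX_rho b d c : mulX b d *m rho K d.+1 c
  = rho K d c *m mulX b d + \sum_b' (gl_coef c b b')%:~R *: mulX b' d.
Proof.
case: d => [|d]; first by apply/matrixP => -[].
rewrite rhoS mulmx_sumr; under eq_bigr => b1 _.
  rewrite mulmx_sumr; under eq_bigr => b2 _.
    rewrite -scalemxAr mulmxA weyl mulmxDl mul_scalar_mx -mulmxA mulXC scalerDr mulmxA.
    over.
  rewrite big_split /=; over.
rewrite big_split /= rhoS mulmx_suml; congr (_ + _).
  apply: eq_bigr => b1 _; rewrite mulmx_suml; apply: eq_bigr => b2 _.
  by rewrite scalemxAl.
rewrite (bigD1 b) //= [X in _ + X]big1 ?addr0 => [|b1 ne].
  by apply: eq_bigr => b2 _; rewrite eqxx scale1r.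
by rewrite big1 // => b2 _; rewrite eq_sym (negPf ne) scale0r scaler0.
Qed.

Lemma rho_derX b d c : rho K d.+1 c *m derX b d
  = derX b d *m rho K d c + \sum_b' (gl_coef c b' b)%:~R *: derX b' d.
Proof.
case: d => [|d]; first by apply/matrixP => i -[].
rewrite [rho K d.+2 c]rhoS mulmx_suml; under eq_bigr => b1 _.
  rewrite mulmx_suml; under eq_bigr => b2 _.
    rewrite -scalemxAl -mulmxA weyl mulmxDr mul_mx_scalar mulmxA derXC scalerDr -mulmxA.
    over.
  rewrite big_split /=; over.
rewrite big_split /= rhoS mulmx_sumr; congr (_ + _).
  apply: eq_bigr => b1 _; rewrite mulmx_sumr; apply: eq_bigr => b2 _.
  by rewrite -scalemxAr.
apply: eq_bigr => b1 _; rewrite (bigD1 b) //= big1 ?addr0 => [|b2 ne].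
  by rewrite eqxx scale1r.
by rewrite (negPf ne) scale0r scaler0.
Qed.

(** The structure constants of sl2 in the basis of [rho]. The factors 2 and - 2 are four times
    [edge_weight]: contracting a vertex, of weight 4 [eps3], along an edge yields the bracket. *)
Definition st_coef (x y b : nat) : int := (if b is 0%N then 2 else - 2) * eps3 b x y.

Lemma gl_coef_bracket x y b b' :
  \sum_a (gl_coef x b a * gl_coef y a b' - gl_coef y b a * gl_coef x a b')
  = \sum_(k < 3) st_coef x y k * gl_coef k b b'.
Proof.
rewrite big_bool !big_ord_recl big_ord0 /= /st_coef /bump /=.
by case: x => [|[|x]]; case: y => [|[|y]]; case: b; case: b'.
Qed.

(* A matrix with coefficients in K acts on polynomials by derivations. *)
Definition gl_act (U : bool -> bool -> K) d : 'M[K]_d :=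
  if d is d'.+1 then \sum_b \sum_b' U b b' *: (derX b d' *m mulX b' d') else 0.

Lemma rhoE d c : rho K d c = gl_act (fun b b' => (gl_coef c b b')%:~R) d.
Proof. by case: d => [|d]; [exact: rho0 | exact: rhoS]. Qed.

Definition gl_mul (U V : bool -> bool -> K) b b' := \sum_a U b a * V a b'.

(** Normal ordering: a product of two vector fields is the action of the product matrix plus a
    second-order part [S], which is symmetric because multiplications commute and derivations
    commute. Commutators therefore lose [S]. *)
Lemma gl_act_mul U V d : exists2 S : (bool -> bool -> K) -> (bool -> bool -> K) -> 'M[K]_d,
  S U V = S V U & forall U' V', gl_act U' d *m gl_act V' d = gl_act (gl_mul U' V') d + S U' V'.
Proof.
case: d => [|[|d]].
- by exists (fun _ _ => 0) => // U' V'; rewrite mul0mx add0r.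
- have act1 W : gl_act W 1 = 0.
    rewrite /gl_act big1 // => b _; rewrite big1 // => b' _.
    by rewrite (flatmx0 (mulX _ 0)) mulmx0 scaler0.
  by exists (fun _ _ => 0) => // U' V'; rewrite !act1 mul0mx add0r.
exists (fun U V => \sum_b \sum_b' \sum_a \sum_a' (U b b' * V a a') *:
    (derX b d.+1 *m derX a d *m (mulX b' d *m mulX a' d.+1))).
  transitivity (\sum_a \sum_a' \sum_b \sum_b' (U b b' * V a a') *:
    (derX b d.+1 *m derX a d *m (mulX b' d *m mulX a' d.+1))).
    rewrite pair_bigA [RHS]pair_bigA /=.
    under eq_bigr do rewrite pair_bigA; under [RHS]eq_bigr do rewrite pair_bigA.
    by rewrite exchange_big.
  apply: eq_bigr => b _; apply: eq_bigr => b' _; apply: eq_bigr => a _.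
  by apply: eq_bigr => a' _; rewrite mulrC derXC mulXC.
move=> U' V'; rewrite /gl_act.
have -> : \sum_b \sum_b' gl_mul U' V' b b' *: (derX b d.+1 *m mulX b' d.+1)
    = \sum_b \sum_b' \sum_a \sum_a' (U' b b' * V' a a') *: ((b' == a)%:R *: (derX b d.+1 *m mulX a' d.+1)).
  apply: eq_bigr => b _; under [RHS]eq_bigr do rewrite exchange_big /=.
  rewrite [RHS]exchange_big /=; apply: eq_bigr => c _.
  rewrite /gl_mul scaler_suml; apply: eq_bigr => a _.
  rewrite (bigD1 a) //= big1 ?addr0 => [|a' ne]; first by rewrite eqxx scale1r.
  by rewrite eq_sym (negPf ne) scale0r scaler0.
rewrite -big_split mulmx_suml; apply: eq_bigr => b _.
rewrite -big_split mulmx_suml; apply: eq_bigr => b' _.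
rewrite -big_split mulmx_sumr; apply: eq_bigr => a _.
rewrite -big_split mulmx_sumr; apply: eq_bigr => a' _ /=.
rewrite -scalemxAl -scalemxAr [LHS]scalerA -scalerDr; congr (_ *: _).
rewrite -[LHS]mulmxA (mulmxA (mulX _ _)) weyl mulmxDl mulmxDr mul_scalar_mx -scalemxAr.
by rewrite addrC -!mulmxA.
Qed.

Lemma gl_actB U V d : gl_act U d - gl_act V d = gl_act (fun b b' => U b b' - V b b') d.
Proof.
case: d => [|d]; first by rewrite /= subr0.
rewrite /gl_act -sumrB; apply: eq_bigr => b _; rewrite -sumrB; apply: eq_bigr => b' _.
by rewrite scalerBl.
Qed.

Lemma gl_act_bracket U V d :
  gl_act U d *m gl_act V d - gl_act V d *m gl_act U d
  = gl_act (fun b b' => gl_mul U V b b' - gl_mul V U b b') d.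
Proof.
have [S SC E] := gl_act_mul U V d.
by rewrite !E SC opprD addrACA subrr addr0 gl_actB.
Qed.

Lemma eq_gl_act U V d : (forall b b', U b b' = V b b') -> gl_act U d = gl_act V d.
Proof.
move=> E; case: d => // d; rewrite /gl_act; apply: eq_bigr => b _.
by apply: eq_bigr => b' _; rewrite E.
Qed.

Lemma rho_bracket d x y :
  rho K d x *m rho K d y - rho K d y *m rho K d x
  = \sum_(k < 3) (st_coef x y k)%:~R *: rho K d k.
Proof.
rewrite !rhoE gl_act_bracket.
transitivity (gl_act (fun b b' => \sum_(k < 3) (st_coef x y k)%:~R * (gl_coef k b b')%:~R) d).
  apply: eq_gl_act => b b'; rewrite /gl_mul -sumrB.
  under eq_bigr do rewrite -!rmorphM -rmorphB.
  under [RHS]eq_bigr do rewrite -rmorphM.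
  by rewrite -!rmorph_sum gl_coef_bracket.
under [RHS]eq_bigr do rewrite rhoE.
case: d => [|d]; first by rewrite big1 // => k _; rewrite scaler0.
rewrite /gl_act; under [RHS]eq_bigr do rewrite scaler_sumr.
rewrite [RHS]exchange_big; apply: eq_bigr => b _.
under [RHS]eq_bigr do rewrite scaler_sumr.
rewrite [RHS]exchange_big; apply: eq_bigr => b' _ /=.
by rewrite scaler_suml; apply: eq_bigr => k _; rewrite scalerA.
Qed.

Lemma gl_act1 d : gl_act (fun b b' => (b == b')%:R) d = d.-1%:R%:M.
Proof.
case: d => [|d]; first by apply/matrixP => -[].
by rewrite /gl_act !big_bool /= !scale0r !scale1r addr0 add0r addrC euler.
Qed.

(** * Tensoring with the two-dimensional representation *)

Fixpoint mprod2 (w : seq nat) (b b' : bool) : K :=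
  if w is c :: w' then \sum_a (gl_coef c b a)%:~R * mprod2 w' a b'
  else (b == b')%:R.

(** The action of a word on the tensor product with the plane, as blocks indexed by the labels of
    the plane. *)
Fixpoint tprod d (w : seq nat) (b b' : bool) : 'M[K]_d :=
  if w is c :: w' then
    rho K d c *m tprod d w' b b'
    + \sum_a (gl_coef c b a)%:~R *: tprod d w' a b'
  else (b == b')%:R%:M.

Lemma tprod_mulX d w b :
  \sum_a tprod d w b a *m mulX a d = mulX b d *m mprod K d.+1 w.
Proof.
elim: w b => [|c w IHw] b /=.
  rewrite mulmx1 (bigD1 b) //= big1 ?addr0 => [|a ne].
    by rewrite eqxx mul_scalar_mx scale1r.
  by rewrite eq_sym (negPf ne) mul_scalar_mx scale0r.
under eq_bigr do rewrite mulmxDl mulmx_suml -mulmxA.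
rewrite big_split /= -mulmx_sumr IHw exchange_big [RHS]mulmxA mulX_rho mulmxDl -mulmxA.
congr (_ + _); rewrite mulmx_suml; apply: eq_bigr => a _.
by rewrite -scalemxAl -IHw scaler_sumr; apply: eq_bigr => a' _; rewrite scalemxAl.
Qed.

Definition sgK (b : bool) : K := if b then 1 else -1.

Lemma gl_coef_adj c b b' :
  - (sgK b * (gl_coef c (~~ b') (~~ b))%:~R) = sgK b' * (gl_coef c b b')%:~R :> K.
Proof. by case: c => [|[|c]]; case: b; case: b'; rewrite /sgK /=; ring. Qed.

(** The derivations map the tensor product to its smaller summand; [~~] and the signs [sgK] are the
    symplectic identification of the plane with its dual. *)
Lemma tprod_derX d w b :
  \sum_a sgK a *: (tprod d.+1 w b a *m derX (~~ a) d)
  = sgK b *: (derX (~~ b) d *m mprod K d w).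
Proof.
elim: w b => [|c w IHw] b /=.
  rewrite mulmx1 (bigD1 b) //= big1 ?addr0 => [|a ne].
    by rewrite eqxx mul_scalar_mx scale1r.
  by rewrite eq_sym (negPf ne) mul_scalar_mx scale0r scaler0.
have Er : derX (~~ b) d *m rho K d c = rho K d.+1 c *m derX (~~ b) d
    - \sum_a (gl_coef c (~~ a) (~~ b))%:~R *: derX (~~ a) d.
  rewrite rho_derX (reindex_inj negb_inj) /=.
  by apply/esym/(canLR (addrK _)); congr (_ + _); apply: eq_bigr => a _; rewrite negbK.
rewrite [RHS](_ : _ = rho K d.+1 c *m (sgK b *: (derX (~~ b) d *m mprod K d w))
  + \sum_a (gl_coef c b a)%:~R *: (sgK a *: (derX (~~ a) d *m mprod K d w))); last first.
  rewrite mulmxA Er mulmxBl scalerBr -scalemxAr mulmxA; congr (_ + _).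
  rewrite mulmx_suml -scalerN -sumrN scaler_sumr; apply: eq_bigr => a _.
  by rewrite -scalemxAl -scaleNr !scalerA mulrN gl_coef_adj mulrC.
rewrite -IHw; under eq_bigr do rewrite mulmxDl scalerDr -mulmxA scalemxAr.
rewrite big_split /= -mulmx_sumr; congr (_ + _).
under [RHS]eq_bigr do rewrite -IHw scaler_sumr.
rewrite exchange_big; apply: eq_bigr => a _; rewrite mulmx_suml scaler_sumr.
by apply: eq_bigr => a' _; rewrite -scalemxAl !scalerA mulrC.
Qed.

(* The Clebsch-Gordan decomposition of the tensor product of the representations
   of dimensions d.+1 and 2, whose summands have dimensions d.+2 and d. *)
Lemma tprodE d w b b' : d.+1%:R *: tprod d.+1 w b b'
  = mulX b d.+1 *m mprod K d.+2 w *m derX b' d.+1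
    + (sgK b * sgK b') *: (derX (~~ b) d *m mprod K d w *m mulX (~~ b') d).
Proof.
rewrite -tprod_mulX mulmx_suml mulrC -scalerA scalemxAl -tprod_derX mulmx_suml.
rewrite scaler_sumr -big_split /=.
(* On the diagonal the Weyl relation and Euler's identity add up to d + 1; off the diagonal the two
   contributions cancel. *)
rewrite (bigD1 b') //= big1 ?addr0 => [|a ne].
  rewrite -scalemxAl scalerA -!mulmxA weyl eqxx.
  have -> : sgK b' * sgK b' = 1 by case: (b'); rewrite /sgK ?mulrNN mulr1.
  rewrite scale1r mulmxDr addrAC -mulmxDr.
  have -> : derX b' d *m mulX b' d + derX (~~ b') d *m mulX (~~ b') d = d%:R%:M.
    by rewrite -euler; case: (b'); rewrite //= addrC.
  by rewrite mulmx1 mul_mx_scalar -natr1 scalerDl scale1r.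
rewrite -scalemxAl scalerA -!mulmxA weyl (negPf ne).
have -> : a = ~~ b' by case: (a) (b') ne => [] [].
have -> : sgK b' * sgK (~~ b') = -1 by case: (b'); rewrite /sgK ?mulr1 ?mul1r.
by rewrite negbK scaleN1r raddf0 addr0 subrr.
Qed.

(** The function of the dimension along which the sum in [slides_chi2] telescopes. *)
Definition tau D w u : K :=
  \tr (mprod K D w *m gl_act (fun b b' => mprod2 u b b') D).

(** Cyclicity of the trace brings together the multiplication and the derivation around the word in
    [tprodE]. In dimension d + 2 they come in the order of a vector field, which is [tau]; in
    dimension d they come in the opposite order, and the Weyl relation produces minus [tau] and the
    last term. *)
Lemma tprod_trace d w u :
  d.+1%:R * (\sum_b \sum_b' mprod2 u b' b * \tr (tprod d.+1 w b b'))
  = tau d.+2 w u - tau d w u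
    + d%:R * (\sum_b mprod2 u b b) * \tr (mprod K d w).
Proof.
have tauE D (V : bool -> bool -> K) (M : 'M[K]_D.+1) : \tr (M *m gl_act V D.+1)
    = \sum_b \sum_b' V b b' * \tr (M *m (derX b D *m mulX b' D)).
  rewrite /gl_act mulmx_sumr raddf_sum; apply: eq_bigr => b _.
  rewrite mulmx_sumr raddf_sum; apply: eq_bigr => b' _.
  by rewrite -scalemxAr /= mxtraceZ.
have -> : d.+1%:R * (\sum_b \sum_b' mprod2 u b' b * \tr (tprod d.+1 w b b'))
   = \sum_b \sum_b' mprod2 u b b' * \tr (mprod K d.+2 w *m (derX b d.+1 *m mulX b' d.+1))
     + \sum_b \sum_b' mprod2 u b b' * ((sgK b' * sgK b) * \tr (mprod K d w *m (mulX (~~ b) d *m derX (~~ b') d))).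
  rewrite [X in _ * X]exchange_big mulr_sumr -big_split; apply: eq_bigr => b _.
  rewrite mulr_sumr -big_split; apply: eq_bigr => b' _ /=.
  rewrite [LHS]mulrCA -[d.+1%:R * \tr _]mxtraceZ tprodE raddfD /= mxtraceZ mulrDr; congr (_ * _ + _ * (_ * _)).
    by rewrite -mulmxA mxtrace_mulC mulmxA.
  by rewrite -mulmxA mxtrace_mulC mulmxA.
rewrite [tau d.+2 w u]tauE -addrA; congr (_ + _).
case: d => [|d].
  rewrite big1 => [|b _]; last first.
    by rewrite big1 // => b' _; rewrite [\tr _]big_ord0 !mulr0.
  by rewrite /tau [\tr _]big_ord0 !mul0r oppr0 add0r.
have termE b b' : sgK b' * sgK b * \tr (mprod K d.+1 w *m (mulX (~~ b) d.+1 *m derX (~~ b') d.+1))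
    = - \tr (mprod K d.+1 w *m (derX b d *m mulX b' d))
      + (b == b')%:R * (d.+1%:R * \tr (mprod K d.+1 w)).
  rewrite weyl; have [<-|ne] := eqVneq b b'.
    have -> : sgK b * sgK b = 1 by case: (b); rewrite /sgK ?mulrNN mulr1.
    rewrite !mul1r eqxx [RHS]addrC; apply/eqP; rewrite -subr_eq opprK -raddfD -mulmxDr addrAC.
    have -> : derX (~~ b) d *m mulX (~~ b) d + derX b d *m mulX b d = d%:R%:M.
      by rewrite -euler; case: (b); rewrite //= addrC.
    by rewrite -raddfD natr1 mul_mx_scalar /= mxtraceZ.
  have -> : b' = ~~ b by case: (b) (b') ne => [] [].
  have -> : sgK (~~ b) * sgK b = -1 by case: (b); rewrite /sgK ?mulr1 ?mul1r.
  by rewrite negbK (_ : (~~ b == b) = false) ?raddf0 ?addr0 ?mul0r ?addr0 ?mulN1r //; case: (b).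
under eq_bigr => b _.
  under eq_bigr do rewrite termE mulrDr mulrN.
  rewrite big_split sumrN; over.
rewrite big_split sumrN /tau tauE; congr (_ + _).
rewrite [d.+1%:R * \sum_b mprod2 u b b]mulr_sumr [RHS]mulr_suml; apply: eq_bigr => b _.
rewrite (bigD1 b) //= big1 ?addr0 => [|b' ne].
  by rewrite eqxx mul1r mulrCA mulrA.
by rewrite eq_sym (negPf ne) mul0r mulr0.
Qed.

End Weyl.

(** * Functionals on words *)

(** The unshuffle coproduct, which governs both tensor products of representations and the
    distribution of legs in a handle slide. *)
Fixpoint splits (w : seq nat) : seq (seq nat * seq nat) :=
  if w is x :: w' then
    [seq (x :: s.1, s.2) | s <- splits w'] ++ [seq (s.1, x :: s.2) | s <- splits w']
  else [:: ([::], [::])].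

Lemma big_splits0 (V : nmodType) (F : seq nat * seq nat -> V) :
  \sum_(s <- splits [::]) F s = F ([::], [::]).
Proof. by rewrite big_seq1. Qed.

Lemma big_splitsS (V : nmodType) x w (F : seq nat * seq nat -> V) :
  \sum_(s <- splits (x :: w)) F s
  = \sum_(s <- splits w) (F (x :: s.1, s.2) + F (s.1, x :: s.2)).
Proof. by rewrite big_cat !big_map [RHS]big_split. Qed.

Lemma big_splits_cat (V : nmodType) u w (F : seq nat * seq nat -> V) :
  \sum_(s <- splits (u ++ w)) F s
  = \sum_(s <- splits u) \sum_(t <- splits w) F (s.1 ++ t.1, s.2 ++ t.2).
Proof.
elim: u F => [|x u IHu] F /=.
  by rewrite big_splits0; apply: eq_bigr => -[].
rewrite !big_splitsS IHu; apply: eq_bigr => s _.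
by rewrite -big_split.
Qed.

Lemma big_splitsA (V : nmodType) w (F : seq nat -> seq nat -> seq nat -> V) :
  \sum_(s <- splits w) \sum_(t <- splits s.2) F s.1 t.1 t.2
  = \sum_(s <- splits w) \sum_(t <- splits s.1) F t.1 t.2 s.2.
Proof.
elim: w F => [|x w IHw] F; first by rewrite !big_splits0.
rewrite !big_splitsS /=.
under eq_bigr do rewrite big_splitsS /= big_split addrA -big_split /=.
under [RHS]eq_bigr do rewrite big_splitsS /= big_split -addrA -big_split /=.
rewrite big_split [RHS]big_split /=.
have E1 := IHw (fun a b c => F (x :: a) b c).
have E2 := IHw (fun a b c => F a (x :: b) c).
have E3 := IHw (fun a b c => F a b (x :: c)).
under eq_bigr do rewrite big_split.
under [X in _ = _ + X]eq_bigr do rewrite big_split.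
by rewrite !big_split /= E1 E2 E3 addrA.
Qed.

Lemma strs_mask_splits (V : nmodType) w (F : seq nat -> seq nat -> V) :
  \sum_(t <- strs (size w)) F (mask (map negb t) w) (mask t w)
  = \sum_(s <- splits w) F s.1 s.2.
Proof.
elim: w F => [|x w IHw] F; first by rewrite big_splits0 big_strs0.
rewrite big_splitsS big_strsS /= addrC big_split /=.
by rewrite (IHw (fun a b => F (x :: a) b)) (IHw (fun a b => F a (x :: b))).
Qed.

Lemma mem_strs n t : size t = n -> t \in strs n.
Proof.
elim: n t => [|k IHk] [|b s] //= [/IHk sk].
by rewrite mem_cat; case: b; apply/orP; [left|right]; apply: map_f.
Qed.

Lemma tuple_mask_splits (V : nmodType) n w (F : seq nat -> seq nat -> V) : size w = n ->
  \sum_(m : n.-tuple bool) F (mask (map negb m) w) (mask m w)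
  = \sum_(s <- splits w) F s.1 s.2.
Proof.
move=> szw; rewrite -strs_mask_splits szw.
rewrite -(big_map val xpredT (fun t => F (mask (map negb t) w) (mask t w))).
apply: perm_big; apply: uniq_perm.
- by rewrite map_inj_uniq ?index_enum_uniq //; exact: val_inj.
- elim: (n) => //= k IHk; rewrite cat_uniq !map_inj_uniq ?IHk; try by move=> s t [].
  by rewrite andbT; apply/hasPn => t /mapP[s _ ->]; apply/negP => /mapP[].
move=> t; apply/mapP/idP => [[m _ ->]|tn].
  exact/mem_strs/size_tuple.
by exists (tcast (size_strs tn) (in_tuple t)); rewrite ?mem_index_enum //= val_tcast.
Qed.

Section Functionals.
Variable K : comNzRingType.

(** The letter [a] is bracketed into each position in turn. Values in an arbitrary group allow
    matrix-valued functions such as [mprod]. *)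
Fixpoint ad (V : zmodType) a (f : seq nat -> V) (w : seq nat) : V :=
  if w is x :: w' then
    \sum_(b < 3) f (nat_of_ord b :: w') *~ st_coef a x b + ad a (fun v => f (x :: v)) w'
  else 0.

Lemma ad_additive (V W : zmodType) (g : {additive V -> W}) a f w :
  ad a (fun v => g (f v)) w = g (ad a f w).
Proof.
elim: w f => [|x w IHw] f /=; first by rewrite raddf0.
rewrite raddfD (IHw (fun v => f (x :: v))) raddf_sum; congr (_ + _).
by apply: eq_bigr => b _; rewrite raddfMz.
Qed.

Lemma ad_sum (V : zmodType) (I : Type) (r : seq I) (P : pred I) a (f : I -> seq nat -> V) w :
  ad a (fun v => \sum_(i <- r | P i) f i v) w = \sum_(i <- r | P i) ad a (f i) w.
Proof.
elim: w f => [|x w IHw] f /=; first by rewrite big1.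
rewrite (IHw (fun i v => f i (x :: v))) [RHS]big_split exchange_big; congr (_ + _).
by apply: eq_bigr => b _; rewrite mulrz_suml.
Qed.

Lemma adZ a (k : K) f w : ad a (fun v => k * f v) w = k * ad a f w.
Proof.
elim: w f => [|x w IHw] f /=; first by rewrite mulr0.
rewrite mulrDr (IHw (fun v => f (x :: v))) mulr_sumr; congr (_ + _).
by apply: eq_bigr => b _; rewrite mulrzAr.
Qed.

Lemma adZr a (k : K) f w : ad a (fun v => f v * k) w = ad a f w * k.
Proof.
rewrite mulrC -adZ; congr ad; apply: functional_extensionality => v; exact: mulrC.
Qed.

Lemma adD (V : zmodType) a (f g : seq nat -> V) w :
  ad a (fun v => f v + g v) w = ad a f w + ad a g w.
Proof.
elim: w f g => [|x w IHw] f g /=; first by rewrite addr0.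
rewrite (IHw (fun v => f (x :: v)) (fun v => g (x :: v))) addrACA -big_split; congr (_ + _).
by apply: eq_bigr => b _; rewrite mulrzDl.
Qed.

Lemma ad_cat (V : zmodType) a (f : seq nat -> V) u w :
  ad a f (u ++ w) = ad a (fun v => f (v ++ w)) u + ad a (fun v => f (u ++ v)) w.
Proof.
elim: u f => [|x u IHu] f /=; first by rewrite add0r.
by rewrite (IHu (fun v => f (x :: v))) addrA.
Qed.

Lemma ad_splits (V : zmodType) a (F : seq nat -> seq nat -> V) w :
  ad a (fun v => \sum_(s <- splits v) F s.1 s.2) w
  = \sum_(s <- splits w) (ad a (fun v => F v s.2) s.1 + ad a (F s.1) s.2).
Proof.
elim: w F => [|x w IHw] F; first by rewrite big_splits0 /= addr0.
have -> : ad a (fun v => \sum_(s <- splits v) F s.1 s.2) (x :: w)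
    = \sum_(b < 3) (\sum_(s <- splits w) (F (nat_of_ord b :: s.1) s.2 + F s.1 (nat_of_ord b :: s.2))) *~ st_coef a x b
      + (ad a (fun v => \sum_(s <- splits v) F (x :: s.1) s.2) w
         + ad a (fun v => \sum_(s <- splits v) F s.1 (x :: s.2)) w).
  rewrite -adD /=; congr (_ + _).
    by apply: eq_bigr => b _; rewrite big_splitsS.
  congr ad; apply: functional_extensionality => v.
  by rewrite big_splitsS big_split.
rewrite (IHw (fun p q => F (x :: p) q)) (IHw (fun p q => F p (x :: q))).
rewrite big_splitsS -big_split.
under [X in X + _]eq_bigr do rewrite mulrz_suml.
rewrite exchange_big -big_split; apply: eq_bigr => s _ /=.
under eq_bigr do rewrite mulrzDl.
rewrite big_split /= addrACA; congr (_ + _); first by rewrite addrA.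
by rewrite addrCA.
Qed.

Definition ad2 a (P : seq nat -> seq nat -> K) w u :=
  ad a (fun v => P v u) w + ad a (P w) u.

(* A linear functional on functions of two words which is invariant under the
   adjoint action: a contraction with an invariant tensor. *)
Record invariant (L : (seq nat -> seq nat -> K) -> K) : Prop := Invariant {
  invariantD : forall P Q, L (fun w u => P w u + Q w u) = L P + L Q;
  invariantZ : forall k P, L (fun w u => k * P w u) = k * L P;
  invariant_ad : forall a P, L (ad2 a P) = 0 }.

Section Invariant.
Variable L : (seq nat -> seq nat -> K) -> K.
Hypothesis invL : invariant L.

Lemma invariant_eq P Q : (forall w u, P w u = Q w u) -> L P = L Q.
Proof.
move=> E; congr L; apply: functional_extensionality => w.
exact: functional_extensionality.
Qed.

Lemma invariant0 : L (fun _ _ => 0) = 0.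
Proof.
rewrite -[RHS](mul0r (L (fun _ _ => 0))) -invariantZ //.
by apply: invariant_eq => w u; rewrite mul0r.
Qed.

Lemma invariant_sum (I : Type) (r : seq I) (Q : pred I) P :
  L (fun w u => \sum_(i <- r | Q i) P i w u) = \sum_(i <- r | Q i) L (P i).
Proof.
elim: r => [|i r IHr].
  rewrite big_nil -[RHS]invariant0; apply: invariant_eq => w u; exact: big_nil.
rewrite big_cons -IHr; case: ifP => Qi; last by apply: invariant_eq => w u; rewrite big_cons Qi.
by rewrite -invariantD //; apply: invariant_eq => w u; rewrite big_cons Qi.
Qed.

Lemma invariantZr k P : L (fun w u => P w u * k) = L P * k.
Proof.
by rewrite mulrC -invariantZ //; apply: invariant_eq => w u; rewrite mulrC.
Qed.

Lemma invariantB P Q : L (fun w u => P w u - Q w u) = L P - L Q.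
Proof.
rewrite invariantD // -[- L Q]mulN1r -invariantZ //; congr (_ + _).
by apply: invariant_eq => w u; rewrite mulN1r.
Qed.

End Invariant.

Definition ad_invariant (f : seq nat -> K) := forall a w, ad a f w = 0.

Definition conv (f g : seq nat -> K) w := \sum_(s <- splits w) f s.1 * g s.2.

(* Sliding a strand on which the words are evaluated by [theta] over a strand on
   which they are evaluated by [f]. *)
Definition slides (theta theta' f : seq nat -> K) := forall L, invariant L ->
  L (fun w u => \sum_(s <- splits w) theta s.1 * f (u ++ s.2))
  = L (fun w u => theta' w * f u).

(** A product of strands is passed one factor at a time, first [f], then [g]. Each stage applies its
    hypothesis to a functional into which the other factor has been absorbed; [L1] is invariant
    because [g] is, and [L2] because [f] is. *)
Lemma slides_conv theta theta' theta'' f g : ad_invariant f -> ad_invariant g ->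
  slides theta theta' f -> slides theta' theta'' g ->
  slides theta theta'' (conv f g).
Proof.
move=> adf adg slf slg L invL.
pose L1 P := L (fun w u => \sum_(s <- splits w) \sum_(t <- splits u)
  P s.1 t.1 * g (t.2 ++ s.2)).
pose L2 P := L (fun w u => \sum_(t <- splits u) f t.1 * P w t.2).
have inv1 : invariant L1.
  split=> [P Q|k P|a P]; rewrite /L1.
  - rewrite -invariantD //; apply: invariant_eq => w u; rewrite -big_split.
    apply: eq_bigr => s _; rewrite -big_split; apply: eq_bigr => t _ /=.
    exact: mulrDl.
  - rewrite -invariantZ //; apply: invariant_eq => w u; rewrite mulr_sumr.
    by apply: eq_bigr => s _; rewrite mulr_sumr; apply: eq_bigr => t _; rewrite mulrA.
  rewrite -[RHS](invariant_ad invL a (fun w u => \sum_(s <- splits w) \sum_(t <- splits u)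
    P s.1 t.1 * g (t.2 ++ s.2))).
  apply: invariant_eq => w u; rewrite /ad2.
  rewrite (ad_splits _ (fun p q => \sum_(t <- splits u) P p t.1 * g (t.2 ++ q))).
  rewrite (ad_sum _ _ _ (fun s v => \sum_(t <- splits v) P s.1 t.1 * g (t.2 ++ s.2))).
  rewrite -big_split; apply: eq_bigr => s _ /=.
  rewrite (ad_splits _ (fun p q => P s.1 p * g (q ++ s.2))).
  rewrite !ad_sum -!big_split; apply: eq_bigr => t _ /=.
  rewrite adZr !adZ adZr mulrDl -!addrA; congr (_ + _).
  rewrite addrCA -[LHS]addr0; congr (_ + _).
  by rewrite addrC -mulrDr -ad_cat adg mulr0.
have inv2 : invariant L2.
  split=> [P Q|k P|a P]; rewrite /L2.
  - rewrite -invariantD //; apply: invariant_eq => w u; rewrite -big_split.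
    by apply: eq_bigr => s _; rewrite mulrDr.
  - rewrite -invariantZ //; apply: invariant_eq => w u; rewrite mulr_sumr.
    by apply: eq_bigr => s _; rewrite mulrCA.
  rewrite -[RHS](invariant_ad invL a (fun w u => \sum_(t <- splits u) f t.1 * P w t.2)).
  apply: invariant_eq => w u; rewrite /ad2.
  rewrite (ad_splits _ (fun p q => f p * P w q)).
  rewrite ad_sum -big_split; apply: eq_bigr => t _ /=.
  by rewrite adZr !adZ adf mul0r add0r mulrDr.
transitivity (L1 (fun w u => \sum_(s <- splits w) theta s.1 * f (u ++ s.2))).
  apply: invariant_eq => w u.
  under eq_bigr => s _.
    rewrite /conv big_splits_cat exchange_big mulr_sumr /=.
    over.
  rewrite (big_splitsA w (fun x y z => theta x * \sum_(t <- splits u) f (t.1 ++ y) * g (t.2 ++ z))).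
  apply: eq_bigr => s _ /=.
  under eq_bigr do rewrite mulr_sumr.
  rewrite exchange_big; apply: eq_bigr => t _ /=.
  by rewrite mulr_suml; apply: eq_bigr => r _; rewrite mulrA.
rewrite (slf _ inv1) /L1.
transitivity (L2 (fun w u => \sum_(s <- splits w) theta' s.1 * g (u ++ s.2))).
  apply: invariant_eq => w u; rewrite exchange_big; apply: eq_bigr => t _ /=.
  by rewrite mulr_sumr; apply: eq_bigr => s _; rewrite mulrAC [LHS]mulrC.
rewrite (slg _ inv2) /L2; apply: invariant_eq => w u; rewrite /conv mulr_sumr.
by apply: eq_bigr => t _; rewrite mulrCA.
Qed.

Lemma slidesB theta theta' f g : slides theta theta' f -> slides theta theta' g ->
  slides theta theta' (fun w => f w - g w).
Proof.
move=> slf slg L invL; transitivity (L (fun w u => theta' w * f u) - L (fun w u => theta' w * g u)).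
  rewrite -slf // -slg // -invariantB //; apply: invariant_eq => w u.
  by rewrite -sumrB; apply: eq_bigr => s _; rewrite mulrBr.
by rewrite -invariantB //; apply: invariant_eq => w u; rewrite mulrBr.
Qed.

End Functionals.

(** * Traces of words *)

Section Traces.
Variable K : comNzRingType.

Definition chi d (w : seq nat) : K := \tr (mprod K d w).

(** Bracketing [a] into one letter is the difference of the products with [a] just before and just
    after that letter, so the sum over the letters telescopes. *)
Lemma mprod_ad d a w :
  ad a (mprod K d) w = rho K d a *m mprod K d w - mprod K d w *m rho K d a.
Proof.
elim: w => [|x w IHw] /=; first by rewrite mulmx1 mul1mx subrr.
have -> : ad a (fun v => rho K d x *m mprod K d v) w = rho K d x *m ad a (mprod K d) w.
  exact: (ad_additive (mulmx (rho K d x))).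
rewrite IHw mulmxBr -!mulmxA (mulmxA (rho K d a)) [X in _ = X *m _ - _](_ : _ =
  \sum_(k < 3) (st_coef a x k)%:~R *: rho K d k + rho K d x *m rho K d a); last first.
  by rewrite -rho_bracket subrK.
rewrite mulmxDl -!mulmxA addrA; congr (_ + _ - _).
rewrite mulmx_suml; apply: eq_bigr => k _.
by rewrite -scalemxAl scaler_int.
Qed.

Lemma chi_ad d : ad_invariant (chi d).
Proof.
move=> a w; rewrite /chi (ad_additive (mxtrace (n := d))) mprod_ad.
by rewrite raddfB /= mxtrace_mulC subrr.
Qed.

Lemma chi_cat d u w : chi d (u ++ w) = chi d (w ++ u).
Proof. by rewrite /chi !mprod_cat mxtrace_mulC. Qed.

Lemma chi_nil d : chi d [::] = d%:R.
Proof. by rewrite /chi mxtrace1. Qed.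

Definition ord_bool (b : bool) : 'I_2 := @Ordinal 2 b (leq_b1 b).

Lemma big_ord_bool (V : nmodType) (F : 'I_2 -> V) :
  \sum_i F i = \sum_b F (ord_bool b).
Proof.
by rewrite big_bool big_ord_recl big_ord1 addrC; congr (F _ + F _); apply: val_inj.
Qed.

Lemma rho2E c b b' : rho K 2 c (ord_bool b) (ord_bool b') = (gl_coef c b b')%:~R.
Proof.
rewrite mxE -val_eqE /=; case: c => [|[|c]]; case: b; case: b' => /=; rewrite ?eqxx ?mulr1n ?mulr0n; try ring.
by rewrite -[1.*2.+1]/3%N expr0; ring.
Qed.

Lemma mprod2E w b b' : mprod2 K w b b' = mprod K 2 w (ord_bool b) (ord_bool b').
Proof.
elim: w b => [|c w IHw] b /=; first by rewrite mxE; case: b; case: b'.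
rewrite mxE big_ord_bool; apply: eq_bigr => a _.
by rewrite IHw rho2E.
Qed.

Lemma mprod2_cat u w b b' :
  mprod2 K (u ++ w) b b' = \sum_a mprod2 K u b a * mprod2 K w a b'.
Proof.
rewrite mprod2E mprod_cat mxE big_ord_bool.
by apply: eq_bigr => a _; rewrite !mprod2E.
Qed.

Lemma chi2E w : chi 2 w = \sum_b mprod2 K w b b.
Proof.
rewrite /chi /mxtrace big_ord_bool; apply: eq_bigr => b _; by rewrite mprod2E.
Qed.

Lemma mprod2_ad a w b b' : ad a (fun v => mprod2 K v b b') w
  = gl_mul (fun b b' => (gl_coef a b b')%:~R) (mprod2 K w) b b'
    - gl_mul (mprod2 K w) (fun b b' => (gl_coef a b b')%:~R) b b'.
Proof.
transitivity ((ad a (mprod K 2) w) (ord_bool b) (ord_bool b')).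
  have -> : (fun v => mprod2 K v b b') = (fun v => mprod K 2 v (ord_bool b) (ord_bool b')).
    by apply: functional_extensionality => v; rewrite mprod2E.
  elim: w (mprod K 2) => [|x w IHw] f /=; first by rewrite mxE.
  rewrite mxE summxE (IHw (fun v => f (x :: v))); congr (_ + _).
  by apply: eq_bigr => k _; rewrite -[in RHS]scaler_int mxE mulrzl.
rewrite mprod_ad !mxE !big_ord_bool /gl_mul; congr (_ - _); apply: eq_bigr => c _.
  by rewrite rho2E mprod2E.
by rewrite rho2E mprod2E.
Qed.

Lemma tprod_splits d w b b' :
  tprod K d w b b' = \sum_(s <- splits w) mprod2 K s.2 b b' *: mprod K d s.1.
Proof.
elim: w b => [|c w IHw] b /=; first by rewrite big_splits0 scale_scalar_mx mulr1.
rewrite big_splitsS big_split /=; congr (_ + _).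
  by rewrite IHw mulmx_sumr; apply: eq_bigr => s _; rewrite -scalemxAr.
under [LHS]eq_bigr do rewrite IHw scaler_sumr.
rewrite exchange_big; apply: eq_bigr => s _ /=.
by rewrite scaler_suml; apply: eq_bigr => a _; rewrite scalerA.
Qed.

Lemma splits_chi2 d w u :
  \sum_(s <- splits w) chi d s.1 * chi 2 (u ++ s.2)
  = \sum_b \sum_b' mprod2 K u b' b * \tr (tprod K d w b b').
Proof.
under [RHS]eq_bigr => b _.
  under eq_bigr => b' _.
    rewrite tprod_splits raddf_sum mulr_sumr /=.
    under eq_bigr do rewrite mxtraceZ mulrA.
    over.
  rewrite exchange_big; over.
rewrite exchange_big; apply: eq_bigr => s _ /=.
rewrite chi2E mulrC mulr_suml exchange_big; apply: eq_bigr => b' _ /=.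
by rewrite mprod2_cat mulr_suml.
Qed.

Lemma splits_chi2_tau d w u :
  d.+1%:R * (\sum_(s <- splits w) chi d.+1 s.1 * chi 2 (u ++ s.2))
  = tau K d.+2 w u - tau K d w u + d%:R * chi 2 u * chi d w.
Proof. by rewrite splits_chi2 tprod_trace -chi2E. Qed.

Lemma tau_nil D w : tau K D w [::] = D.-1%:R * chi D w.
Proof. by rewrite /tau gl_act1 mul_mx_scalar mxtraceZ. Qed.

Lemma chi0 w : chi 0 w = 0.
Proof. by rewrite /chi /mxtrace big_ord0. Qed.

(** For an empty second word the vector field is Euler's, and [tau] is a multiple of a trace. The
    factor d + 1 stays, as it may vanish in the ring. *)
Lemma conv_chi2 d w :
  d.+1%:R * conv (chi d.+1) (chi 2) w = d.+1%:R * (chi d.+2 w + chi d w).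
Proof.
rewrite /conv (splits_chi2 _ _ [::]) tprod_trace !tau_nil -chi2E chi_nil -/(chi d w).
case: d => [|d]; first by rewrite chi0 !(mulr0, mul0r, subr0, addr0).
rewrite /= -!natr1; ring.
Qed.

End Traces.

(** * Sliding over irreducible representations in characteristic p *)

Section ModP.
Variables (K : fieldType) (p : nat).
Hypotheses (p_odd : odd p) (pcharKp : p \in [pchar K]).

Lemma natr_neq0 n : (0 < n < p)%N -> n%:R != 0 :> K.
Proof.
case/andP=> n_gt0 lt_np; rewrite -(dvdn_pcharf pcharKp).
by apply: contraL lt_np => /dvdn_leq -/(_ n_gt0); rewrite -leqNgt.
Qed.

Lemma two_neq0 : 2%:R != 0 :> K.
Proof.
apply: natr_neq0; have := prime_gt1 (pcharf_prime pcharKp).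
by case: p p_odd => [|[|[|n]]].
Qed.

(* Schur's lemma for the Steinberg representation, whose dimension vanishes. *)
Lemma schur_trace (A : 'M[K]_p) :
  (forall a, rho K p a *m A = A *m rho K p a) -> \tr A = 0.
Proof.
move=> comm.
(* The diagonal entries of h differ by 2 (i - j), nonzero modulo p, so commuting with h forces [A]
   to be diagonal. *)
have diag i j : i != j -> A i j = 0.
  move=> ne; have /matrixP/(_ i j) := comm 2%N.
  rewrite !mxE (bigD1 i) //= [X in _ + X]big1 ?addr0 => [|k nk]; last first.
    by rewrite mxE /= eq_sym (negPf nk) mul0r.
  rewrite (bigD1 j) //= [X in _ + X]big1 ?addr0 => [|k nk]; last first.
    by rewrite mxE /= (negPf nk) mulr0.
  rewrite !mxE /= !eqxx !mulr1n [RHS]mulrC => /eqP; rewrite -subr_eq0 -mulrBl mulf_eq0.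
  case/orP=> /eqP // E; case/eqP: ne.
  wlog lt_ji : i j E / (j < i)%N => [wl|].
    have [|lt_ij|Eij] := ltngtP j i; [exact: wl | | by apply: val_inj].
    by apply/esym/wl => //; rewrite -opprB E oppr0.
  move: E; rewrite opprB addrA subrK -!natr1 -!addnn !natrD opprD addrACA subrr addr0.
  have -> : i%:R + i%:R - (j%:R + j%:R) = 2%:R * (i - j)%N%:R :> K.
    by rewrite natrB ?(ltnW lt_ji) //; ring.
  move/eqP; rewrite mulf_eq0 (negPf two_neq0) /= => /negPn/negP[].
  by apply: natr_neq0; have := ltn_ord i; lia.
(* The first two basis matrices differ by 2 e, whose subdiagonal entries are nonzero modulo p and
   link consecutive diagonal entries of [A]. *)
have next (i j : 'I_p) : i = j.+1 :> nat -> A i i = A j j.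
  move=> Ei; have : (rho K p 0 - rho K p 1) *m A = A *m (rho K p 0 - rho K p 1).
    by rewrite mulmxBl mulmxBr !comm.
  move/matrixP/(_ i j); rewrite !mxE (bigD1 j) //= [X in _ * A j j + X]big1 ?addr0 => [|k nk]; last first.
    by rewrite [A k j]diag ?mulr0.
  rewrite (bigD1 i) //= [X in A i i * _ + X]big1 ?addr0 => [|k nk]; last first.
    by rewrite [A i k]diag ?mul0r // eq_sym.
  rewrite !mxE /= Ei eqxx (_ : (j == j.+2 :> nat) = false) ?mulr0n; last by lia.
  rewrite !mulr1n !subr0 opprK -mulr2n [RHS]mulrC.
  have nz : (p - j.+1)%:R *+ 2 != 0 :> K.
    by rewrite -[X in X != 0]mulr_natl mulf_neq0 ?two_neq0 // natr_neq0 //; have := ltn_ord i; rewrite Ei; lia.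
  by move=> E; apply/esym/(mulfI nz).
have p_gt0 : (0 < p)%N := prime_gt0 (pcharf_prime pcharKp).
have const (i : 'I_p) : A i i = A (Ordinal p_gt0) (Ordinal p_gt0).
  case: i => i; elim: i => [|i IHi] lt_i; first by congr (A _ _); apply: val_inj.
  by rewrite (next (Ordinal lt_i) (Ordinal (ltnW lt_i))) // IHi.
rewrite /mxtrace (eq_bigr _ (fun i _ => const i)) sumr_const card_ord.
by rewrite (mulrn_pchar pcharKp).
Qed.

Definition equivariant (Psi : seq nat -> seq nat -> 'M[K]_p) := forall a w u,
  ad a (fun v => Psi v u) w + ad a (Psi w) u
  = rho K p a *m Psi w u - Psi w u *m rho K p a.

(** Applied entrywise, [L] kills the left side of equivariance, so the matrix of its values commutes
    with the action. *)
Lemma equivariant_trace Psi L : equivariant Psi -> invariant L ->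
  L (fun w u => \tr (Psi w u)) = 0.
Proof.
move=> eqv invL; rewrite (invariant_sum invL (index_enum 'I_p) xpredT (fun i w u => Psi w u i i)).
pose A := \matrix_(i, j) L (fun w u => Psi w u i j).
transitivity (\tr A); first by apply: eq_bigr => i _; rewrite mxE.
apply: schur_trace => a; apply/matrixP => i j; apply/eqP; rewrite -subr_eq0; apply/eqP.
rewrite -[RHS](invariant_ad invL a (fun w u => Psi w u i j)).
transitivity (L (fun w u => (rho K p a *m Psi w u - Psi w u *m rho K p a) i j)).
  rewrite !mxE.
  transitivity (L (fun w u => \sum_k rho K p a i k * Psi w u k j)
     - L (fun w u => \sum_k Psi w u i k * rho K p a k j)).
    rewrite !invariant_sum //; congr (_ - _); apply: eq_bigr => k _.
      by rewrite [A _ _]mxE invariantZ.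
    by rewrite [A _ _]mxE invariantZr.
  rewrite -invariantB //; apply: invariant_eq => w u; by rewrite !mxE.
apply: invariant_eq => w u; rewrite -eqv /ad2 mxE.
have entry (f : seq nat -> 'M[K]_p) v : ad a f v i j = ad a (fun x => f x i j) v.
  elim: v f => [|x v IHv] f /=; first by rewrite mxE.
  rewrite mxE summxE (IHv (fun y => f (x :: y))); congr (_ + _).
  by apply: eq_bigr => k _; rewrite -[in LHS]scaler_int mxE mulrzl.
by rewrite !entry.
Qed.

Definition theta (P : pred nat) (w : seq nat) : K := \sum_(d < p | P d) d%:R * chi K d w.

(** Both factors vary by commutators, and the inner terms cancel in the product. *)
Lemma equivariant_gl_act : equivariant (fun w u => mprod K p w *m gl_act (mprod2 K u) p).
Proof.
move=> a w u.
have -> : ad a (fun v => mprod K p v *m gl_act (mprod2 K u) p) w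
    = (rho K p a *m mprod K p w - mprod K p w *m rho K p a) *m gl_act (mprod2 K u) p.
  rewrite -mprod_ad; exact: (ad_additive (mulmxr (gl_act (mprod2 K u) p))).
have -> : ad a (fun v => mprod K p w *m gl_act (mprod2 K v) p) u
    = mprod K p w *m (rho K p a *m gl_act (mprod2 K u) p - gl_act (mprod2 K u) p *m rho K p a).
  rewrite (ad_additive (mulmx (mprod K p w)) a (fun v => gl_act (mprod2 K v) p)); congr (_ *m _).
  rewrite rhoE gl_act_bracket.
  case: (p) => [|q]; first by apply/matrixP => -[].
  rewrite /gl_act ad_sum; apply: eq_bigr => b _; rewrite ad_sum; apply: eq_bigr => b' _.
  rewrite -mprod2_ad.
  elim: u (mprod2 K) => [|x u IHu] f /=; first by rewrite scale0r.
  rewrite scalerDl (IHu (fun v => f (x :: v))); congr (_ + _).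
  by rewrite scaler_suml; apply: eq_bigr => k _; rewrite scalerMzl.
by rewrite mulmxBl mulmxBr addrA -!mulmxA subrK.
Qed.

(* The action of w in dimension d - 1 and of u in dimension 2, on the tensor
   product mapped to dimension d and back. *)
Definition shift_act d w u : 'M[K]_d :=
  if d is q.+1 then
    \sum_b \sum_b' mprod2 K u b b' *: (derX K b q *m mprod K q w *m mulX K b' q)
  else 0.

(** Moving the action through [derX] and [mulX] costs terms in the matrix of the plane; these make
    up the variation of [u], and the rest is the variation of [w]. *)
Lemma equivariant_shift_act : equivariant (shift_act p).
Proof.
move=> a w u; case: (p) => [|q]; first by apply/matrixP => -[].
pose g b b' : K := (gl_coef a b b')%:~R.
have -> : ad a (fun v => shift_act q.+1 v u) w = \sum_b \sum_b' mprod2 K u b b' *: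
    (derX K b q *m (rho K q a *m mprod K q w - mprod K q w *m rho K q a) *m mulX K b' q).
  rewrite ad_sum; apply: eq_bigr => b _; rewrite ad_sum; apply: eq_bigr => b' _.
  rewrite -mprod_ad.
  exact: (ad_additive (GRing.scale (mprod2 K u b b')
    \o (mulmxr (mulX K b' q) \o mulmx (derX K b q)))).
have -> : ad a (shift_act q.+1 w) u = \sum_b \sum_b'
    (gl_mul g (mprod2 K u) b b' - gl_mul (mprod2 K u) g b b') *:
      (derX K b q *m mprod K q w *m mulX K b' q).
  rewrite ad_sum; apply: eq_bigr => b _; rewrite ad_sum; apply: eq_bigr => b' _.
  rewrite -mprod2_ad.
  elim: u (mprod2 K) => [|x u IHu] f /=; first by rewrite scale0r.
  rewrite scalerDl (IHu (fun v => f (x :: v))); congr (_ + _).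
  by rewrite scaler_suml; apply: eq_bigr => k _; rewrite scalerMzl.
have -> : rho K q.+1 a *m shift_act q.+1 w u
    = \sum_b \sum_b' mprod2 K u b b' *: (derX K b q *m (rho K q a *m mprod K q w) *m mulX K b' q)
      + \sum_b \sum_b' gl_mul g (mprod2 K u) b b' *: (derX K b q *m mprod K q w *m mulX K b' q).
  rewrite /shift_act mulmx_sumr.
  rewrite [X in _ = _ + X](_ : _ = \sum_b \sum_b' mprod2 K u b b' *:
      (\sum_c g c b *: (derX K c q *m mprod K q w *m mulX K b' q))); last first.
    rewrite exchange_big [RHS]exchange_big; apply: eq_bigr => b' _ /=.
    under [RHS]eq_bigr do rewrite scaler_sumr.
    rewrite [RHS]exchange_big; apply: eq_bigr => b _ /=.
    by rewrite /gl_mul scaler_suml; apply: eq_bigr => c _; rewrite scalerA mulrC.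
  rewrite -big_split; apply: eq_bigr => b _; rewrite mulmx_sumr -big_split.
  apply: eq_bigr => b' _ /=; rewrite -scalemxAr -scalerDr; congr (_ *: _).
  rewrite !mulmxA rho_derX !mulmxDl; congr (_ + _).
  by rewrite !mulmx_suml; apply: eq_bigr => c _; rewrite -!scalemxAl.
have -> : shift_act q.+1 w u *m rho K q.+1 a
    = \sum_b \sum_b' mprod2 K u b b' *: (derX K b q *m (mprod K q w *m rho K q a) *m mulX K b' q)
      + \sum_b \sum_b' gl_mul (mprod2 K u) g b b' *: (derX K b q *m mprod K q w *m mulX K b' q).
  rewrite /shift_act mulmx_suml -big_split; apply: eq_bigr => b _ /=.
  rewrite [X in _ = _ + X](_ : _ = \sum_b' mprod2 K u b b' *:
      (\sum_c g b' c *: (derX K b q *m mprod K q w *m mulX K c q))); last first.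
    under [RHS]eq_bigr do rewrite scaler_sumr.
    rewrite [RHS]exchange_big; apply: eq_bigr => b' _ /=.
    by rewrite /gl_mul scaler_suml; apply: eq_bigr => c _; rewrite scalerA.
  rewrite mulmx_suml -big_split; apply: eq_bigr => b' _ /=.
  rewrite -scalemxAl -scalerDr; congr (_ *: _).
  rewrite -!mulmxA mulX_rho !mulmxDr; congr (_ + _).
  by rewrite !mulmx_sumr; apply: eq_bigr => c _; rewrite -!scalemxAr mulmxA.
rewrite opprD addrACA; congr (_ + _).
  rewrite -sumrB; apply: eq_bigr => b _; rewrite -sumrB; apply: eq_bigr => b' _.
  by rewrite -scalerBr mulmxBr mulmxBl.
rewrite -sumrB; apply: eq_bigr => b _; rewrite -sumrB; apply: eq_bigr => b' _.
by rewrite scalerBl.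
Qed.

(** By cyclicity and the Weyl relation. The product of characters is what completes [tau] in
    dimension p - 1 when the even sum is the target. *)
Lemma trace_shift_act q w u :
  \tr (shift_act q.+2 w u) = tau K q.+1 w u + chi K 2 u * chi K q.+1 w.
Proof.
rewrite /shift_act /tau /gl_act mulmx_sumr !raddf_sum chi2E mulr_suml -big_split.
apply: eq_bigr => b _ /=; rewrite mulmx_sumr !raddf_sum /=.
rewrite (_ : mprod2 K u b b * _ = \sum_b' (b' == b)%:R * (mprod2 K u b b' * chi K q.+1 w)); last first.
  rewrite (bigD1 b) //= eqxx mul1r big1 ?addr0 // => b' ne.
  by rewrite (negPf ne) mul0r.
rewrite -big_split; apply: eq_bigr => b' _ /=.
rewrite -scalemxAr !mxtraceZ -mulmxA mxtrace_mulC -mulmxA weyl mulmxDr raddfD /=.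
by rewrite mul_mx_scalar mxtraceZ -/(chi K q.+1 w) mulrDr; congr (_ + _); rewrite mulrCA.
Qed.

(** The upper index is the least integer of parity [r] not below [N]; the lower one is [r] itself,
    read as 0 or 1. *)
Lemma telescope_parity (V : zmodType) (t : nat -> V) N (r : bool) :
  \sum_(d < N | odd d == r) (t d.+2 - t d) = t (N + (odd N (+) r))%N - t r.
Proof.
elim: N => [|N IHN]; first by rewrite big_ord0 add0n subrr.
rewrite big_mkcond big_ord_recr -big_mkcond IHN /=.
have [E|ne] := eqVneq (odd N) r.
  by rewrite E addbb addNb addbb /= addn0 addn1 addrC addrA subrK.
have {ne} -> : r = ~~ odd N by move: ne; case: (odd N); case: (r).
rewrite addr0.
by rewrite addbN addbb addNb addbN addbb /= addn0 addn1.
Qed.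

(* By [tprod_trace] the sum over d telescopes up to a boundary term, the trace of
   an equivariant p x p matrix. *)
Lemma slides_chi2 q :
  slides (theta (fun d => odd d == q)) (theta (fun d => odd d == ~~ q)) (chi K 2).
Proof.
move=> L invL; apply/eqP; rewrite -subr_eq0 -invariantB //; apply/eqP.
have [N Ep oN] : exists2 N, p = N.+2 & odd N.
  have := prime_gt1 (pcharf_prime pcharKp).
  by case: (p) p_odd => [|[|N]] //= /negPn oN _; exists N.
(* This is the weight of dimension p - 1, which occurs in the even target sum but not in the shifted
   sum. *)
have EN : N.+1%:R = -1 :> K.
  by apply/eqP; rewrite -subr_eq0 opprK natr1 -Ep (pcharf0 pcharKp).
have Sum w u : \sum_(s <- splits w) theta (fun d => odd d == q) s.1 * chi K 2 (u ++ s.2)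
    = \sum_(d < N.+1 | odd d == ~~ q)
        (tau K d.+2 w u - tau K d w u + d%:R * chi K 2 u * chi K d w).
  rewrite /theta; under eq_bigr do rewrite mulr_suml.
  rewrite exchange_big /= Ep big_mkcond big_ord_recl /= [X in _ = X]big_mkcond /=.
  rewrite (_ : (if _ then _ else _) = 0) ?add0r; last first.
    by case: ifP => // _; rewrite big1 // => s _; rewrite !mul0r.
  apply: eq_bigr => d _; rewrite /bump /= add1n.
  have -> : (~~ odd d == q) = (odd d == ~~ q) by case: (odd d) (q) => [] [].
  case: ifP => // _; rewrite -splits_chi2_tau mulr_sumr.
  by apply: eq_bigr => s _; rewrite mulrA.
(* The upper boundary term: [tau] in dimension p when the target dimensions are odd, and in
   dimension p - 1 with its completion when they are even. *)
pose R w u : K := if q then \tr (shift_act p w u) else \tr (mprod K p w *m gl_act (mprod2 K u) p).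
transitivity (L R); last first.
  rewrite /R; case: (q); first exact: equivariant_trace equivariant_shift_act invL.
  exact: equivariant_trace equivariant_gl_act invL.
apply: invariant_eq => w u.
rewrite Sum big_split /= (telescope_parity (fun d => tau K d w u)) /= oN addFb.
(* The lower boundary lies in dimension 0 or 1, where vector fields act by 0. *)
have -> : tau K (~~ q) w u = 0.
  case: (q) => /=; rewrite /tau; first by rewrite /mxtrace big_ord0.
  rewrite (_ : gl_act _ 1 = 0) ?mulmx0 ?linear0 // /gl_act big1 // => b _; rewrite big1 // => b' _.
  by rewrite (flatmx0 (mulX K _ 0)) mulmx0 scaler0.
rewrite subr0 [theta _ w]/theta /R Ep [in X in _ - X]big_mkcond big_ord_recr -big_mkcond /= oN.
rewrite (eq_bigr (fun d : 'I_N.+1 => d%:R * chi K d w * chi K 2 u)); last first.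
  by move=> d _; rewrite mulrAC.
rewrite -mulr_suml mulrDl opprD addrA addrK.
case: (q) => /=; last by rewrite mul0r subr0 addn1.
by rewrite trace_shift_act addn0 EN mulN1r mulNr opprK mulrC.
Qed.

Lemma slides_chi1 f : slides f f (chi K 1).
Proof.
have chi1 x w : chi K 1 (x :: w) = 0.
  by rewrite /chi /= rho1 mul0mx linear0.
move=> L invL; apply: invariant_eq => w u.
case: u => [|x u]; last by rewrite chi1 mulr0 big1 // => s _; rewrite chi1 mulr0.
elim: w f => [|x w IHw] f; first by rewrite big_splits0.
rewrite big_splitsS big_split /= [X in _ + X]big1 ?addr0 => [|s _]; last by rewrite chi1 mulr0.
exact: (IHw (fun v => f (x :: v))).
Qed.

(** Recursion through chi_(d+1) = chi_d chi_2 - chi_(d-1), obtained by dividing by d, nonzero modulo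
    p. Every factor chi_2 exchanges the parities, hence d - 1 exchanges for chi_d. *)
Lemma slides_chi d q : (0 < d < p)%N ->
  slides (theta (fun k => odd k == q)) (theta (fun k => odd k == q (+) ~~ odd d)) (chi K d).
Proof.
elim/ltn_ind: d q => -[|[|[|d]]] IHd q // lt_dp.
- by rewrite addbF; exact: slides_chi1.
- by rewrite addbT; exact: slides_chi2.
have nz : d.+2%:R != 0 :> K by apply: natr_neq0; lia.
have -> : chi K d.+3 = fun w => conv (chi K d.+2) (chi K 2) w - chi K d.+1 w.
  apply: functional_extensionality => w; apply: (mulfI nz).
  by rewrite mulrBr conv_chi2 mulrDr addrK.
have -> : odd d.+3 = odd d.+1 by rewrite /= negbK.
apply: slidesB; last by apply: IHd; lia.
apply: (slides_conv (theta' := theta (fun k => odd k == q (+) ~~ odd d.+2))).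
- exact: chi_ad.
- exact: chi_ad.
- by apply: IHd; lia.
have -> : q (+) ~~ odd d.+1 = ~~ (q (+) ~~ odd d.+2) by rewrite /=; case: (q); case: (odd d).
exact: slides_chi2.
Qed.

Lemma slides_sum f g (P : pred nat) :
  (forall d, (0 < d < p)%N -> P d -> slides f g (chi K d)) -> slides f g (theta P).
Proof.
move=> sl L invL.
transitivity (\sum_(d < p | P d) d%:R * L (fun w u => g w * chi K d u)).
  transitivity (\sum_(d < p | P d) d%:R * L (fun w u => \sum_(s <- splits w) f s.1 * chi K d (u ++ s.2))).
    under [RHS]eq_bigr do rewrite -invariantZ //.
    rewrite -invariant_sum //; apply: invariant_eq => w u.
    rewrite /theta; under eq_bigr do rewrite mulr_sumr.
    rewrite exchange_big; apply: eq_bigr => d _ /=.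
    by rewrite mulr_sumr; apply: eq_bigr => s _; rewrite mulrCA.
  apply: eq_bigr => d Pd; have [->|d_gt0] := posnP d; first by rewrite !mul0r.
  by rewrite sl // d_gt0 ltn_ord.
under eq_bigr do rewrite -invariantZ //.
rewrite -invariant_sum //; apply: invariant_eq => w u.
by rewrite /theta mulr_sumr; apply: eq_bigr => d _; rewrite mulrCA.
Qed.

Lemma thetaD w : theta xpredT w
  = theta (fun d => odd d == true) w + theta (fun d => odd d == false) w.
Proof.
rewrite /theta (bigID (fun d : 'I_p => odd d)) /=; congr (_ + _); apply: eq_bigl => d.
  by rewrite eqb_id.
by rewrite eqbF_neg.
Qed.

(** Odd dimensions preserve the parity, so the odd sum slides over itself; even dimensions exchange
    the two classes, which leaves the full sum unchanged. *)
Lemma slides_theta (P : pred nat) : P = xpredT \/ P = odd -> slides (theta P) (theta P) (theta P).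
Proof.
case=> ->; apply: slides_sum => d lt_d odd_d; last first.
  have := slides_chi true lt_d; rewrite odd_d.
  have -> // : theta (fun k => odd k == true) = theta odd.
  apply: functional_extensionality => w; apply: eq_bigl => k; exact: eqb_id.
move=> L invL.
transitivity (L (fun w u => \sum_(s <- splits w) theta (fun d => odd d == true) s.1 * chi K d (u ++ s.2))
  + L (fun w u => \sum_(s <- splits w) theta (fun d => odd d == false) s.1 * chi K d (u ++ s.2))).
  rewrite -invariantD //; apply: invariant_eq => w u; rewrite -big_split.
  by apply: eq_bigr => s _; rewrite thetaD mulrDl.
rewrite !(slides_chi _ lt_d) // -invariantD //; apply: invariant_eq => w u.
rewrite thetaD mulrDl; case: (odd d) => //=; exact: addrC.
Qed.

End ModP.

(** * Invariance of the contraction defined by a diagram *)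

Section Adjoint.
Variable K : comNzRingType.

Lemma eq_ad_size (V : zmodType) a (f g : seq nat -> V) w :
  (forall v, size v = size w -> f v = g v) -> ad a f w = ad a g w.
Proof.
elim: w f g => [|x w IHw] f g E //=; congr (_ + _).
  by apply: eq_bigr => b _; rewrite E.
by apply: IHw => v sv; apply: E; rewrite /= sv.
Qed.

Lemma ad0 (V : zmodType) a w : ad a (fun=> 0 : V) w = 0.
Proof.
elim: w => [|x w IHw] //=; rewrite IHw addr0 big1 // => b _; exact: mul0rz.
Qed.

Lemma ad_nth (V : zmodType) a (f : seq nat -> V) w :
  ad a f w = \sum_(k < size w) \sum_(b < 3)
    f (set_nth 0%N w k b) *~ st_coef a (nth 0%N w k) b.
Proof.
elim: w f => [|x w IHw] f /=; first by rewrite big_ord0.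
by rewrite [RHS]big_ord_recl (IHw (fun v => f (x :: v))); congr (_ + _); apply: eq_bigr.
Qed.

Fixpoint adl a (F : seq (seq nat) -> K) (ls : seq (seq nat)) : K :=
  if ls is l :: ls' then
    ad a (fun v => F (v :: ls')) l + adl a (fun vs => F (l :: vs)) ls'
  else 0.

Lemma adl_flatten a F ls :
  adl a F ls = ad a (fun v => F (reshape (shape ls) v)) (flatten ls).
Proof.
elim: ls F => [|l ls IHls] F //=; rewrite ad_cat IHls; congr (_ + _).
  apply: eq_ad_size => v sv.
  by rewrite -sv take_size_cat // drop_size_cat // flattenK.
by apply: eq_ad_size => v _; rewrite take_size_cat // drop_size_cat.
Qed.

Fixpoint prod_fun (fs : seq (seq nat -> K)) (ls : seq (seq nat)) : K :=
  match fs, ls with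
  | f :: fs', l :: ls' => f l * prod_fun fs' ls'
  | _, _ => 1
  end.

Lemma adlZ a k F ls : adl a (fun vs => k * F vs) ls = k * adl a F ls.
Proof.
elim: ls F => [|l ls IHls] F /=; first by rewrite mulr0.
by rewrite adZ (IHls (fun vs => F (l :: vs))) mulrDr.
Qed.

Lemma adl_prod_fun a fs ls : size fs = size ls ->
  (forall f, List.In f fs -> ad_invariant f) -> adl a (prod_fun fs) ls = 0.
Proof.
elim: fs ls => [|f fs IHfs] [|l ls] //= [sz] inv.
rewrite adZr inv ?mul0r ?add0r; last by left.
by rewrite adlZ IHfs ?mulr0 // => g gfs; apply: inv; right.
Qed.

Definition vertex_weight (x y z : nat) : K := 4%:R * (eps3 x y z)%:~R.

(** A vertex as a function of words, so that vertices and circles are treated alike; words of length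
    other than 3 get 0. *)
Definition vertex_fun (l : seq nat) : K :=
  if l is [:: x; y; z] then vertex_weight x y z else 0.

Lemma vertex_fun_ad : ad_invariant vertex_fun.
Proof.
move=> a w; have z0 x : \sum_(b < 3) (0 : K) *~ st_coef a x b = 0.
  by rewrite big1 // => b _; exact: mul0rz.
case: w => [|x [|y [|z [|t w]]]] //=; rewrite ?z0 ?addr0 //.
- have E (s : int) x' y' z' : vertex_weight x' y' z' *~ s = (4 * (eps3 x' y' z' * s))%:~R.
    by rewrite /vertex_weight -mulrzr !intrM mulrA.
  rewrite !big_ord_recl !big_ord0 /bump /= !E !addr0 -!intrD -[RHS]/(0%:~R); congr (_%:~R).
  clear z0; by rewrite /st_coef; case: a => [|[|a]]; case: x => [|[|x]]; case: y => [|[|y]]; case: z => [|[|z]].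
by rewrite !add0r; exact: ad0.
Qed.

End Adjoint.

Lemma eps3_antisym x y z : eps3 y x z = - eps3 x y z.
Proof. by case: x => [|[|x]]; case: y => [|[|y]]; case: z => [|[|z]]. Qed.

Lemma eps3_cyclic x y z : eps3 y z x = eps3 x y z.
Proof. by case: x => [|[|x]]; case: y => [|[|y]]; case: z => [|[|z]]. Qed.

Section Flat.
Variable K : fieldType.
Hypothesis two_neq0 : 2%:R != 0 :> K.

Definition edge_sum (es : seq nat) (c : nat -> nat) (F : (nat -> nat) -> K) : K :=
  sumlab (fun=> 3%N) (fun=> edge_weight K) es c F.

Lemma edge_sum_last e es c F : e \in es -> 
  edge_sum es c F = edge_sum (rem e es) c (fun c' => \sum_(x < 3) edge_weight K x * F (upd c' e x)).
Proof.
move=> e_es; rewrite /edge_sum (@sumlab_perm _ _ _ _ es (rem e es ++ [:: e])) ?sumlab_cat //.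
by rewrite (perm_trans (perm_to_rem e_es)) // perm_sym cats1 perm_rcons.
Qed.

Lemma edge_weight_st x y b :
  edge_weight K b * (4%:R * (eps3 b x y)%:~R) = (st_coef x y b)%:~R.
Proof.
rewrite /st_coef intrM mulrA; congr (_ * _); case: b => [|b] /=.
  by rewrite (_ : 4%:R = 2%:R * 2%:R) ?mulKf // -natrM.
by rewrite mulNr (_ : 4%:R = 2%:R * 2%:R) ?mulKf // -natrM.
Qed.

Lemma edge_weight_st_antisym a x b : edge_weight K x * (st_coef a x b)%:~R
  = - (edge_weight K b * (st_coef a b x)%:~R).
Proof.
have E y z : edge_weight K y * (st_coef a y z)%:~R
    = edge_weight K y * edge_weight K z * 4%:R * (eps3 z a y)%:~R.
  by rewrite -edge_weight_st !mulrA.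
rewrite !E -mulrN -intrN -eps3_antisym (mulrC (edge_weight K b)); congr (_ * _%:~R).
by rewrite -eps3_cyclic.
Qed.

(** The terms are grouped by edges. Each edge has both ends in [t], and the brackets at its two ends
    cancel because the bracket is skew for the form carried by the edge. *)
Lemma edge_sum_ad a (G : seq nat -> K) t es c0 :
  (forall e, e \in t -> count_mem e t = 2%N) -> {subset t <= es} ->
  edge_sum es c0 (fun c => ad a G (map c t)) = 0.
Proof.
move=> cnt sub.
pose H c (k : nat) : K := \sum_(b < 3)
  G (set_nth 0%N (map c t) k b) *~ st_coef a (c (nth 0%N t k)) b.
transitivity (\sum_(e <- undup t) edge_sum es c0
    (fun c => \sum_(k < size t | nth 0%N t k == e) H c k)).
  rewrite -sumlab_sum; apply: eq_sumlab => c _.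
  rewrite ad_nth size_map [RHS](exchange_big_dep xpredT) //=; apply: eq_bigr => k _.
  rewrite -[RHS]big_filter (_ : [seq _ <- _ | _] = [:: nth 0%N t k]); last first.
    rewrite (eq_filter (a2 := pred1 (nth 0%N t k))); last by move=> e; rewrite /= eq_sym.
    by rewrite filter_pred1_uniq ?undup_uniq // mem_undup mem_nth.
  rewrite big_seq1; apply: eq_bigr => b _.
  by rewrite (nth_map 0%N).
rewrite big_seq big1 // => e; rewrite mem_undup => e_t.
rewrite (edge_sum_last _ _ (sub e e_t)) -[RHS](mul0r (edge_sum (rem e es) c0 (fun=> 0))).
rewrite /edge_sum -sumlabZ; apply: eq_sumlab => c _; rewrite mul0r.
pose A := [set k : 'I_(size t) | nth 0%N t k == e].
have /cards2P[k1 [k2 [ne12 EA]]] : #|A| == 2%N.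
  rewrite -sum1_card -(cnt e e_t) -sum1_count (big_nth 0%N) big_mkord; apply/eqP.
  by apply: eq_bigl => k; rewrite inE.
pose h x b := G (set_nth 0%N (map (upd c e x) t) k1 b).
have t1 : nth 0%N t k1 = e by have := set21 k1 k2; rewrite -EA inE => /eqP.
have t2 : nth 0%N t k2 = e by have := set22 k1 k2; rewrite -EA inE => /eqP.
(* Changing the second end from x to b gives the same labels as changing the first end from b to
   x. *)
have h2 x b : G (set_nth 0%N (map (upd c e x) t) k2 b) = h b x.
  rewrite /h; congr G; apply: (@eq_from_nth _ 0%N).
    by rewrite !size_set_nth !size_map !(maxn_idPr _).
  move=> i; rewrite size_set_nth size_map (maxn_idPr _) // => lt_i.
  rewrite !nth_set_nth /= !(nth_map 0%N) // /upd.
  have := in_set2 (Ordinal lt_i) k1 k2; rewrite -EA inE /= -!val_eqE /= => ->.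
  have ne21 : (k2 : nat) == k1 = false by apply/negbTE; rewrite eq_sym.
  case: (i =P k1) => [->|_] /=; last by case: eqP.
  by rewrite eq_sym ne21.
transitivity (\sum_(x < 3) \sum_(b < 3) ((edge_weight K x * (st_coef a x b)%:~R) * h x b
    + (edge_weight K x * (st_coef a x b)%:~R) * h b x)).
  apply: eq_bigr => x _; rewrite (eq_bigl (fun k => k \in A)); last by move=> k; rewrite inE.
  rewrite EA big_setU1 ?inE //= big_set1 /H t1 t2 /upd eqxx -big_split mulr_sumr.
  apply: eq_bigr => b _; rewrite h2 -/(h x b) -[h x b *~ _]mulrzr -[h b x *~ _]mulrzr /=; ring.
under eq_bigr do rewrite big_split.
rewrite big_split /= [X in _ + X]exchange_big -big_split big1 // => x _.
rewrite -big_split big1 // => b _ /=.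
by rewrite edge_weight_st_antisym mulNr addNr.
Qed.

End Flat.

(** * Relations satisfied by the contraction of a diagram *)

Section Ends.
Variable n : nat.
Implicit Types D : diagram n.

Lemma count_perm (P : pred nat) (s t : seq nat) : perm_eq s t -> count P s = count P t.
Proof. by move/seq.permP. Qed.

Definition count_legs (P : pred nat) D : nat := (\sum_i count P (legs D i))%N.

Lemma count_ends (P : pred nat) D : count P (ends D)
  = (\sum_(v <- ivert D) count P (triple_ends v) + count_legs P D)%N.
Proof.
by rewrite count_cat !count_flatten !sumnE !big_map.
Qed.

Lemma count_set_legs (P : pred nat) D i w :
  (count_legs P (set_legs D i w) + count P (legs D i) = count_legs P D + count P w)%N.
Proof.
rewrite /count_legs.
have E : (\sum_(k < n | k != i) count P (legs (set_legs D i w) k)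
    = \sum_(k < n | k != i) count P (legs D k))%N.
  by apply: eq_bigr => k /negPf ne; rewrite ffunE ne.
rewrite (bigD1 i) //= E [in RHS](bigD1 i) //= ffunE eqxx.
by rewrite addnC (addnC (count P w)) addnA.
Qed.

Lemma is_diagramP D : reflect (forall e, e \in ends D -> count_mem e (ends D) = 2%N) (is_diagram D).
Proof. by apply: (iffP allP) => dD e eD; apply/eqP; exact: dD. Qed.

Lemma is_diagram_perm D D' : perm_eq (ends D) (ends D') -> is_diagram D -> is_diagram D'.
Proof.
move=> pe /is_diagramP dD; apply/is_diagramP => e.
by rewrite -(perm_mem pe) -(seq.permP pe); exact: dD.
Qed.

Lemma perm_same_ends D D' f (s : 'S_n) r t :
    (forall i, legs D' (s i) = rot (r i) (map f (legs D i))) ->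
    perm_eq (ivert D') t -> all2 same_vertex t (map (triple_map f) (ivert D)) ->
  perm_eq (ends D') (map f (ends D)).
Proof.
move=> El pt al; apply/seq.permP => P; rewrite count_map !count_ends; congr addn.
  rewrite (perm_big _ pt) /=; elim: t (ivert D) al {pt} => [|v t IHt] [|u us] //=.
    by rewrite !big_nil.
  case/andP=> uv /IHt; rewrite !big_cons => ->; congr addn.
  move: v u uv => [[x y] z] [[a b] c]; rewrite /= !inE.
  by case/or3P=> /eqP [-> -> ->] /=; lia.
rewrite /count_legs (reindex_inj (@perm_inj _ s)) /=; apply: eq_bigr => i _.
by rewrite El -count_map; apply/seq.permP; rewrite perm_rot.
Qed.

Lemma perm_set_ivert D vs : perm_eq (flatten (map (@triple_ends nat) (ivert D)))
  (flatten (map (@triple_ends nat) vs)) -> perm_eq (ends D) (ends (set_ivert D vs)).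
Proof. by rewrite /ends perm_cat2r. Qed.

Lemma perm_set_legs D i w : perm_eq (legs D i) w -> perm_eq (ends D) (ends (set_legs D i w)).
Proof.
move=> /seq.permP pe; apply/seq.permP => P; rewrite !count_ends; congr addn.
by have := count_set_legs P D i w; rewrite pe => /addIn ->.
Qed.

Lemma perm_mask (m : seq bool) (w : seq nat) : size m = size w ->
  perm_eq w (mask (map negb m) w ++ mask m w).
Proof.
elim: m w => [|b m IHm] [|x w] //= [/IHm pe].
case: b; last by rewrite /= perm_cons.
by rewrite perm_sym /= -[x :: mask m w]cat1s perm_catCA /= perm_cons perm_sym.
Qed.

Lemma perm_handle_slide D i j a b m : i != j -> size m = size (legs D i) ->
  perm_eq (ends D) (ends (handle_slide D i j a b m)).
Proof.
move=> ne szm; apply/seq.permP => P; rewrite !count_ends; congr addn.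
rewrite /handle_slide; set w := rot a (legs D i).
have := count_set_legs P D i (mask (map negb m) w).
have := count_set_legs P (set_legs D i (mask (map negb m) w)) j (rot b (legs D j) ++ mask m w).
have -> : legs (set_legs D i (mask (map negb m) w)) j = legs D j.
  by rewrite ffunE eq_sym (negPf ne).
have /(count_perm P) : perm_eq w (mask (map negb m) w ++ mask m w).
  by apply: perm_mask; rewrite size_rot.
have /(count_perm P) : perm_eq w (legs D i) by rewrite perm_rot.
have /(count_perm P) : perm_eq (rot b (legs D j)) (legs D j) by rewrite perm_rot.
rewrite !count_cat; lia.
Qed.

Lemma perm_stu D i x y w e : legs D i = [:: x, y & w] ->
  perm_eq (e :: e :: ends D) (ends (set_ivert (set_legs D i (e :: w)) ((e, x, y) :: ivert D))).
Proof.
move=> El; apply/seq.permP => P; rewrite [RHS]count_ends big_cons /= count_ends.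
rewrite -[X in _ = (_ + X)%N]/(count_legs P (set_legs D i (e :: w))).
have := count_set_legs P D i (e :: w); rewrite El /=.
move: (count_legs P (set_legs D i (e :: w))) (count_legs P D) => k l.
move: (\sum_(v <- ivert D) _)%N => m; lia.
Qed.

Lemma is_diagram_stu D i x y w e : legs D i = [:: x, y & w] -> e \notin ends D ->
  is_diagram D -> is_diagram (set_ivert (set_legs D i (e :: w)) ((e, x, y) :: ivert D)).
Proof.
move=> El ne /is_diagramP dD; apply/is_diagramP => z.
rewrite -(perm_mem (perm_stu e El)) -(seq.permP (perm_stu e El)) !inE orbA orbb /=.
case: (eqVneq z e) => [->|nz] /=; first by rewrite (count_memPn ne).
by move/dD => ->.
Qed.

End Ends.

Section DiagramSum.
Variables (K : fieldType) (theta : seq nat -> K).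
Hypothesis two_neq0 : 2%:R != 0 :> K.

Definition vertex_product (vs : seq (nat * nat * nat)) (c : nat -> nat) : K :=
  \prod_(v <- vs) vertex_weight K (c v.1.1) (c v.1.2) (c v.2).

Definition diagram_fun n (D : diagram n) (c : nat -> nat) : K :=
  vertex_product (ivert D) c * \prod_i theta (map c (legs D i)).

Definition diagram_sum n (D : diagram n) : K :=
  edge_sum (undup (ends D)) (fun=> 0%N) (diagram_fun D).

Definition other_legs n (D : diagram n) i c : K :=
  \prod_(k < n | k != i) theta (map c (legs D k)).

Lemma diagram_funE n (D : diagram n) i c : diagram_fun D c
  = vertex_product (ivert D) c * other_legs D i c * theta (map c (legs D i)).
Proof. by rewrite /diagram_fun (bigD1 i) //= -mulrA [in RHS](mulrC (other_legs D i c)). Qed.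

Lemma diagram_fun_set_legs n (D : diagram n) i w c : diagram_fun (set_legs D i w) c
  = vertex_product (ivert D) c * other_legs D i c * theta (map c w).
Proof.
rewrite (diagram_funE _ i) /= ffunE eqxx; congr (_ * _ * _).
by apply: eq_bigr => k /negPf ne; rewrite ffunE ne.
Qed.

Lemma edge_sum_perm es es' c F : perm_eq es es' -> edge_sum es c F = edge_sum es' c F :> K.
Proof. exact: sumlab_perm. Qed.

Lemma edge_sumD es c F G :
  edge_sum es c (fun c' => F c' + G c') = edge_sum es c F + edge_sum es c G :> K.
Proof. exact: sumlabD. Qed.

Lemma edge_sum_ends n (D D' : diagram n) F : perm_eq (ends D) (ends D') ->
  edge_sum (undup (ends D')) (fun=> 0%N) F = edge_sum (undup (ends D)) (fun=> 0%N) F :> K.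
Proof. by move=> pe; apply: edge_sum_perm; rewrite perm_sym perm_undup //; exact: perm_mem. Qed.

Hypothesis theta_cyclic : forall u w, theta (u ++ w) = theta (w ++ u).

Lemma theta_rot r w : theta (rot r w) = theta w.
Proof. by rewrite /rot theta_cyclic cat_take_drop. Qed.

Lemma diagram_sum_same n (D D' : diagram n) : same_diagram D D' ->
  diagram_sum D = diagram_sum D'.
Proof.
case=> f [s [r [t [injf El pt al]]]].
have pe := perm_same_ends El pt al.
have -> : diagram_sum D' = edge_sum (map f (undup (ends D))) (fun=> 0%N)
    (fun c => diagram_fun D (c \o f)).
  rewrite /diagram_sum (@edge_sum_perm _ (map f (undup (ends D)))); last first.
    rewrite -undup_map_inj //; apply: perm_undup; exact: perm_mem.
  apply: eq_sumlab => c _; rewrite /diagram_fun; congr (_ * _).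
    rewrite /vertex_product (perm_big _ pt) /=.
    elim: t (ivert D) al {pt} => [|v t IHt] [|u us] //=; first by rewrite !big_nil.
    case/andP=> uv /IHt; rewrite !big_cons => ->; congr (_ * _).
    move: v u uv => [[x y] z] [[a b] d]; rewrite /= !inE /vertex_weight => uv.
    congr (_ * _%:~R).
    by case/or3P: uv => /eqP[-> -> ->] //=; [rewrite eps3_cyclic | rewrite -[LHS]eps3_cyclic].
  rewrite (reindex_inj (@perm_inj _ s)) /=; apply: eq_bigr => i _.
  by rewrite El map_rot theta_rot -map_comp.
by rewrite /edge_sum (@sumlab_map _ _ K (fun=> 3%N) _ (fun=> edge_weight K)).
Qed.

Lemma diagram_sum_AS n (D : diagram n) a b c vs : ivert D = (a, b, c) :: vs ->
  perm_eq (ends D) (ends (set_ivert D ((b, a, c) :: vs))) /\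
  diagram_sum (set_ivert D ((b, a, c) :: vs)) = - diagram_sum D.
Proof.
move=> Ev; have pe : perm_eq (ends D) (ends (set_ivert D ((b, a, c) :: vs))).
  apply: perm_set_ivert; rewrite Ev /=.
  by rewrite (perm_catCA [:: a] [:: b]).
split=> //; rewrite /diagram_sum (edge_sum_ends _ pe) /edge_sum -sumlabN.
apply: eq_sumlab => k _.
by rewrite /diagram_fun Ev /vertex_product !big_cons /= /vertex_weight eps3_antisym intrN mulrN !mulNr.
Qed.

Lemma ihx_identity a b c d : \sum_(x < 3) edge_weight K x *
  (vertex_weight K a b x * vertex_weight K x c d
   + vertex_weight K b c x * vertex_weight K x a d
   + vertex_weight K c a x * vertex_weight K x b d) = 0.
Proof.
transitivity (\sum_(x < 3) (4 * \sum_(y < 3) 0 : int)%:~R : K); last first.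
  by rewrite !big1 // => x _; rewrite big1.
transitivity (4%:R * (\sum_(x < 3) (eps3 a b x * st_coef c d x + eps3 b c x * st_coef a d x
  + eps3 c a x * st_coef b d x))%:~R : K).
  rewrite raddf_sum mulr_sumr; apply: eq_bigr => x _ /=.
  have E y z t u : (eps3 y z x * st_coef t u x)%:~R
      = (eps3 y z x)%:~R * (edge_weight K x * (4%:R * (eps3 x t u)%:~R)) :> K.
    by rewrite edge_weight_st // -intrM.
  rewrite !intrD !E /vertex_weight; ring.
rewrite [X in X%:~R](_ : _ = 0) ?mulr0; last first.
  rewrite !big_ord_recl big_ord0 /bump /= /st_coef.
  by case: a => [|[|a]]; case: b => [|[|b]]; case: c => [|[|c]]; case: d => [|[|d]].
by rewrite big1 // => x _; rewrite big1.
Qed.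

(** Both ends of [e] are at the two displayed vertices, so [e] occurs nowhere else; summing over its
    label last isolates [ihx_identity], the Jacobi identity. *)
Lemma diagram_sum_IHX n (D : diagram n) a b c d e vs : is_diagram D ->
    ivert D = [:: (a, b, e), (e, c, d) & vs] ->
  let D1 := set_ivert D [:: (b, c, e), (e, a, d) & vs] in
  let D2 := set_ivert D [:: (c, a, e), (e, b, d) & vs] in
  [/\ perm_eq (ends D) (ends D1), perm_eq (ends D) (ends D2)
    & diagram_sum D + diagram_sum D1 + diagram_sum D2 = 0].
Proof.
move=> /is_diagramP dD Ev D1 D2.
have pe1 : perm_eq (ends D) (ends D1).
  apply: perm_set_ivert; rewrite Ev /=; apply/seq.permP => P /=; lia.
have pe2 : perm_eq (ends D) (ends D2).
  apply: perm_set_ivert; rewrite Ev /=; apply/seq.permP => P /=; lia.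
split=> //; rewrite /diagram_sum (edge_sum_ends _ pe1) (edge_sum_ends _ pe2).
have e_ends : e \in undup (ends D).
  by rewrite mem_undup /ends Ev /= !inE eqxx !orbT.
have cnt : count_mem e (ends D) = 2%N by apply: dD; rewrite -mem_undup.
have [[na nb nc nd] nv nl] : [/\ [/\ (a == e) = false, (b == e) = false, (c == e) = false & (d == e) = false],
    e \notin flatten (map (@triple_ends nat) vs)
    & e \notin flatten [seq legs D i | i <- enum 'I_n]].
  move: cnt; rewrite /ends Ev /= eqxx count_cat.
  move: (a == e) (b == e) (c == e) (d == e) => ca cb cc cd cnt.
  have [/count_memPn nv /count_memPn nl] :
      count_mem e (flatten (map (@triple_ends nat) vs)) = 0%N
      /\ count_mem e (flatten [seq legs D i | i <- enum 'I_n]) = 0%N.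
    by move: cnt; case: ca; case: cb; case: cc; case: cd => //=; move: (count _ _) (count _ _); lia.
  by split=> //; move: cnt; case: ca; case: cb; case: cc; case: cd => //=; move: (count _ _) (count _ _); lia.
rewrite -!edge_sumD (edge_sum_last _ _ e_ends) -[RHS](mul0r (edge_sum (rem e (undup (ends D))) (fun=> 0%N) (fun=> 0))).
rewrite /edge_sum -sumlabZ; apply: eq_sumlab => k _; rewrite mul0r.
transitivity ((\sum_(x < 3) edge_weight K x *
  (vertex_weight K (k a) (k b) x * vertex_weight K x (k c) (k d)
   + vertex_weight K (k b) (k c) x * vertex_weight K x (k a) (k d)
   + vertex_weight K (k c) (k a) x * vertex_weight K x (k b) (k d)))
   * (vertex_product vs k * \prod_i theta (map k (legs D i)))); last first.
  by rewrite ihx_identity mul0r.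
rewrite mulr_suml; apply: eq_bigr => x _.
have Ev' : vertex_product vs (upd k e x) = vertex_product vs k.
  apply: eq_big_seq => v v_vs; rewrite /upd.
  have nev : e \notin triple_ends v.
    by apply: contra nv => ev; apply/flattenP; exists (triple_ends v) => //; exact: map_f.
  by move: nev; rewrite !inE !negb_or eq_sym (eq_sym e) (eq_sym e v.2) => /and3P[/negPf-> /negPf-> /negPf->].
have El' i : map (upd k e x) (legs D i) = map k (legs D i).
  apply/eq_in_map => y yl; rewrite /upd; case: eqP => // Ey.
  by case/negP: nl; apply/flattenP; exists (legs D i); rewrite -?Ey // map_f ?mem_enum.
rewrite /diagram_fun Ev /vertex_product !big_cons /= -/(vertex_product vs (upd k e x)) Ev'.
rewrite (eq_bigr (fun i => theta (map k (legs D i)))); last by move=> i _; rewrite El'.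
rewrite /upd eqxx; rewrite na nb nc nd.
rewrite -/(vertex_product vs k); ring.
Qed.

Hypothesis theta_bracket : forall x y w, theta [:: x, y & w] - theta [:: y, x & w]
  = \sum_(b < 3) (st_coef x y b)%:~R * theta (nat_of_ord b :: w).

(** The new edge joins the new vertex to the circle; summing over its label contracts the structure
    tensor with [theta], which is the bracket of the two legs. *)
Lemma diagram_sum_STU n (D : diagram n) i x y w e : legs D i = [:: x, y & w] ->
    e \notin ends D ->
  diagram_sum D - diagram_sum (set_legs D i [:: y, x & w])
  = diagram_sum (set_ivert (set_legs D i (e :: w)) ((e, x, y) :: ivert D)).
Proof.
move=> El ne; set D' := set_ivert _ _.
have pe : perm_eq (ends D) (ends (set_legs D i [:: y, x & w])).
  by apply: perm_set_legs; rewrite El (perm_catCA [:: x] [:: y]).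
rewrite /diagram_sum (edge_sum_ends _ pe) /edge_sum -sumlabN -sumlabD.
rewrite [RHS](@edge_sum_perm _ (undup (ends D) ++ [:: e])); last first.
  apply: uniq_perm; rewrite ?undup_uniq //.
    by rewrite cats1 rcons_uniq mem_undup ne undup_uniq.
  move=> z; rewrite mem_undup -(perm_mem (perm_stu e El)) mem_cat mem_undup !inE.
  by rewrite orbA orbb orbC.
rewrite [RHS]sumlab_cat; apply: eq_sumlab => c _.
have ne_v v : v \in ivert D -> e \notin triple_ends v.
  move=> vD; apply: contra ne => ev; rewrite mem_cat; apply/orP; left.
  by apply/flattenP; exists (triple_ends v) => //; exact: map_f.
have ne_l k : e \notin legs D k.
  apply: contra ne => el; rewrite mem_cat; apply/orP; right.
  by apply/flattenP; exists (legs D k) => //; rewrite map_f ?mem_enum.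
have map_upd a s : e \notin s -> map (upd c e a) s = map c s.
  move=> es; apply/eq_in_map => z zs; rewrite /upd; case: eqP => // Ez.
  by rewrite -Ez zs in es.
rewrite diagram_fun_set_legs (diagram_funE D i) El /= -mulrBr theta_bracket mulr_sumr.
apply: eq_bigr => b _; rewrite /D' /diagram_fun /= /vertex_product big_cons /=.
rewrite -/(vertex_product (ivert D) (upd c e b)).
have -> : vertex_product (ivert D) (upd c e b) = vertex_product (ivert D) c.
  apply: eq_big_seq => v /ne_v nev; rewrite /upd.
  by move: nev; rewrite !inE !negb_or eq_sym (eq_sym e) (eq_sym e v.2) => /and3P[/negPf-> /negPf-> /negPf->].
rewrite [X in _ = _ * (_ * X)](bigD1 i) //= ffunE eqxx /=.
have -> : \prod_(k < n | k != i) theta (map (upd c e b) (legs (set_legs D i (e :: w)) k))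
    = other_legs D i c.
  by apply: eq_bigr => k /negPf nk; rewrite ffunE nk map_upd.
have := ne_l i; rewrite El !inE !negb_or => /and3P[nx ny nw].
rewrite -/(vertex_product (ivert D) c) map_upd // -edge_weight_st //.
rewrite [vertex_weight K (upd _ _ _ _) _ _]/vertex_weight /upd eqxx.
rewrite eq_sym (negPf nx) eq_sym (negPf ny); ring.
Qed.

Hypothesis theta_rev : forall w, theta (rev w) = (-1) ^+ size w * theta w.

Lemma diagram_sum_rev n (D : diagram n) i :
  diagram_sum (set_legs D i (rev (legs D i))) = (-1) ^+ size (legs D i) * diagram_sum D.
Proof.
have pe : perm_eq (ends D) (ends (set_legs D i (rev (legs D i)))).
  by apply: perm_set_legs; rewrite perm_sym perm_rev.
rewrite /diagram_sum (edge_sum_ends _ pe) /edge_sum -sumlabZ; apply: eq_sumlab => c _.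
rewrite diagram_fun_set_legs (diagram_funE D i) map_rev theta_rev size_map; ring.
Qed.

Hypothesis theta_ad : ad_invariant theta.

Section Slide.
Variables (n : nat) (D : diagram n) (i j : 'I_n) (a b : nat).
Hypotheses (dD : is_diagram D) (ne : i != j).

Definition far_legs c : K := \prod_(k < n | (k != i) && (k != j)) theta (map c (legs D k)).

(** The rest of the diagram as a functional of what is put on the circles [i] and [j], cut at the
    chosen points. *)
Definition contraction (P : seq nat -> seq nat -> K) : K :=
  edge_sum (undup (ends D)) (fun=> 0%N) (fun c =>
    P (map c (rot a (legs D i))) (map c (rot b (legs D j)))
    * (vertex_product (ivert D) c * far_legs c)).

Lemma prod_fun_map (T : Type) (f : seq nat -> K) (g : T -> seq nat) r fs ls :
  prod_fun (map (fun=> f) r ++ fs) (map g r ++ ls)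
  = (\prod_(v <- r) f (g v)) * prod_fun fs ls.
Proof.
elim: r => [|v r IHr] /=; first by rewrite big_nil mul1r.
by rewrite IHr big_cons mulrA.
Qed.

(** All factors together form one function of the concatenated ends, whose variation sums to 0 by
    [edge_sum_ad]. The vertices and the other circles are invariant by themselves, so only the
    variation of [P] is left. *)
Lemma invariant_contraction : invariant contraction.
Proof.
split=> [P Q|k P|x P]; rewrite /contraction.
- by rewrite -edge_sumD; apply: eq_sumlab => c _; rewrite mulrDl.
- by rewrite /edge_sum -sumlabZ; apply: eq_sumlab => c _; rewrite -mulrA.
pose r := [seq k <- enum 'I_n | (k != i) && (k != j)].
pose fs := map (fun=> vertex_fun K) (ivert D) ++ map (fun=> theta) r.
pose ls := map (@triple_ends nat) (ivert D) ++ map (legs D) r.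
pose F (vs : seq (seq nat)) : K :=
  if vs is v :: u :: vs' then P v u * prod_fun fs vs' else 0.
pose ls0 := rot a (legs D i) :: rot b (legs D j) :: ls.
have El c : prod_fun fs (map (map c) ls) = vertex_product (ivert D) c * far_legs c.
  rewrite /fs /ls map_cat -!map_comp prod_fun_map; congr (_ * _).
  have := @prod_fun_map _ theta (map c \o legs D) r [::] [::]; rewrite !cats0 mulr1 => ->.
  by rewrite /r big_filter big_enum_cond.
transitivity (edge_sum (undup (ends D)) (fun=> 0%N) (fun c =>
    ad x (fun v => F (reshape (shape ls0) v)) (map c (flatten ls0)))).
  apply: eq_sumlab => c _.
  rewrite map_flatten (_ : shape ls0 = shape (map (map c) ls0)); last first.
    by rewrite /shape -map_comp; apply: eq_map => v; rewrite /= size_map.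
  rewrite -adl_flatten /ls0 [RHS]/= /F /= !adZr adlZ adl_prod_fun; last first.
  - move=> f; rewrite /fs => /(@List.in_app_or _ _ _ _)[]; rewrite List.in_map_iff.
      by case=> ? [<- _]; exact: vertex_fun_ad.
    by case=> ? [<- _].
  - by rewrite size_map /fs /ls !size_cat !size_map.
  by rewrite mulr0 addr0 El /ad2 mulrDl.
have pe : perm_eq (flatten ls0) (ends D).
  have Ei : perm_eq (rot a (legs D i)) (legs D i) by rewrite perm_rot.
  have Ej : perm_eq (rot b (legs D j)) (legs D j) by rewrite perm_rot.
  apply/seq.permP => P'; rewrite count_ends.
  rewrite /= count_cat (count_perm _ Ei) count_cat (count_perm _ Ej) flatten_cat count_cat.
  rewrite !count_flatten !sumnE !big_map /r big_filter big_enum_cond.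
  rewrite /count_legs [in RHS](bigD1 i) //= [in RHS](bigD1 j) 1?eq_sym //=.
  by rewrite !addnA; congr (_ + _)%N; rewrite addnC addnA.
apply: edge_sum_ad => // [e|e]; rewrite (perm_mem pe) ?mem_undup // => eD.
by rewrite (seq.permP pe); exact: (is_diagramP _ dD).
Qed.

Hypothesis theta_slides : slides theta theta theta.

Lemma diagram_sum_slide :
  diagram_sum D = \sum_(m : (size (legs D i)).-tuple bool) diagram_sum (handle_slide D i j a b m).
Proof.
transitivity (contraction (fun w u => theta w * theta u)).
  apply: eq_sumlab => c _; rewrite (diagram_funE D i) /other_legs (bigD1 j) 1?eq_sym //=.
  rewrite !map_rot !theta_rot /far_legs; ring.
rewrite -(theta_slides invariant_contraction).
under [RHS]eq_bigr => m _.
  rewrite /diagram_sum (edge_sum_ends _ (perm_handle_slide a b ne (size_tuple m))).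
  over.
rewrite -sumlab_sum; apply: eq_sumlab => c _.
rewrite mulr_suml -(tuple_mask_splits (n := size (legs D i))
  (fun s t => theta s * theta (map c (rot b (legs D j)) ++ t) * (vertex_product (ivert D) c * far_legs c)));
  last by rewrite size_map size_rot.
apply: eq_bigr => m _; rewrite /handle_slide diagram_fun_set_legs /=.
rewrite /other_legs (bigD1 i) //= ffunE eqxx.
have -> : \prod_(k < n | (k != j) && (k != i)) theta (map c (legs (set_legs D i
    (mask (map negb m) (rot a (legs D i)))) k)) = far_legs c.
  apply: eq_big => [k|k /andP[_ /negPf nk]]; first exact: andbC.
  by rewrite ffunE nk.
rewrite map_cat !map_mask; ring.
Qed.

End Slide.

Lemma kirby_diagram_sum (omega : forall n, diagram n -> K) :
    slides theta theta theta ->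
    (forall n (D : diagram n), is_diagram D -> omega n D = diagram_sum D) ->
  kirby_weight_system omega.
Proof.
move=> theta_slides E; split; first split.
- move=> n D D' dD same; have dD' : is_diagram D'.
    case: (same) => f [s [r [t [injf El pt al]]]].
    rewrite /is_diagram; apply/allP => e; rewrite (perm_mem (perm_same_ends El pt al)).
    case/mapP=> x xD ->; rewrite (seq.permP (perm_same_ends El pt al)) count_map.
    rewrite (eq_count (a2 := pred1 x)); last by move=> y; rewrite /= (inj_eq injf).
    exact: (allP dD).
  by rewrite !E // (diagram_sum_same same).
- move=> n D a b c vs dD Ev; have [pe ES] := diagram_sum_AS Ev.
  by rewrite !E // (is_diagram_perm pe).
- move=> n D a b c d e vs dD Ev; have [pe1 pe2 ES] := diagram_sum_IHX dD Ev.
  by rewrite !E ?(is_diagram_perm pe1) ?(is_diagram_perm pe2).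
- move=> n D i x y w e dD El ne; rewrite !E ?(diagram_sum_STU El ne) //.
    exact: is_diagram_stu.
  apply: is_diagram_perm dD; apply: perm_set_legs.
  by rewrite El (perm_catCA [:: x] [:: y]).
- move=> n D i dD; rewrite !E //; last first.
    by apply: is_diagram_perm dD; apply: perm_set_legs; rewrite perm_sym perm_rev.
  rewrite diagram_sum_rev -mulrzr rmorphXn /= rmorphN1 mulrAC -exprMn.
  by rewrite mulrNN mulr1 expr1n mul1r.
move=> n D i j a b dD ne; rewrite E // (diagram_sum_slide a b dD ne) //.
apply: eq_bigr => m _; rewrite E //; apply: is_diagram_perm dD.
exact: perm_handle_slide ne (size_tuple m).
Qed.

End DiagramSum.

(** * Reversal *)

Section Reversal.
Variables (K : fieldType) (p : nat).
Hypotheses (p_odd : odd p) (pcharKp : p \in [pchar K]).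

Lemma bin_neq0 n k : (n < p)%N -> (k <= n)%N -> 'C(n, k)%:R != 0 :> K.
Proof.
move=> lt_np le_kn; have fact_neq0 m : (m < p)%N -> m`!%:R != 0 :> K.
  elim: m => [|m IHm] lt_mp; first by rewrite fact0 oner_neq0.
  rewrite factS natrM; apply: mulf_neq0; last exact/IHm/ltnW.
  exact: (natr_neq0 pcharKp).
apply: contraNneq (fact_neq0 n lt_np) => b0.
by rewrite -(bin_fact le_kn) natrM b0 mul0r.
Qed.

Section Form.
Variable d : nat.
Hypothesis lt_dp : (d.+1 < p)%N.

Let v (i : nat) : K := (-1) ^+ i * 'C(d, i)%:R.

(* The invariant bilinear form, which is nondegenerate as d < p. *)
Let S : 'M[K]_d.+1 := \matrix_(i, j) (v i *+ (j == rev_ord i)).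
Let S' : 'M[K]_d.+1 := \matrix_(i, j) ((v j)^-1 *+ (i == rev_ord j)).

Lemma form_inv : S' *m S = 1%:M.
Proof.
apply/mulmx1C/matrixP => i k; rewrite !mxE (bigD1 (rev_ord i)) //= big1 => [|j nj].
  rewrite !mxE eqxx addr0 mulr1n (inj_eq rev_ord_inj); case: eqP => [->|_]; last by rewrite mulr0.
  rewrite mulfV // /v mulf_neq0 ?expf_neq0 ?oppr_eq0 ?oner_neq0 //.
  by apply: bin_neq0; [exact: ltnW | rewrite -ltnS].
by rewrite !mxE (negPf nj) mul0r.
Qed.

(** For e and f this is the ratio [vS] of consecutive coefficients; for h it says that reversing the
    basis negates the weights. *)
Lemma form_rho c : S *m (rho K d.+1 c)^T = - (rho K d.+1 c *m S).
Proof.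
apply/matrixP => i k; rewrite !mxE (bigD1 (rev_ord i)) //= big1 => [|j nj]; last first.
  by rewrite !mxE (negPf nj) mul0r.
rewrite (bigD1 (rev_ord k)) //= [X in _ = - (_ + X)]big1 => [|j nj]; last first.
  by rewrite !mxE [k == _]eq_sym (can2_eq rev_ordK rev_ordK) (negPf nj) mulr0.
rewrite !mxE rev_ordK !eqxx !mulr1n !addr0.
have vS m : (m < d)%N -> v m.+1 * m.+1%:R = - (v m * (d - m)%:R).
  move=> lt_md; rewrite /v exprS mulN1r !mulNr -!mulrA -!natrM.
  by rewrite [('C(d, m.+1) * _)%N]mulnC mul_bin_left mulnC.
have hk : (k <= d)%N by rewrite -ltnS.
have hi : (i <= d)%N by rewrite -ltnS.
have he : v i * ((d.+1 - k)%:R *+ (k == (rev_ord i).+1 :> nat))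
    = - ((d.+1 - i)%:R *+ (i == (rev_ord k).+1 :> nat) * v (rev_ord k)).
  rewrite /= !subSS (_ : (i == (d - k).+1 :> nat) = (k == (d - i).+1 :> nat)); last first.
    by apply/eqP/eqP => E; lia.
  case: eqP => [E|_]; last by rewrite !mulr0n mulr0 mul0r oppr0.
  have Ei : (i : nat) = (d - k).+1 by lia.
  rewrite !mulr1n Ei (_ : (d.+1 - k)%N = (d - k).+1) ?vS; try lia.
  by rewrite mulrC subSS.
have hf : v i * (k.+1%:R *+ (rev_ord i == k.+1 :> nat))
    = - (i.+1%:R *+ (rev_ord k == i.+1 :> nat) * v (rev_ord k)).
  rewrite /= !subSS (_ : (d - k == i.+1)%N = (d - i == k.+1)%N); last first.
    by apply/eqP/eqP => E; lia.
  case: eqP => [E|_]; last by rewrite !mulr0n mulr0 mul0r oppr0.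
  have -> : (d - k)%N = i.+1 by lia.
  by rewrite !mulr1n [_ * v _]mulrC vS ?opprK ?E //; lia.
case: c => [|[|c]].
- rewrite mulrBr he hf mulrBl opprB opprK; exact: addrC.
- rewrite mulrBr mulrN he hf mulrBl mulNr opprB !opprK; exact: addrC.
cbv zeta; rewrite [i == _]eq_sym (can2_eq rev_ordK rev_ordK).
case: (eqVneq k (rev_ord i)) => [->|_]; last first.
  by rewrite !mulr0n mulr0 mul0r oppr0.
rewrite !mulr1n rev_ordK /= mulrC -mulNr; congr (_ * _).
rewrite subSS opprB; apply/eqP; rewrite -subr_eq0 opprB addrACA -opprD -!natrD subr_eq0.
by apply/eqP; congr (_%:R); lia.
Qed.

Lemma form_mprod w : S *m (mprod K d.+1 (rev w))^T = (-1) ^+ size w *: (mprod K d.+1 w *m S).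
Proof.
elim: w => [|x w IHw]; first by rewrite /= trmx1 mulmx1 mul1mx scale1r.
rewrite rev_cons -cats1 mprod_cat trmx_mul /= mulmx1 mulmxA form_rho mulNmx -[rho K d.+1 x *m S *m _]mulmxA IHw.
by rewrite -scalemxAr exprS mulN1r scaleNr mulmxA.
Qed.

(** Transposition reverses a product, and the form conjugates each transposed letter into its
    opposite. *)
Lemma chiS_rev w : chi K d.+1 (rev w) = (-1) ^+ size w * chi K d.+1 w.
Proof.
rewrite /chi -mxtrace_tr -[X in \tr X](mul1mx) -form_inv -mulmxA form_mprod.
by rewrite -scalemxAr mxtraceZ mxtrace_mulC -mulmxA (mulmx1C form_inv) mulmx1.
Qed.

End Form.

Lemma theta_reverse P w : theta K p P (rev w) = (-1) ^+ size w * theta K p P w.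
Proof.
rewrite /theta mulr_sumr; apply: eq_bigr => -[[|d] lt_dp] _ /=.
  by rewrite !mul0r mulr0.
by rewrite chiS_rev // mulrCA.
Qed.

Lemma theta_cat P u w : theta K p P (u ++ w) = theta K p P (w ++ u).
Proof. by apply: eq_bigr => d _; rewrite chi_cat. Qed.

Lemma theta_invariant P : ad_invariant (theta K p P).
Proof.
move=> a w; rewrite /theta ad_sum big1 // => d _.
by rewrite adZ chi_ad mulr0.
Qed.

Lemma theta_commutator P x y w : theta K p P [:: x, y & w] - theta K p P [:: y, x & w]
  = \sum_(b < 3) (st_coef x y b)%:~R * theta K p P (nat_of_ord b :: w).
Proof.
rewrite /theta -sumrB; under [RHS]eq_bigr do rewrite mulr_sumr.
rewrite exchange_big; apply: eq_bigr => d _ /=.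
rewrite -mulrBr /chi /= !mulmxA -raddfB /= -mulmxBl rho_bracket mulmx_suml raddf_sum mulr_sumr.
by apply: eq_bigr => b _; rewrite -scalemxAl /= mxtraceZ mulrCA.
Qed.

End Reversal.

(** * Reduction modulo p *)

Section Integrality.
Variable K : fieldType.
Hypothesis two_neq0 : 2%:R != 0 :> K.

(** The only denominators are the halves in [edge_weight], one for each edge. *)
Lemma edge_sum_int es c (F : (nat -> nat) -> K) (G : (nat -> nat) -> int) :
  (forall c', F c' = (G c')%:~R) ->
  edge_sum es c F * 2%:R ^+ size es
  = (sumlab (fun=> 3%N) (fun=> fun a => if a is 0%N then 1 else -1) es c G)%:~R.
Proof.
move=> E; elim: es c => [|e es IHes] c; first by rewrite /edge_sum /= mulr1.
rewrite /edge_sum /= mulr_suml raddf_sum; apply: eq_bigr => a _ /=.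
rewrite intrM -IHes exprS; case: (nat_of_ord a) => [|b] /=.
  by rewrite mul1r mulrACA mulVf // mul1r.
by rewrite mulrACA !mulNr mulVf // !mul1r.
Qed.

Lemma rho_int d c : rho K d c = map_mx intr (rho int d c).
Proof.
apply/matrixP => i j; rewrite !mxE.
by case: c => [|[|c]]; rewrite ?rmorphB ?rmorphN ?rmorphMn ?rmorphB /= ?rmorph_nat.
Qed.

Lemma chi_int d w : chi K d w = (chi int d w)%:~R.
Proof.
rewrite /chi -[RHS](trace_map_mx intr); congr (\tr _).
by elim: w => [|x w IHw] /=; rewrite ?map_mx1 // map_mxM IHw rho_int.
Qed.

End Integrality.

Section Reduction.
Variable p : nat.
Hypotheses (p_prime : prime p) (p_odd : odd p).

Let pcharFp : p \in [pchar 'F_p]. Proof. exact: pchar_Fp. Qed.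
Let two_neq0_Fp : 2%:R != 0 :> 'F_p. Proof. exact: two_neq0 p_odd pcharFp. Qed.

(** [ratr] divides by the image of the denominator, silently giving 0 if that image is 0; here the
    denominator divides a power of 2 and stays invertible modulo p. *)
Lemma ratr_dyadic (x : rat) (m : int) k : x * 2%:R ^+ k = m%:~R ->
  ratr x * 2%:R ^+ k = m%:~R :> 'F_p.
Proof.
move=> xm; have E : numq x * 2%:R ^+ k = m * denq x.
  apply: (@intr_inj rat); rewrite !intrM rmorphXn /= rmorph_nat -xm.
  by rewrite mulrAC numqE.
have dn0 : (denq x)%:~R != 0 :> 'F_p.
  have : (denq x %| 2 ^+ k)%Z.
    by rewrite -(@Gauss_dvdzr _ (numq x)) ?E ?dvdz_mull // coprimez_sym coprimezE coprime_num_den.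
  case/dvdzP=> q Eq; apply: contraTneq (expf_neq0 k two_neq0_Fp) => d0.
  by rewrite -[2%:R](rmorph_nat intr) -rmorphXn Eq rmorphM /= d0 mulr0 eqxx.
apply: (mulIf dn0); rewrite /ratr mulrAC mulfVK //.
by rewrite -[2%:R](rmorph_nat intr) -rmorphXn -!intrM E.
Qed.

Definition trace_product n (D : diagram n) (K : comNzRingType) (lam : 'I_n -> nat) c : K :=
  \prod_(v <- ivert D) vertex_weight K (c v.1.1) (c v.1.2) (c v.2)
  * \prod_i chi K (lam i).+1 (map c (legs D i)).

Lemma trace_product_int n (D : diagram n) (K : fieldType) lam c :
  trace_product D K lam c = (trace_product D int lam c)%:~R.
Proof.
rewrite /trace_product intrM !rmorph_prod; congr (_ * _); apply: eq_bigr => i _ /=.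
  by rewrite /vertex_weight intrM rmorph_nat intz.
by rewrite chi_int.
Qed.

Lemma ratr_omegaT n (D : diagram n) lam : is_diagram D ->
  ratr (omegaT lam D) = \prod_i (-1) ^+ lam i
    * edge_sum (undup (ends D)) (fun=> 0%N) (trace_product D 'F_p lam) :> 'F_p.
Proof.
move=> dD; have n2 := expf_neq0 (size (undup (ends D))) two_neq0_Fp.
apply: (mulIf n2); rewrite -[RHS]mulrA.
rewrite (edge_sum_int two_neq0_Fp _ _ (@trace_product_int _ D 'F_p lam)).
rewrite (_ : \prod_i (-1) ^+ lam i = (\prod_i (-1) ^+ lam i : int)%:~R); last first.
  by rewrite rmorph_prod; apply: eq_bigr => i _; rewrite rmorphXn /= rmorphN1.
rewrite -intrM; apply: ratr_dyadic.
rewrite omegaT_sum // intrM -mulrA; congr (_ * _).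
  by rewrite rmorph_prod; apply: eq_bigr => i _; rewrite rmorphXn /= rmorphN1.
by rewrite -(edge_sum_int _ _ _ (@trace_product_int _ D rat lam)).
Qed.

(** Colours are dimensions minus 1, and dimension 0 has weight 0. *)
Lemma theta_shift (K : fieldType) (P : pred nat) w : theta K p P w
  = \sum_(l < p.-1 | P l.+1) l.+1%:R * chi K l.+1 w.
Proof.
rewrite /theta -(big_mkord P (fun d => d%:R * chi K d w)).
rewrite -[in LHS](prednK (prime_gt0 p_prime)) big_mkcond big_nat_recl //= mul0r.
by rewrite if_same add0r -big_mkcond big_mkord.
Qed.

(** The signs of [Delta] and of [omegaT] cancel, leaving the dimensions as weights; the sum over
    colourings of a product over circles is then a product of values of [theta]. *)
Lemma omega_diagram_sum n (D : diagram n) (P : pred nat) : is_diagram D ->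
  \sum_(lam : {ffun 'I_n -> 'I_p.-1} | [forall i, P (lam i).+1])
     (Delta (fun i => lam i : nat))%:~R * ratr (omegaT (fun i => lam i : nat) D)
  = diagram_sum (theta 'F_p p P) D :> 'F_p.
Proof.
move=> dD; transitivity (edge_sum (undup (ends D)) (fun=> 0%N) (fun c =>
    \sum_(lam : {ffun 'I_n -> 'I_p.-1} | [forall i, P (lam i).+1])
      (\prod_i (lam i).+1%:R) * trace_product D 'F_p (fun i => lam i : nat) c)).
  rewrite /edge_sum sumlab_sum; apply: eq_bigr => lam _.
  rewrite ratr_omegaT // sumlabZ mulrA; congr (_ * _).
  rewrite /Delta rmorph_prod -big_split; apply: eq_bigr => i _ /=.
  by rewrite intrM rmorphXn rmorphN1 /= mulrAC -exprMn mulrNN mulr1 expr1n mul1r rmorph_nat.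
apply: eq_sumlab => c _; rewrite /diagram_fun.
under [X in _ * X]eq_bigr do rewrite theta_shift.
rewrite (bigA_distr_big (fun l : 'I_p.-1 => P l.+1)) mulr_sumr; apply: eq_big => [lam|lam _].
  by apply/forallP/ffun_onP.
by rewrite big_split mulrCA.
Qed.

Lemma kirby_theta (P : pred nat) (omega : forall n, diagram n -> 'F_p) :
  P = xpredT \/ P = odd ->
  (forall n (D : diagram n), omega n D =
    \sum_(lam : {ffun 'I_n -> 'I_p.-1} | [forall i, P (lam i).+1])
       (Delta (fun i => lam i : nat))%:~R * ratr (omegaT (fun i => lam i : nat) D)) ->
  kirby_weight_system omega.
Proof.
move=> HP E; apply: (@kirby_diagram_sum _ (theta 'F_p p P)) => //.
- exact: theta_cat.
- exact: theta_commutator.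
- exact: theta_reverse.
- exact: theta_invariant.
- exact: slides_theta.
by move=> n D dD; rewrite E omega_diagram_sum.
Qed.

End Reduction.

Theorem theorem1 (p : nat) (p_prime : prime p) (p_odd : odd p) :
  kirby_weight_system (@omega_sl2 p) /\ kirby_weight_system (@omega_so3 p).
Proof.
split.
  apply: (kirby_theta p_prime p_odd (P := xpredT)); first by left.
  by move=> n D; apply: eq_bigl => lam; apply/esym/forallP.
(* Even colours are odd dimensions: [odd l.+1] reduces to [~~ odd l]. *)
by apply: (kirby_theta p_prime p_odd (P := odd)) => [|n D]; first by right.
Qed.
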